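(* Let $G$ be a graph and let $f\colon G\to G$ be a continuous map with zero topological entropy. Then $f$ is Li-Yorke chaotic if and only if there exists an NS-pair for $f$.
   Context: An arc is a space homeomorphic to $[0,1]$. A graph is a continuum (compact connected metric space) $G$, with metric $d$, which is a union of finitely many arcs, any two of which are either disjoint or intersect in at most one common endpoint. A graph map is a continuous map $f\colon G\to G$. A subgraph of $G$ is a subset of $G$ that is itself a graph (in particular closed and non-degenerate). A subgraph $K$ of $G$ is periodic (for $f$) with period $k\in\mathbb{N}=\{1,2,\dots\}$ if $K,f(K),\dots,f^{k-1}(K)$ are pairwise disjoint and $f^k(K)=K$. The $\omega$-limit set of $x$ is $\omega_f(x)=\bigcap_{n\ge1}\overline{\{f^m(x): m\ge n\}}$, and $\omega(f)=\bigcup_{x\in G}\omega_f(x)$. A pair $\langle x,y\rangle\in G\times G$ with $x\ne y$ is an NS-pair for $f$ if $x,y\in\omega(f)$ and there exists a sequence $(J_n)_{n=1}^\infty$ of periodic subgraphs (for $f$) with periods $(m_n)_{n=1}^\infty$ such that $J_n\supset J_{n+1}$ for all $n$, $\lim_{n\to\infty}m_n=\infty$, and $x,y\in J_n$ for all $n\in\mathbb{N}$. A pair $\langle x,y\rangle$ is scrambled if $\liminf_{n\to\infty}d(f^n(x),f^n(y))=0$ but it is not the case that $\lim_{n\to\infty}d(f^n(x),f^n(y))=0$. The map $f$ is Li-Yorke chaotic if there exists an uncountable subset $S\subset G$ such that any two distinct points $x,y\in S$ form a scrambled pair. *)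

(* Defs.v *)
From mathcomp Require Import all_boot all_order all_algebra finmap.
From mathcomp Require Import all_classical all_reals all_analysis.

Set Implicit Arguments.
Unset Strict Implicit.
Unset Printing Implicit Defensive.

Import Order.TTheory GRing.Theory Num.Theory.
Import numFieldNormedType.Exports.

Local Open Scope classical_set_scope.
Local Open Scope ring_scope.

Definition homeomorphism {S T : topologicalType} (A : set S) (B : set T)
    (h : S -> T) (g : T -> S) : Prop :=
  [/\ h @` A = B,
      forall s, A s -> g (h s) = s,
      {within A, continuous h} &
      {within B, continuous g}].

Section Graphs.
Context {R : realType} {G : metricType R}.
Implicit Types (A B K : set G) (p : G).

Definition is_arc A : Prop :=
  exists (h : R -> G) (g : G -> R), homeomorphism (`[0, 1] : set R) A h g.

Definition arc_endpoint A p : Prop :=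
  exists (h : R -> G) (g : G -> R),
    homeomorphism (`[0, 1] : set R) A h g /\ (p = h 0 \/ p = h 1).

Definition is_continuum K : Prop := [/\ K !=set0, compact K & connected K].

Definition is_graph K : Prop :=
  is_continuum K /\
  exists F : set (set G),
    [/\ finite_set F,
        forall A, F A -> is_arc A,
        forall A B, F A -> F B -> A <> B ->
          A `&` B = set0 \/
          exists p, [/\ A `&` B = [set p], arc_endpoint A p & arc_endpoint B p] &
        K = \bigcup_(A in F) A].

End Graphs.

Section Dynamics.
Context {R : realType} {G : metricType R}.
Implicit Types (f : G -> G) (K : set G) (x y : G).

Definition periodic_subgraph f K (k : nat) : Prop :=
  [/\ is_graph K, (0 < k)%N,
      trivIset `I_k (fun i => iter i f @` K) &
      iter k f @` K = K].

Definition omega_limit f x : set G :=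
  \bigcap_(n in [set n | (1 <= n)%N])
    closure [set iter m f x | m in [set m | (n <= m)%N]].

Definition omega f : set G := \bigcup_x omega_limit f x.

Definition NS_pair f x y : Prop :=
  [/\ x <> y, omega f x, omega f y &
      exists (J : nat -> set G) (m : nat -> nat),
        [/\ forall n, periodic_subgraph f (J n) (m n),
            forall n, J n.+1 `<=` J n,
            m n @[n --> \oo] --> \oo &
            forall n, J n x /\ J n y]].

Definition scrambled f x y : Prop :=
  limn_einf (fun n => (mdist (iter n f x) (iter n f y))%:E) = 0%E /\
  ~ (mdist (iter n f x) (iter n f y) @[n --> \oo] --> (0 : R)).

Definition Li_Yorke_chaotic f : Prop :=
  exists S : set G, ~ countable S /\
    forall x y, S x -> S y -> x <> y -> scrambled f x y.

(* Topological entropy in the Bowen-Dinaburg form: the exponential growth rate of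
   maximal (n, e)-separated sets, in the limit e -> 0+. *)
Definition bowen_dist f (n : nat) x y : R :=
  \big[Num.max/0]_(i < n) mdist (iter i f x) (iter i f y).

Definition orbit_separated f (n : nat) (e : R) (E : set G) : Prop :=
  forall x y, E x -> E y -> x <> y -> e < bowen_dist f n x y.

Definition max_separated f (n : nat) (e : R) : \bar R :=
  ereal_sup [set (#|` E|%:R)%:E | E in
    [set E : {fset G} | orbit_separated f n e [set` E]]].

Definition entropy_at_scale f (e : R) : \bar R :=
  limn_esup (fun n => (n%:R^-1)%:E * lne (max_separated f n e))%E.

Definition topological_entropy f : \bar R :=
  lim (entropy_at_scale f e @[e --> 0^'+]).

End Dynamics.

(* Main.v *)
Require Import Defs.
From mathcomp Require Import all_boot all_order all_algebra finmap.
From mathcomp Require Import all_classical all_reals all_analysis.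
From mathcomp Require Import zify lra.

Set Implicit Arguments.
Unset Strict Implicit.
Unset Printing Implicit Defensive.

Import Order.TTheory GRing.Theory Num.Theory.
Import numFieldNormedType.Exports.

Local Open Scope classical_set_scope.
Local Open Scope ring_scope.

(** From chaos to an NS-pair.  Zero entropy excludes horseshoes.  An uncountable scrambled set
contains a point [p] that is not isolated in it and whose omega-limit set [L] is infinite.  For a
small connected neighbourhood [U] of [p] the images [f^m(U)] are not pairwise disjoint, because a
graph does not contain infinitely many disjoint connected sets of large diameter; the gcd of the
differences of the times at which they meet divides the tail [f^N(U), f^(N+1)(U), ...] into
finitely many connected classes permuted cyclically by [f].

If this gcd is unbounded as [U] shrinks, the closures of the classes touch in finitely many points;
a deeper level avoids these points, and joining its classes along their own touching points
produces nested periodic subgraphs with periods tending to infinity.  A non-diagonal limit of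
[(f^m p, f^m q)] then is an NS-pair.

If the gcd stabilises, pass to an iterate for which all tails are connected.  Without a horseshoe
[f^m(U)] contains no arc meeting [L], so once it meets an edge between such arcs it stays between
them.  Hence tails contain no periodic points, [L] lies in every tail, and [f^m p], [f^m q]
eventually lie in a common image of [U].  A non-diagonal limit pair [h(a), h(b)] inside one edge
then forces, by the intermediate value theorem, a periodic point of [L] or of a tail, which is
absurd.

From an NS-pair to chaos.  Pulling the solenoidal tower back along its backward orbit one may
assume that the intersection [K] of the [J_n] contains no vertex, so [K] is a segment [h[a, b]] in
the interior of an edge.  The images of [K] are pairwise disjoint, hence [K] is visited at most
once by an orbit and the NS-pair consists of its end points.  Looking at the sides of [K] on which
the returning images of [K] lie, one finds for every [N] a time [s] such that [f^s] maps both the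
part of [J_N] left of [K] and the part right of [K] onto supersets of some [J_n].  Prescribing
left/right itineraries yields an uncountable scrambled set. *)

(** * Iterates and connected sets *)

(** A continuous image of an arc may spread over several edges, so images are handled only as
    connected sets: what confines them is that their boundaries are finite and that they cannot
    cross a point which they miss. Three obstacles shape the proof. In the solenoidal case the
    closures of disjoint classes may touch, which spoils the disjointness required of periodic
    subgraphs. A touching point is eventually periodic, and a periodic point meets no more disjoint
    classes than its valence allows, so sufficiently deep levels avoid all touching points; joining
    classes there yields periods between two given ones for divisibility, which still tend to
    infinity. In the other case the limit set might leave a connected tail. The missed points would
    be finitely many periodic points, and one of them would attract the orbit along an arm of its
    star, making the limit set finite. Conversely, a vertex inside [K] would give [K] more than two
    sides; going backwards removes it because the backward images of [K] are disjoint while the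
    vertices are finitely many. *)

Definition io (P : nat -> Prop) := forall N, exists n, (N <= n)%N /\ P n.

Lemma io_sub (P Q : nat -> Prop) : (forall n, P n -> Q n) -> io P -> io Q.
Proof. by move=> PQ iP N; have [n [? /PQ ?]] := iP N; exists n. Qed.

Lemma io_pigeon (I : finType) (P : nat -> I -> Prop) :
  io (fun n => exists i, P n i) -> exists i, io (fun n => P n i).
Proof.
move=> iP; apply: contrapT => nP.
have : forall i, exists N, forall n, (N <= n)%N -> ~ P n i.
  move=> i; apply: contrapT => nN; apply: nP; exists i => N.
  apply: contrapT => nM; apply: nN; exists N => n Nn Pn; apply: nM.
  by exists n.
move=> /choice[N NP].
have [n [le_n [i Pi]]] := iP (\max_i N i)%N.
by apply: (NP i n) => //; apply: leq_trans le_n; exact: leq_bigmax.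
Qed.

Section top_generic.
Context {T : topologicalType}.

(** No subsequence is extracted: the values at times in [Q] beyond [N] form a filter base, and any
    cluster point of it is approached infinitely often along [Q]. *)
Lemma io_cluster (Q : nat -> Prop) (u : nat -> T) :
  compact [set: T] -> io Q ->
  exists y : T, forall U, nbhs y U -> io (fun n => Q n /\ U (u n)).
Proof.
move=> cT iQ.
pose D := [set: nat]; pose B (N : nat) := [set x | exists n, [/\ (N <= n)%N, Q n & u n = x]].
have FB : ProperFilter (filter_from D B).
  apply: filter_from_proper; first apply: filter_from_filter.
  - by exists 0%N.
  - move=> i j _ _; exists (maxn i j) => // x [n [le_n Qn <-]].
    by move: le_n; rewrite geq_max => /andP[? ?]; split; exists n.
  - by move=> N _; have [n [? ?]] := iQ N; exists (u n), n.
have /(_ filterT)[y [_ cy]] := cT _ FB.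
exists y => U Uy N.
have [x [[n [? ? xE]] Ux]] := cy (B N) U (ex_intro2 _ _ N I (fun _ => id)) Uy.
by exists n; split=> //; split=> //; rewrite xE.
Qed.

(** The trace of [A] on [Y] is clopen. With [A] an arc of an edge, or a star, whose boundary points
    [Y] misses, this confines [Y]. *)
Lemma trap (Y A : set T) (x : T) : connected Y -> Y x -> A x ->
  open A -> (forall y, Y y -> closure A y -> A y) -> Y `<=` A.
Proof.
move=> cY Yx Ax oA cA.
suff <- : Y `&` A = Y by move=> y [].
apply: cY; first by exists x.
- by exists A.
- exists (closure A); first exact: closed_closure.
  apply/seteqP; split=> y [Yy Ay]; split => //; first exact: subset_closure.
  exact: cA.
Qed.

Lemma closureP (A : set T) x :
  closure A x <-> forall U, nbhs x U -> exists y, A y /\ U y.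
Proof.
split=> [cA U Ux|cA U Ux]; first by have [y [? ?]] := cA _ Ux; exists y.
by have [y [? ?]] := cA _ Ux; exists y.
Qed.

Lemma not_interiorP (A : set T) x :
  ~ interior A x <-> forall U, nbhs x U -> exists y, ~ A y /\ U y.
Proof.
split=> [nA U Ux|nA].
  apply: contrapT => nU; apply: nA; apply: (filterS _ Ux) => y Uy.
  by apply: contrapT => nAy; apply: nU; exists y.
by move=> /nA[y []].
Qed.

End top_generic.

Section Iter.
Context {T : topologicalType} (f : T -> T).

Lemma iter_continuous n : continuous f -> continuous (iter n f).
Proof.
move=> cf; elim: n => [|n IH] x; first exact: cvg_id.
by apply: continuous_comp; [exact: IH|exact: cf].
Qed.

Lemma image_iterD (A : set T) m n : iter (m + n) f @` A = iter m f @` (iter n f @` A).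
Proof.
by rewrite image_comp; congr (_ @` _); apply/funext => x /=; rewrite iterD.
Qed.

Lemma image_iterDC (A : set T) m n : iter (m + n) f @` A = iter n f @` (iter m f @` A).
Proof. by rewrite addnC image_iterD. Qed.

Lemma iter_connected (A : set T) n : continuous f -> connected A -> connected (iter n f @` A).
Proof.
move=> cf cA; apply: connected_continuous_connected => //.
by apply: continuous_subspaceT => x; exact: iter_continuous.
Qed.

Lemma iter_compact (A : set T) n : continuous f -> compact A -> compact (iter n f @` A).
Proof.
move=> cf cA; apply: continuous_compact => //.
by apply: continuous_subspaceT => x; exact: iter_continuous.
Qed.

End Iter.

Section Real.
Context {R : realType}.

(** The cuts are the midpoints of consecutive points among [r.+2] chosen points of [A], so each of
    the [r] gaps contains a chosen point. *)
Lemma infinite_cuts (A : set R) r : infinite_set A -> (forall x, A x -> 0 < x < 1) ->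
  exists c : nat -> R, [/\ forall k, (k <= r)%N -> 0 < c k < 1,
    forall j k, (j < k)%N -> (k <= r)%N -> c j < c k &
    forall k, (k < r)%N -> exists x, A x /\ c k < x < c k.+1].
Proof.
move=> iA A01; have [B BA Br] := infinite_set_fset r.+2 iA.
pose s := sort <=%R (enum_fset B).
have ss : sorted <%R s.
  by rewrite sort_lt_sorted; exact: fset_uniq.
have sz : (r.+2 <= size s)%N by rewrite size_sort.
have sA k : (k < r.+2)%N -> A (nth 0 s k).
  move=> kr; apply: BA => /=.
  have : nth 0 s k \in s by apply: mem_nth; apply: leq_trans sz.
  by rewrite mem_sort.
have sl j k : (j < k)%N -> (k < r.+2)%N -> nth 0 s j < nth 0 s k.
  move=> jk kr; apply: (sorted_ltn_nth lt_trans) => //; rewrite inE.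
    by apply: leq_trans sz; apply: ltn_trans kr.
  by apply: leq_trans sz.
exists (fun k => (nth 0 s k + nth 0 s k.+1) / 2); split.
- move=> k kr; have := A01 _ (sA k _); have := A01 _ (sA k.+1 _).
  have k1 : (k.+1 < r.+2)%N by [].
  by move=> /(_ k1) ? /(_ (ltnW k1)) ?; lra.
- move=> j k jk kr; have := sl j j.+1 (ltnSn _); have := sl k k.+1 (ltnSn _).
  have k1 : (k.+1 < r.+2)%N by [].
  have j1 : (j.+1 < r.+2)%N by apply: leq_ltn_trans k1; apply: leqW.
  move=> /(_ k1) ? /(_ j1) ?.
  have : nth 0 s j.+1 <= nth 0 s k.
    by have [->//|/eqP] := eqVneq j.+1 k; move=> ?; apply/ltW/sl; lia.
  lra.
- move=> k kr; exists (nth 0 s k.+1); split; first by apply: sA; lia.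
  have := sl k k.+1 (ltnSn _); have := sl k.+1 k.+2 (ltnSn _).
  have k1 : (k.+2 < r.+2)%N by [].
  have k2 : (k.+1 < r.+2)%N by lia.
  move=> /(_ k1) ? /(_ k2) ?; lra.
Qed.

End Real.

(** * Arcs and edges of a graph *)

Section Arcs.
Context {R : realType} {G : metricType R}.
Implicit Types (A K Y : set G) (h : R -> G) (g : G -> R).

Lemma homeo_compact A h g a b : homeomorphism (`[0, 1] : set R) A h g ->
  0 <= a -> b <= 1 -> compact (h @` `[a, b]).
Proof.
move=> [_ _ ch _] a0 b1; apply: continuous_compact; last exact: segment_compact.
apply: continuous_subspaceW ch => x /=; rewrite !in_itv /= => /andP[? ?]; lra.
Qed.

Lemma homeo_connected A h g I : homeomorphism (`[0, 1] : set R) A h g ->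
  I `<=` `[0, 1] -> is_interval I -> connected (h @` I).
Proof.
move=> [_ _ ch _] I01 iI; apply: connected_continuous_connected.
  exact/connected_intervalP.
exact: continuous_subspaceW ch.
Qed.

Lemma homeo_inj A h g s t : homeomorphism (`[0, 1] : set R) A h g ->
  0 <= s <= 1 -> 0 <= t <= 1 -> h s = h t -> s = t.
Proof.
move=> [_ gh _ _] s01 t01 hst; rewrite -(gh s) ?hst ?gh //=; rewrite in_itv //=.
Qed.

Lemma homeo_coord_interval A h g Y : homeomorphism (`[0, 1] : set R) A h g ->
  Y `<=` A -> connected Y -> is_interval (g @` Y).
Proof.
move=> [_ _ _ cg] YA cY; apply/connected_intervalP.
apply: connected_continuous_connected => //; exact: continuous_subspaceW cg.
Qed.

(** [arc_endpoint] allows any parametrisation, so ends are recognised topologically: removing [p]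
    leaves the connected set [Y], whereas removing a point with coordinate strictly between 0 and 1
    separates the arc. *)
Lemma homeo_endpoint A h g p : homeomorphism (`[0, 1] : set R) A h g ->
  arc_endpoint A p -> p = h 0 \/ p = h 1.
Proof.
move=> hA [h' [g' [hA' p01]]].
have [hAE gh _ _] := hA; have [hAE' gh' _ _] := hA'.
have Ap : A p.
  by rewrite -hAE'; case: p01 => ->; [exists 0|exists 1] => //=; rewrite in_itv /=; lra.
pose Y := h' @` [set x | 0 <= x <= 1 /\ h' x <> p].
have YA : Y `<=` A.
  by move=> _ [x [x01 _] <-]; rewrite -hAE'; exists x.
have YE y : A y -> y <> p -> Y y.
  rewrite -hAE' => -[x /=]; rewrite in_itv /= => x01 <- h'x; by exists x.
have cY : connected Y.
  apply: (homeo_connected hA') => [x [x01 _]//|].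
  move=> x y [x01 hx] [y01 hy] z xzy; split; first lra.
  move=> hz; case: p01 => pE; move: hz hx hy; rewrite pE.
  - move=> /(homeo_inj hA') zE; have z0 : z = 0 by apply: zE; lra.
    move=> hx _; apply: hx; congr (h' _); lra.
  - move=> /(homeo_inj hA') zE; have z0 : z = 1 by apply: zE; lra.
    move=> _ hx; apply: hx; congr (h' _); lra.
have /(homeo_coord_interval hA YA) iY := cY.
have [x x01 xp] : (h @` `[0, 1]) p by rewrite hAE.
move: x01; rewrite /= in_itv /= => x01.
apply: contrapT => /not_orP[p0 p1].
have x0 : x <> 0 by move=> x0; apply: p0; rewrite -xp x0.
have x1 : x <> 1 by move=> x1; apply: p1; rewrite -xp x1.
have hA01 t : 0 <= t <= 1 -> A (h t) by move=> t01; rewrite -hAE; exists t.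
have Y0 : Y (h 0) by apply: YE => [|/esym//]; apply: hA01; lra.
have Y1 : Y (h 1) by apply: YE => [|/esym//]; apply: hA01; lra.
have [y Yy gy] : (g @` Y) x.
  apply: (iY 0 1); first by exists (h 0) => //; rewrite gh //= in_itv /=; lra.
    by exists (h 1) => //; rewrite gh //= in_itv /=; lra.
  lra.
have Ay := YA _ Yy; move: Ay; rewrite -hAE => -[t /=]; rewrite in_itv /= => t01 hty.
move: gy; rewrite -hty gh /= ?in_itv//= => tx.
case: Yy => z [_ +] zy; apply; by rewrite zy -hty tx xp.
Qed.

(** A graph structure in coordinates. Two edges meet only at end points by the third clause, and in
    at most one point by the fourth, which is stated through the parameter on the first edge. *)
Definition edges K n (h : 'I_n -> R -> G) (g : 'I_n -> G -> R) :=
  [/\ forall i, homeomorphism (`[0, 1] : set R) (h i @` `[0, 1]) (h i) (g i),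
      K = \bigcup_i (h i @` `[0, 1]),
      forall i j s t, i != j -> 0 <= s <= 1 -> 0 <= t <= 1 -> h i s = h j t ->
        (s = 0 \/ s = 1) /\ (t = 0 \/ t = 1) &
      forall i j s t s' t', i != j -> 0 <= s <= 1 -> 0 <= t <= 1 ->
        0 <= s' <= 1 -> 0 <= t' <= 1 ->
        h i s = h j t -> h i s' = h j t' -> s = s'].

Lemma graph_edges K : is_graph K -> exists n (h : 'I_n -> R -> G) (g : 'I_n -> G -> R), edges K h g.
Proof.
move=> [_ [F [/finite_seqP[s0 FE] Farc Fint KE]]].
(* The intersection condition concerns different arcs, so distinct indices have to name distinct
   arcs. *)
pose s := undup s0.
have Fs A : F A <-> A \in s by rewrite FE /s /= mem_undup.
have us : uniq s := undup_uniq s0.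
pose A (i : 'I_(size s)) := nth set0 s i.
have FA i : F (A i) by apply/Fs; exact: mem_nth.
have AF B : F B -> exists i, A i = B.
  move=> /Fs Bs; have lt : (index B s < size s)%N by rewrite index_mem.
  by exists (Ordinal lt); rewrite /A /= nth_index.
have Ainj i j : A i = A j -> i = j.
  by move=> /eqP; rewrite nth_uniq // => /eqP /val_inj.
have /choice[h /choice[g hg]] : forall i, exists h g, homeomorphism (`[0, 1] : set R) (A i) h g.
  by move=> i; exact: (Farc _ (FA i)).
have hA i t : 0 <= t <= 1 -> A i (h i t).
  by move=> t01; have [<- _ _ _] := hg i; exists t.
have E : forall i, h i @` `[0, 1] = A i by move=> i; have [] := hg i.
have meet i j : i != j -> forall s t s' t', 0 <= s <= 1 -> 0 <= t <= 1 ->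
    0 <= s' <= 1 -> 0 <= t' <= 1 -> h i s = h j t -> h i s' = h j t' ->
    [/\ s = 0 \/ s = 1, t = 0 \/ t = 1 & s = s'].
  move=> ij r t r' t' r01 t01 r'01 t'01 e e'.
  have nA : A i <> A j by move/Ainj/eqP; rewrite (negbTE ij).
  have [I0|[p [Ip pi pj]]] := Fint _ _ (FA i) (FA j) nA.
    have : (A i `&` A j) (h i r) by split; [exact: hA|rewrite e; exact: hA].
    by rewrite I0.
  have p1 : h i r = p.
    have : (A i `&` A j) (h i r) by split; [exact: hA|rewrite e; exact: hA].
    by rewrite Ip.
  have p2 : h i r' = p.
    have : (A i `&` A j) (h i r') by split; [exact: hA|rewrite e'; exact: hA].
    by rewrite Ip.
  have inji := homeo_inj (hg i); have injj := homeo_inj (hg j).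
  split; last by apply: inji => //; rewrite p1 p2.
    have [q|q] := homeo_endpoint (hg i) pi; [left|right]; apply: inji; rewrite ?p1 //; lra.
  have [q|q] := homeo_endpoint (hg j) pj; [left|right]; apply: injj; rewrite -?e ?p1 //; lra.
exists (size s), h, g; split => [i|||].
- by rewrite E.
- rewrite KE; apply/seteqP; split=> x [].
    by move=> B /AF[i <-] ?; exists i => //; rewrite E.
  by move=> i _; rewrite E => ?; exists (A i).
- by move=> i j r t ij r01 t01 e; have [? ? _] := meet i j ij r t r t r01 t01 r01 t01 e e.
- by move=> i j r t r' t' ij r01 t01 r'01 t'01 e e'; have [] := meet i j ij r t r' t' r01 t01 r'01 t'01 e e'.
Qed.

End Arcs.

Lemma finType_min {R : realType} (I : finType) (a : I -> R) :
  (forall k, 0 < a k) -> exists2 r, 0 < r & forall k, r <= a k.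
Proof.
move=> a0; suff [r r0 rP] : exists2 r, 0 < r & forall k, k \in enum I -> r <= a k.
  by exists r => // k; apply: rP; rewrite mem_enum.
elim: (enum I) => [|x s [r r0 rP]]; first by exists 1.
exists (Num.min r (a x)); first by rewrite lt_min r0 a0.
move=> k; rewrite inE => /orP[/eqP ->|/rP ?]; rewrite ge_min ?lexx ?orbT //.
by apply/orP; left.
Qed.

Section GraphFacts.
Context {R : realType} {G : metricType R}.
Context n (h : 'I_n -> R -> G) (g : 'I_n -> G -> R).
Hypothesis E : edges [set: G] h g.
Implicit Types (A K Y : set G) (i j : 'I_n).

Local Notation arc i a b := (h i @` `]a, b[%classic).

Lemma edge_homeo i : homeomorphism (`[0, 1] : set R) (h i @` `[0, 1]) (h i) (g i).
Proof. by have [] := E. Qed.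

Lemma edge_inj i s t : 0 <= s <= 1 -> 0 <= t <= 1 -> h i s = h i t -> s = t.
Proof. exact: homeo_inj (edge_homeo i). Qed.

Lemma edge_cover x : exists i s, 0 <= s <= 1 /\ x = h i s.
Proof.
have [_ K _ _] := E; have : [set: G] x by [].
by rewrite K => -[i _ [s]] /=; rewrite in_itv /= => ? <-; exists i, s.
Qed.

Lemma edge_interior i j s t : 0 < s < 1 -> 0 <= t <= 1 -> h i s = h j t -> i = j /\ s = t.
Proof.
move=> s01 t01 e; have [ij|ij] := eqVneq i j.
  by split=> //; subst j; apply: (@edge_inj i) => //; lra.
have [_ _ K _] := E; have [] := K i j s t ij _ t01 e; first lra.
by case=> ?; lra.
Qed.

Lemma edge_K i s : 0 <= s <= 1 -> g i (h i s) = s.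
Proof. by move=> s01; have [_ -> //] := edge_homeo i. Qed.

Lemma edge_closed i a b : 0 <= a -> b <= 1 -> closed (h i @` `[a, b]).
Proof.
move=> a0 b1; apply: compact_closed; first exact: metric_hausdorff.
exact: homeo_compact (edge_homeo i) a0 b1.
Qed.

Lemma graph_compact : compact [set: G].
Proof.
have [_ -> _ _] := E; rewrite bigcup_fset_set; last exact: finite_finset.
apply: bigsetU_compact => i _; exact: homeo_compact (edge_homeo i) _ _.
Qed.

(** The complement is a finite union of compact arcs: the other edges and the two closed pieces left
    on edge [i]. *)
Lemma edge_open i a b : 0 <= a -> b <= 1 -> open (arc i a b).
Proof.
move=> a0 b1.
pose C j := if j == i then h i @` `[0, a] `|` h i @` `[b, 1] else h j @` `[0, 1].
have [ba|ab] := leP b a.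
  by rewrite set_itv_ge ?image_set0 ?bnd_simp -?leNgt //; exact: open0.
have -> : arc i a b = ~` (\bigcup_j C j).
  apply/seteqP; split=> x.
    move=> [s /=]; rewrite in_itv /= => sab <- [j _]; rewrite /C.
    case: eqP => [_|ji].
      case=> -[t /=]; rewrite in_itv /= => t01 /esym/edge_interior [| |_ ?]; lra.
    move=> [t /=]; rewrite in_itv /= => t01 /esym/edge_interior [| |? _]; [lra|lra|].
    exact: ji.
  move=> nC; have [j [s [s01 xE]]] := edge_cover x; subst x.
  have [ji|ji] := eqVneq j i; last first.
    exfalso; apply: nC; exists j => //; rewrite /C (negbTE ji); exists s => //=; rewrite ?in_itv.
  subst j; have [sa|sa] := leP s a.
    exfalso; apply: nC; exists i => //; rewrite /C eqxx; left; exists s => //=.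
    rewrite in_itv /=; lra.
  have [sb|sb] := leP b s.
    exfalso; apply: nC; exists i => //; rewrite /C eqxx; right; exists s => //=.
    rewrite in_itv /=; lra.
  by exists s => //=; rewrite in_itv /= sa sb.
apply: closed_openC; apply: closed_bigcup; first exact: finite_finset.
move=> j _; rewrite /C; case: ifP => _; last exact: edge_closed.
apply: closedU; apply: edge_closed => //; lra.
Qed.

Lemma trap_edge Y i a s b : connected Y -> 0 <= a -> a < s < b -> b <= 1 ->
  Y (h i s) -> ~ Y (h i a) -> ~ Y (h i b) -> Y `<=` arc i a b.
Proof.
move=> cY a0 asb b1 Ys na nb.
apply: (trap cY Ys); [by exists s|exact: edge_open|].
move=> y Yy /(closureS (B := h i @` `[a, b])) cy.
have : closure (h i @` `[a, b]) y.
  by apply: cy => _ [t /= + <-]; rewrite in_itv /= => ?; exists t => //=; rewrite in_itv /=; lra.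
rewrite -(closure_id _).1; last exact: edge_closed.
move=> [t /=]; rewrite in_itv /= => tab yE; exists t => //=; rewrite in_itv /=.
have ta : t != a by apply/eqP => tE; apply: na; rewrite -tE yE.
have tb : t != b by apply/eqP => tE; apply: nb; rewrite -tE yE.
by rewrite !lt_neqAle (eq_sym a) ta tb.
Qed.

Lemma edge_continuous i s U : 0 <= s <= 1 -> nbhs (h i s) U ->
  exists2 e, 0 < e & forall t, 0 <= t <= 1 -> `|t - s| < e -> U (h i t).
Proof.
move=> s01 Us; have [_ _ /subspace_continuousP ch _] := edge_homeo i.
have /(_ U Us) : h i @ within (`[0, 1] : set R) (nbhs s) --> h i s by apply: ch.
rewrite /= => /nbhs_ballP[e /= e0 eU]; exists e => // t t01 tse.
by apply: eU => //; rewrite /ball /= distrC.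
Qed.

Lemma edge_nbhs i s e : 0 < s < 1 -> 0 < e ->
  exists a b, [/\ 0 <= a /\ b <= 1, a < s < b, s - e < a, b < s + e & nbhs (h i s) (arc i a b)].
Proof.
move=> s01 e0; exists (Num.max (s / 2) (s - e / 2)), (Num.min ((s + 1) / 2) (s + e / 2)).
have ? : s / 2 <= Num.max (s / 2) (s - e / 2) < s.
  by rewrite le_max lexx gt_max /=; lra.
have ? : s < Num.min ((s + 1) / 2) (s + e / 2) <= (s + 1) / 2.
  by rewrite ge_min lexx lt_min /= andbT; lra.
split; try lra.
- by rewrite lt_max; apply/orP; right; lra.
- by rewrite gt_min; apply/orP; right; lra.
- apply: open_nbhs_nbhs; split; first by apply: edge_open; lra.
  by exists s => //=; rewrite in_itv /=; lra.
Qed.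

Lemma infinite_edge A : infinite_set A -> exists i, infinite_set [set s | 0 < s < 1 /\ A (h i s)].
Proof.
move=> iA; apply: contrapT => /forallNP nA.
apply: iA.
have fin i : finite_set (h i @` ([set s | 0 < s < 1 /\ A (h i s)] `|` [set 0; 1])).
  apply: finite_image; rewrite finite_setU; split; last exact: finite_set2.
  by apply: contrapT; exact: nA.
apply: (sub_finite_set _ (bigcup_finite (finite_finset (X := [set: 'I_n])) (fun i _ => fin i))).
move=> x Ax; have [i [s [s01 xE]]] := edge_cover x; exists i => //; exists s => //.
have [->|s0] := eqVneq s 0; first by right; left.
have [->|s1] := eqVneq s 1; first by right; right.
left; split; last by rewrite -xE.
by rewrite !lt_neqAle eq_sym s0 s1.
Qed.

(** Infinitely many boundary points would put infinitely many inside one edge. Gaps around four of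
    them supply parameters [a < b < d < e] alternately inside and outside [Y]; trapped between [b]
    and [e], the set [Y] could not contain the point at [a]. *)
Lemma boundary_finite Y : connected Y -> finite_set (closure Y `\` interior Y).
Proof.
move=> cY; apply: contrapT => /infinite_edge [i iB].
have [|c [c01 clt cB]] := infinite_cuts 4 iB; first by move=> x [].
have cP k : (k < 4)%N -> (exists2 s, c k < s < c k.+1 & Y (h i s)) /\
    (exists2 s, c k < s < c k.+1 & ~ Y (h i s)).
  move=> k4; have [x [[x01 [cYx nYx]] xc]] := cB k k4.
  have N : nbhs (h i x) (arc i (c k) (c k.+1)).
    have := c01 k (ltnW k4); have := c01 k.+1 k4 => ? ?.
    apply: open_nbhs_nbhs; split; first by apply: edge_open; lra.
    by exists x => //=; rewrite in_itv.
  split.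
    have [y [Yy [s /= + sE]]] := cYx _ N; rewrite in_itv /= => ?.
    by exists s => //; rewrite sE.
  have [y [nYy [s /= + sE]]] := (not_interiorP _ _).1 nYx _ N; rewrite in_itv /= => ?.
  by exists s => //; rewrite sE.
have [[a ac Ya] _] := cP 0%N isT; have [_ [b bc nYb]] := cP 1%N isT.
have [[d dc Yd] _] := cP 2%N isT; have [_ [e ec nYe]] := cP 3%N isT.
have := c01 0%N isT; have := c01 1%N isT; have := c01 2%N isT; have := c01 3%N isT; have := c01 4%N isT.
move=> ? ? ? ? ?.
have : Y `<=` arc i b e by apply: (@trap_edge Y i b d e) => //; lra.
move=> /(_ _ Ya)[t /=]; rewrite in_itv /= => tbe /edge_inj; move=> /(_ _ _)ta.
have : t = a by apply: ta; lra.
lra.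
Qed.

(** The intermediate value theorem for the displacement [phi] in the coordinate of the edge; the end
    parameters move either both inwards or both outwards. *)
Lemma edge_fixpt (F : G -> G) i s t s' t' : continuous F -> 0 <= s -> s <= t -> t <= 1 ->
  (forall r, s <= r <= t -> exists2 r', 0 <= r' <= 1 & F (h i r) = h i r') ->
  0 <= s' <= 1 -> 0 <= t' <= 1 -> F (h i s) = h i s' -> F (h i t) = h i t' ->
  (s <= s' /\ t' <= t) \/ (s' <= s /\ t <= t') ->
  exists2 r, s <= r <= t & F (h i r) = h i r.
Proof.
move=> cF s0 st t1 Fr s'01 t'01 Fs Ft H.
pose phi r := g i (F (h i r)) - r.
have cphi : {within `[s, t], continuous phi}.
  apply/subspace_continuousP => x /=; rewrite in_itv /= => xst.
  apply: cvgB; last exact: cvg_within.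
  have [x' x'01 FE] := Fr x xst.
  move=> V /=; rewrite FE edge_K // => /nbhs_ballP[e /= e0 eV].
  have [_ _ _ /subspace_continuousP cg] := edge_homeo i.
  have Ax' : (h i @` `[0, 1]) (h i x') by exists x' => //=; rewrite in_itv.
  have gV : nbhs (g i (h i x')) V by rewrite edge_K //; apply/nbhs_ballP; exists e.
  have [d /= d0 dV] := (nbhs_ballP _ _).1 (cg _ Ax' V gV).
  have : nbhs (h i x) (F @^-1` (ball (h i x') d)).
    by apply: cF; rewrite FE; apply: nbhsx_ballx.
  move=> /(edge_continuous _)[|e1 e10 e1P]; first lra.
  apply/nbhs_ballP; exists e1 => //= y; rewrite /ball /= => yx; rewrite in_itv /= => yst.
  have [y' y'01 FyE] := Fr y yst.
  apply: dV; last by rewrite FyE; exists y' => //=; rewrite in_itv.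
  by apply: e1P; [lra|rewrite distrC].
have [|r] := IVT st cphi (v := 0).
  rewrite /phi Fs Ft !edge_K // ge_min le_max; case: H => -[? ?]; apply/andP; split; apply/orP;
  by [left; lra|right; lra].
rewrite in_itv /= => rst /eqP; rewrite subr_eq0 => /eqP rE; exists r => //.
by have [r' r'01 FE] := Fr r rst; move: rE; rewrite FE edge_K // => ->.
Qed.

Definition nstar (I : finType) (gam : I -> R -> G) (e : R) :=
  [set x | exists k s, 0 <= s < e /\ x = gam k s].

(** The local model of a graph at [w]: finitely many arms leave [w], are disjoint and open away from
    it, and their initial pieces form a base of neighbourhoods. Vertices and inner points of edges
    are treated alike. *)
Definition star (w : G) (I : finType) (gam : I -> R -> G) :=
  [/\ [/\ forall k, gam k 0 = w,
      forall k c, 0 < c <= 1 -> open (gam k @` `]0, c[) &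
      forall k l s t, 0 < s <= 1 -> 0 <= t <= 1 -> gam k s = gam l t -> k = l /\ s = t],
      forall k, {within `[0, 1], continuous (gam k)},
      forall U, nbhs w U -> exists2 e, 0 < e <= 1 & nstar gam e `<=` U &
      forall e, 0 < e <= 1 -> nbhs w (nstar gam e)].

Lemma star_exists w : exists (I : finType) (gam : I -> R -> G), star w gam.
Proof.
pose act (x : 'I_n * bool) := exists2 t, 0 <= t <= 1 & h x.1 t = w /\ (if x.2 then t < 1 else 0 < t).
pose I := {x : 'I_n * bool | `[< act x >]}.
have /choice[tau tauP] : forall k : I, exists t, [/\ 0 <= t <= 1, h (val k).1 t = w & 
    if (val k).2 then t < 1 else 0 < t].
  by move=> [x /= /asboolP[t t01 [? ?]]]; exists t.
(* Going only half way to the end of the edge keeps the arm, its tip at [s = 1] included, strictly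
   inside the edge away from [w]. *)
pose al (k : I) := if (val k).2 then (1 - tau k) / 2 else - tau k / 2.
have alP (k : I) s : 0 <= s <= 1 -> 0 <= tau k + s * al k <= 1.
  by have [t01 _] := tauP k; rewrite /al; case: ((val k).2) => ? ?; nra.
have alP' (k : I) s : 0 < s <= 1 -> 0 < tau k + s * al k < 1.
  by have [t01 _] := tauP k; rewrite /al; case: ((val k).2) => ? ?; nra.
have al0 k : 0 < `|al k|.
  rewrite normr_gt0; have [t01 _] := tauP k; rewrite /al; case: ((val k).2) => ?; apply/eqP; nra.
pose gam (k : I) s := h (val k).1 (tau k + s * al k).
have ctsgam k : {within `[0, 1], continuous (gam k)}.
  apply/subspace_continuousP => s /=; rewrite in_itv /= => s01 V Vs.
  have [e e0 eV] := edge_continuous (alP k s s01) Vs.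
  apply/nbhs_ballP; exists (e / `|al k|); first by rewrite /= divr_gt0.
  move=> t; rewrite /ball /= => ts; rewrite in_itv /= => t01.
  apply: eV; first exact: alP.
  rewrite opprD addrACA subrr add0r -mulrBl normrM distrC.
  by rewrite -ltr_pdivlMr.
exists I, gam; split => //.
- split.
  + by move=> k; rewrite /gam mul0r addr0; have [] := tauP k.
  + move=> k c c01.
    have -> : gam k @` `]0, c[ = if (val k).2 then arc (val k).1 (tau k) (tau k + c * al k)
                            else arc (val k).1 (tau k + c * al k) (tau k).
      have := al0 k; rewrite normr_gt0 => ak.
      have [t01 _] := tauP k; rewrite /gam /al in ak *; case: ((val k).2) ak => ak tk.
        apply/seteqP; split=> _ [s /= + <-]; rewrite in_itv /= => s0c.
          by exists (tau k + s * ((1 - tau k) / 2)) => //=; rewrite in_itv /=; nra.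
        exists ((s - tau k) / ((1 - tau k) / 2)); last by rewrite divfK // addrC subrK.
        rewrite /= in_itv /= divr_gt0 ?ltr_pdivrMr /=; nra.
      apply/seteqP; split=> _ [s /= + <-]; rewrite in_itv /= => s0c.
        by exists (tau k + s * (- tau k / 2)) => //=; rewrite in_itv /=; nra.
      exists ((tau k - s) / (tau k / 2)).
        rewrite /= in_itv /= divr_gt0 ?ltr_pdivrMr /=; nra.
      congr (h _ _); rewrite mulNr mulrN divfK; first lra.
      by apply/eqP; lra.
    have [t01 _] := tauP k; have := alP' k c c01; case: ((val k).2) => ? _;
      apply: edge_open; lra.
  + move=> k l s t s01 t01 e.
    have [ikl skl] := edge_interior (alP' k s s01) (alP l t t01) e.
    have [tk01 tkw tkb] := tauP k; have [tl01 tlw tlb] := tauP l.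
    have tkl : tau k = tau l by apply: (@edge_inj (val k).1) => //; rewrite tkw ikl tlw.
    move: skl; rewrite tkl => /addrI; rewrite /al tkl.
    have kl : (val k).2 = (val l).2 -> k = l.
      by move=> ?; apply: val_inj; apply: injective_projections.
    case kE : ((val k).2) tkb kl; case lE : ((val l).2) tlb => tlb tkb kl st.
    * by split; [exact: kl|nra].
    * by exfalso; nra.
    * by exfalso; nra.
    * by split; [exact: kl|nra].
- move=> U Uw.
  have /choice[e eP] : forall k, exists e, 0 < e /\ forall s, 0 <= s <= 1 -> s < e -> U (gam k s).
    move=> k; have Ut : nbhs (h (val k).1 (tau k)) U by have [_ -> _] := tauP k.
    have [e e0 eU] := edge_continuous (let: And3 a _ _ := tauP k in a) Ut.
    exists (e / `|al k|); split; first by rewrite divr_gt0.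
    move=> s s01 se; apply: eU; first exact: alP.
    rewrite addrAC subrr add0r normrM ger0_norm; last lra.
    by rewrite -ltr_pdivlMr.
  have [r r0 rP] := finType_min (fun k => let: conj a _ := eP k in a).
  exists (Num.min r 1); first by rewrite lt_min r0 ltr01 ge_min lexx orbT.
  move=> _ [k [s [+ ->]]]; rewrite lt_min => s01; have [_] := eP k; apply; first lra.
  by have := rP k; lra.
- move=> e e01.
  have [r r0 rP] := finType_min al0.
  (* The images of the [D i] form a closed set that misses [w]. A point outside it is within [r * e]
     of a parameter of [w], hence on an initial piece of an arm, as every arm has speed at least
     [r]. *)
  pose D i := [set s : R | 0 <= s <= 1 /\ forall t, 0 <= t <= 1 -> h i t = w -> r * e <= `|s - t|].
  have re0 : 0 < r * e by nra.
  have cD i : closed (h i @` D i).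
    apply: compact_closed; first exact: metric_hausdorff.
    apply: continuous_compact.
      have [_ _ ch _] := edge_homeo i; apply: continuous_subspaceW ch => s [s01 _] /=.
      by rewrite in_itv.
    have -> : D i = `[0, 1] `&` \bigcap_(t in [set t | 0 <= t <= 1 /\ h i t = w])
        ((fun s => `|s - t|) @^-1` [set y | r * e <= y]).
      apply/seteqP; split=> [s [s01 sP]|s [/=]].
        by split; [rewrite /= in_itv|move=> t [? ?]; apply: sP].
      by rewrite in_itv /= => s01 sP; split=> // t t01 tw; apply: (sP t).
    apply: compact_closedI; first exact: segment_compact.
    apply: closed_bigI => t _; apply: (@closed_comp _ _ (fun s => `|s - t|)); last exact: closed_ge.
    move=> x _; apply: cvg_norm; apply: cvgB; [exact: cvg_id|exact: cvg_cst].
  have : nbhs w (~` \bigcup_i (h i @` D i)).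
    apply: open_nbhs_nbhs; split.
      by apply: closed_openC; apply: closed_bigcup => //; exact: finite_finset.
    move=> [i _ [s [s01 /(_ s s01) sP] sw]]; have := sP sw.
    by rewrite subrr normr0; lra.
  apply: filterS => x nx; have [i [s [s01 xE]]] := edge_cover x.
  have : ~ D i s by move=> Ds; apply: nx; exists i => //; exists s.
  move=> /not_andP[//|/existsNP[t /not_implyP[t01 /not_implyP[tw /negP]]]].
  rewrite -ltNge => st.
  have mk b (ab : act (i, b)) : exists k : I, val k = (i, b) /\ tau k = t.
    have kP : `[< act (i, b) >] by apply/asboolP.
    exists (exist _ (i, b) kP); split=> //.
    have [+ + _] := tauP (exist _ (i, b) kP) => /= ? ?.
    by apply: (@edge_inj i) => //; rewrite tw.
  have [lt_ts|le_st] := ltP t s.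
    have [|k [kE tk]] := mk true; first by exists t => //; split => //=; lra.
    have aE : al k = (1 - t) / 2 by rewrite /al kE tk.
    have := rP k; rewrite aE ger0_norm; last lra.
    move: st; rewrite ger0_norm; last lra.
    move=> st rk; exists k, ((s - t) / al k); split; last first.
      rewrite xE /gam kE tk aE divfK; last by apply/eqP; lra.
      by congr (h _ _); lra.
    rewrite aE divr_ge0 ?ltr_pdivrMr /=; nra.
  have [lt_st|ts] := ltP s t.
    have [|k [kE tk]] := mk false; first by exists t => //; split => //=; lra.
    have aE : al k = - t / 2 by rewrite /al kE tk.
    have := rP k; rewrite aE ler0_norm; last lra.
    move: st; rewrite ler0_norm; last lra.
    move=> st rk; exists k, ((t - s) / (t / 2)); split; last first.
      rewrite xE /gam kE tk aE mulNr mulrN divfK; last by apply/eqP; lra.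
      by congr (h _ _); lra.
    rewrite divr_ge0 ?ltr_pdivrMr /=; nra.
  have {ts le_st}st' : s = t by lra.
  have xw : x = w by rewrite xE st'.
  have [k _] : exists k : I, True.
    have [t1|t1] := ltP t 1.
      by have [|k _] := mk true; [exists t|exists k].
    by have [|k _] := mk false; [exists t => //; split=> //=; lra|exists k].
  exists k, 0; split; first lra.
  by rewrite /gam mul0r addr0 xw; have [] := tauP k.
Qed.

End GraphFacts.

(** * Stars and disjoint connected sets *)

Section StarFacts.
Context {R : realType} {G : metricType R}.
Context (w : G) (I : finType) (gam : I -> R -> G).
Hypothesis S : star w gam.
Implicit Types Y : set G.

Lemma star_closed k a b : 0 <= a -> b <= 1 -> closed (gam k @` `[a, b]).
Proof.
move=> a0 b1; apply: compact_closed; first exact: metric_hausdorff.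
have [_ /(_ k) ch _ _] := S.
apply: continuous_compact; last exact: segment_compact.
by apply: continuous_subspaceW ch => x /=; rewrite !in_itv /= => /andP[? ?]; lra.
Qed.

Lemma nstar_open e : 0 < e <= 1 -> open (nstar gam e).
Proof.
move=> e01; have [[g0 og _] _ _ nw] := S; rewrite openE => x [k [s [se ->]]].
have [->|s0] := eqVneq s 0; first by rewrite g0; exact: nw.
have : nbhs (gam k s) (gam k @` `]0, e[).
  apply: open_nbhs_nbhs; split; first exact: og.
  exists s => //=; rewrite in_itv /= lt_neqAle eq_sym s0; lra.
by apply: filterS => _ [t /= + <-]; rewrite in_itv /= => ?; exists k, t; split => //; lra.
Qed.

Lemma nstar_closure e : 0 < e <= 1 -> closure (nstar gam e) `<=` [set x | exists k s, 0 <= s <= e /\ x = gam k s].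
Proof.
move=> e01.
have -> : [set x | exists k s, 0 <= s <= e /\ x = gam k s] = \bigcup_k gam k @` `[0, e].
  apply/seteqP; split=> x.
    by move=> [k [s [? ->]]]; exists k => //; exists s => //=; rewrite in_itv.
  by move=> [k _ [s /=]]; rewrite in_itv /= => ? <-; exists k, s.
have cU : closed (\bigcup_k gam k @` `[0, e]).
  by apply: closed_bigcup => [|k _]; [exact: finite_finset|apply: star_closed; lra].
rewrite [X in _ `<=` X](closure_id _).1 //; apply: closureS => x [k [s [? ->]]].
by exists k => //; exists s => //=; rewrite in_itv /=; lra.
Qed.

(** The star of radius [e] is left only through the finitely many tips [gam k e]. *)
Lemma star_exit Y e y y' : connected Y -> 0 < e <= 1 -> Y y -> nstar gam e y ->
  Y y' -> ~ nstar gam e y' -> exists k, Y (gam k e).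
Proof.
move=> cY e01 Yy ye Yy' y'e; apply: contrapT => /forallNP nY.
apply: y'e; apply: (trap cY Yy ye (nstar_open e01)) => // x Yx /(nstar_closure e01).
move=> [k [s [se xE]]]; exists k, s; split=> //.
have [sE|ne] := eqVneq s e; first by exfalso; apply: (nY k); rewrite -sE -xE.
by rewrite lt_neqAle ne; lra.
Qed.

Lemma star_trap Y k c t : connected Y -> ~ Y w -> 0 < c <= 1 -> ~ Y (gam k c) ->
  0 < t < c -> Y (gam k t) -> Y `<=` gam k @` `]0, c[.
Proof.
move=> cY nw c01 nc tc Yt; have [[g0 og _] _ _ _] := S.
apply: (trap cY Yt); [by exists t => //=; rewrite in_itv|exact: og|].
move=> y Yy cy; have : closure (gam k @` `[0, c]) y.
  by apply: closureS cy => _ [s /= + <-]; rewrite in_itv /= => ?; exists s => //=; rewrite in_itv /=; lra.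
rewrite -(closure_id _).1; last by apply: star_closed; lra.
move=> [s /=]; rewrite in_itv /= => sc yE; exists s => //=; rewrite in_itv /=.
have s0 : s != 0 by apply/eqP => sE; apply: nw; rewrite -(g0 k) -sE yE.
have s1 : s != c by apply/eqP => sE; apply: nc; rewrite -sE yE.
by rewrite !lt_neqAle (eq_sym 0) s0 s1.
Qed.

Lemma nstar_avoid (J : finType) (c : J -> G) : (forall j, c j <> w) ->
  exists2 e, 0 < e <= 1 & forall j, ~ nstar gam e (c j).
Proof.
move=> cw; have [_ _ nb _] := S.
have /choice[e eP] : forall j, exists e, 0 < e /\ (e <= 1 /\ ~ nstar gam e (c j)).
  move=> j; have [|e /andP[? ?] eU] := nb (~` [set c j]).
    apply: open_nbhs_nbhs; split; last by move=> /= /esym; exact: cw.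
    apply: closed_openC; apply: accessible_closed_set1; apply: hausdorff_accessible.
    exact: metric_hausdorff.
  by exists e; split=> //; split=> // /eU; apply.
have [r r0 rP] := finType_min (fun j => let: conj a _ := eP j in a).
exists (Num.min r 1); first by rewrite lt_min r0 ltr01 ge_min lexx orbT.
move=> j [k [s [+ sE]]]; rewrite lt_min => sr; have [_ [_]] := eP j; apply.
by exists k, s; split=> //; have := rP j; lra.
Qed.

(** At a radius [e] so small that every [C j] has a point off the star, each [C j] contains a tip,
    and disjoint sets contain different tips: the valence of [w] bounds their number. *)
Lemma star_valence (J : finType) (C : J -> set G) (c : J -> G) :
  (forall j, connected (C j)) -> (forall j, closure (C j) w) ->
  (forall j, C j (c j) /\ c j <> w) ->
  (forall i j, i <> j -> C i `&` C j = set0) -> (#|J| <= #|I|)%N.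
Proof.
move=> cC wC cP dC.
have [e e01 eP] := nstar_avoid (fun j => let: conj _ b := cP j in b).
have /choice[k kP] : forall j, exists k, C j (gam k e).
  move=> j; have [_ _ _ /(_ e e01) nw] := S.
  have [y [Cy ye]] := (closureP _ _).1 (wC j) _ nw.
  by apply: (star_exit (cC j) e01 Cy ye (cP j).1 (eP j)).
apply: (leq_card k) => i j kij; apply: contrapT => ij.
have : (C i `&` C j) (gam (k i) e) by split=> //; rewrite kij.
by rewrite dC.
Qed.

End StarFacts.

Section Shrink.
Context {R : realType} {G : metricType R}.
Hypothesis cG : compact [set: G].
Hypothesis stars : forall w : G, exists (I : finType) (gam : I -> R -> G), star w gam.

(** Large sets would accumulate at a point [a] and leave a fixed star around it, so two of them
    would share one of its finitely many tips. *)
Lemma disjoint_connected_small (Y : nat -> set G) (p q : nat -> G) (d : R) : 0 < d ->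
  (forall m, connected (Y m)) -> (forall m, Y m (p m) /\ Y m (q m)) ->
  (forall m m', (m < m')%N -> Y m `&` Y m' = set0) ->
  ~ io (fun m => d <= mdist (p m) (q m)).
Proof.
move=> d0 cY pq dY iod.
have [a aP] := io_cluster p cG iod.
have [I [gam S]] := stars a; have [_ _ nb nw] := S.
have [|e e01 eb] := nb (ball a (d / 2)); first by apply: nbhsx_ballx; lra.
have : io (fun m => exists k, Y m (gam k e)).
  apply: io_sub (aP _ (nw _ e01)) => m [dm pm].
  have [? ?] := pq m; apply: (star_exit S (cY m) e01 (y := p m) (y' := q m)) => // qm.
  move: (eb _ pm) (eb _ qm); rewrite !ballEmdist /= => ? ?.
  have := metric_triangle (p m) a (q m); rewrite (metric_sym (p m) a); lra.
move=> /io_pigeon[k kP].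
have [m [_ Ym]] := kP 0%N; have [m' [mm' Ym']] := kP m.+1.
have : (Y m `&` Y m') (gam k e) by [].
by rewrite dY.
Qed.

End Shrink.

(** * Horseshoes and entropy *)

Section Horseshoe.
Context {R : realType} {G : metricType R} (f : G -> G).

(** Neither arcs nor equal return times are required. This makes the condition easy to obtain from
    covering properties, and it still forces positive entropy. *)
Definition horseshoe := exists (A A1 A2 : set G) (s1 s2 : nat),
  [/\ A !=set0, A1 `<=` A /\ A2 `<=` A, closed A1 /\ closed A2, A1 `&` A2 = set0 &
    A `<=` iter s1 f @` A1 /\ A `<=` iter s2 f @` A2].

Lemma closed_disjoint_dist (A1 A2 : set G) : compact [set: G] ->
  closed A1 -> closed A2 -> A1 `&` A2 = set0 ->
  exists2 e : R, 0 < e & forall x y, A1 x -> A2 y -> e <= mdist x y.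
Proof.
move=> cG c1 c2 d12; apply: contrapT => nE.
have : forall n : nat, exists xy : G * G, [/\ A1 xy.1, A2 xy.2 & mdist xy.1 xy.2 < n.+1%:R^-1].
  move=> n; apply: contrapT => nxy; apply: nE; exists n.+1%:R^-1; first by rewrite invr_gt0.
  by move=> x y A1x A2y; rewrite leNgt; apply/negP => xy; apply: nxy; exists (x, y).
move=> /choice[xy xyP].
have [a aP] := io_cluster (fun n => (xy n).1) cG (Q := fun=> True) (fun N => ex_intro _ N (conj (leqnn N) I)).
have a1 : A1 a.
  rewrite (closure_id A1).1 //; apply/closureP => U /aP/(_ 0%N)[n [_ [_ Un]]].
  by exists (xy n).1; have [] := xyP n.
have a2 : A2 a.
  rewrite (closure_id A2).1 //; apply/closureP => U /nbhs_ballP[e /= e0 eU].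
  have [N _ NP] := near_infty_natSinv_lt (PosNum (divr_gt0 e0 (ltr0Sn R 1))).
  have [|n [Nn [_ bn]]] := aP (ball a (e / 2)) _ N; first by apply: nbhsx_ballx; rewrite divr_gt0.
  exists (xy n).2; have [_ ? dn] := xyP n; split=> //; apply: eU.
  have {}dn := lt_trans dn (NP n Nn : n.+1%:R^-1 < e / 2).
  move: bn; rewrite !ballEmdist /= => ?.
  have := metric_triangle a (xy n).1 (xy n).2; lra.
have : (A1 `&` A2) a by [].
by rewrite d12.
Qed.

Section Words.
Variables (A A1 A2 : set G) (s1 s2 : nat).
Hypotheses (A1A : A1 `<=` A) (A2A : A2 `<=` A) (AN : A !=set0).
Hypotheses (f1 : A `<=` iter s1 f @` A1) (f2 : A `<=` iter s2 f @` A2).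
Variable e : R.
Hypothesis e12 : forall x y, A1 x -> A2 y -> e <= mdist x y.

Fixpoint follow (w : seq bool) (x : G) : Prop :=
  match w with
  | [::] => A x
  | b :: w' => (if b then A1 else A2) x /\ follow w' (iter (if b then s1 else s2) f x)
  end.

Lemma follow_exists w : exists x, follow w x.
Proof.
elim: w => [|b w [y wy]]; first by case: AN => x ?; exists x.
have Ay : A y by case: w wy => //= -[] w [] *; [exact: A1A|exact: A2A].
by case: b; [have [x ? xE] := f1 Ay|have [x ? xE] := f2 Ay]; exists x => /=; rewrite xE.
Qed.

(** Up to the first letter at which the words differ, both orbits have spent the same return times,
    so they are compared at one common time even when [s1] and [s2] differ. *)
Lemma follow_sep w w' x x' : size w = size w' -> w <> w' -> follow w x -> follow w' x' ->
  exists2 i, (i < (maxn s1 s2).+1 * size w)%N & e <= mdist (iter i f x) (iter i f x').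
Proof.
elim: w w' x x' => [|b w IH] [|b' w'] //= x x' [sz] ne [bx wx] [bx' wx'].
have [bb|bb] := eqVneq b b'.
  subst b'; have [|i il ie] := IH w' _ _ sz _ wx wx'; first by move=> ww; apply: ne; rewrite ww.
  exists (i + if b then s1 else s2)%N; last by rewrite !iterD.
  have : ((if b then s1 else s2) <= maxn s1 s2)%N by case: b {bx bx' wx wx' ne ie}; rewrite leq_max leqnn ?orbT.
  by rewrite mulnS; lia.
exists 0%N; first by rewrite muln_gt0.
by case: b b' bb bx bx' {ne wx wx'} => [] [] //= _ ? ?; [exact: e12|rewrite metric_sym; exact: e12].
Qed.

Lemma max_separated_ge n d : 0 < e -> d < e ->
  ((2 ^+ n)%:E <= max_separated f ((maxn s1 s2).+1 * n) d)%E.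
Proof.
move=> e0 de.
have /choice[x xP] : forall w : n.-tuple bool, exists x, follow w x.
  by move=> w; exact: follow_exists.
have sep w w' : w <> w' -> d < bowen_dist f ((maxn s1 s2).+1 * n) (x w) (x w').
  move=> ww'; have [||i il ie] := follow_sep _ _ (xP w) (xP w').
  - by rewrite !size_tuple.
  - by move=> /val_inj.
  rewrite size_tuple in il; apply: lt_le_trans de _; apply: le_trans ie _.
  by rewrite /bowen_dist; apply: (@le_bigmax _ _ _ _ _ (Ordinal il)).
have xinj : injective x.
  move=> w w' xE; apply: contrapT => ww'.
  have [||i _] := follow_sep _ _ (xP w) (xP w'); first by rewrite !size_tuple.
    by move=> /val_inj.
  by rewrite xE mdistxx; lra.
apply: ereal_sup_ubound; exists [fset x w | w in {: n.-tuple bool}]%fset.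
  move=> _ _ /= /imfsetP[w _ ->] /imfsetP[w' _ ->] ne; apply: sep => ww'.
  by apply: ne; rewrite ww'.
rewrite card_imfset //=.
by rewrite -cardE card_tuple card_bool natrX.
Qed.

End Words.

Lemma max_separated_ge1 (x : G) n d : (1 <= max_separated f n d)%E.
Proof.
apply: ereal_sup_ubound; exists [fset x]%fset; last by rewrite cardfs1.
by move=> a b; rewrite /= !inE => /eqP -> /eqP ->.
Qed.

Lemma entropy_at_scale_anti (x : G) d d' : d <= d' ->
  (entropy_at_scale f d' <= entropy_at_scale f d)%E.
Proof.
move=> dd'; rewrite /entropy_at_scale /limn_esup /limf_esup.
have le_n n : ((n%:R^-1)%:E * lne (max_separated f n d') <= (n%:R^-1)%:E * lne (max_separated f n d))%E.
  apply: lee_wpmul2l; first by rewrite lee_fin invr_ge0.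
  have m1 a : max_separated f n a \in `[0%E, +oo%E].
    by rewrite in_itv /= leey andbT; apply: le_trans (max_separated_ge1 x n a); rewrite lee_fin.
  rewrite lee_lne //; apply: ge_ereal_sup => _ [F /= FP <-]; apply: ereal_sup_ubound.
  exists F => //= a b Fa Fb ab; apply: le_lt_trans dd' _; exact: FP.
apply: le_ereal_inf_tmp => _ [V V_oo <-].
apply: (@le_trans _ _ (ereal_sup ((fun n => (n%:R^-1)%:E * lne (max_separated f n d'))%E @` V))).
  by apply: ereal_inf_lbound; exists V.
by apply: ge_ereal_sup => _ [n Vn <-]; apply: le_trans (le_n n) _; apply: ereal_sup_ubound; exists n.
Qed.

(** At lengths [S * N.+1] the words of length [N.+1] give separated sets of growth rate at least
    [ln 2 / S], at every scale below [e]. By monotonicity in the scale the limit at 0 is a supremum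
    and inherits this bound. *)
Lemma horseshoe_entropy : compact [set: G] -> horseshoe -> topological_entropy f <> 0%E.
Proof.
move=> cG [A [A1 [A2 [s1 [s2 [AN [A1A A2A] [c1 c2] d12 [f1 f2]]]]]]].
have [x _] := AN.
have [e e0 eP] := closed_disjoint_dist cG c1 c2 d12.
pose S := (maxn s1 s2).+1.
have lb d : d < e -> ((S%:R^-1 * ln 2)%:E <= entropy_at_scale f d)%E.
  move=> de; rewrite /entropy_at_scale /limn_esup /limf_esup.
  apply: le_ereal_inf_tmp => _ [V [N _ NV] <-].
  apply: (@le_trans _ _ (((S * N.+1)%:R^-1)%:E * lne (max_separated f (S * N.+1) d))%E); last first.
    apply: ereal_sup_ubound; exists (S * N.+1)%N => //; apply: NV => /=.
    by rewrite /S; nia.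
  have := max_separated_ge A1A A2A AN f1 f2 eP N.+1 e0 de; rewrite -/S => le2.
  apply: (@le_trans _ _ (((S * N.+1)%:R^-1)%:E * (N.+1%:R * ln 2)%:E)%E).
    rewrite -EFinM lee_fin natrM invfM -mulrA (mulrA _ N.+1%:R).
    by rewrite mulVf ?pnatr_eq0 // mul1r.
  apply: lee_wpmul2l; first by rewrite lee_fin invr_ge0.
  have -> : (N.+1%:R * ln 2)%:E = lne (2 ^+ N.+1)%:E :> \bar R.
    by rewrite lne_EFin ?exprn_gt0 // lnXn // mulr_natl.
  have le02 : (0 <= (2 ^+ N.+1)%:E :> \bar R)%E by rewrite lee_fin exprn_ge0.
  rewrite lee_lne //; first by rewrite in_itv /= leey andbT.
  by rewrite in_itv /= leey andbT; exact: le_trans le02 le2.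
rewrite /topological_entropy => H.
have /cvg_lim : entropy_at_scale f d @[d --> 0^'+] --> ereal_sup (entropy_at_scale f @` [set` Interval (BRight 0) (BLeft e)]).
  apply: nonincreasing_at_right_cvge; first by rewrite bnd_simp.
  by move=> a b _ _; exact: entropy_at_scale_anti.
rewrite H => /(_ _) H0; have {}H0 := H0 (@ereal_hausdorff R).
have : ((S%:R^-1 * ln 2)%:E <= 0%:E :> \bar R)%E.
  apply: (@le_trans _ _ (ereal_sup [set entropy_at_scale f x | x in `]0, e[])); last by rewrite -H0.
  apply: le_trans (lb (e / 2) _) _; first lra.
  by apply: ereal_sup_ubound; exists (e / 2) => //=; rewrite in_itv /=; lra.
rewrite lee_fin leNgt mulr_gt0 ?invr_gt0 ?ltr0n //; apply: ln_gt0; lra.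
Qed.

End Horseshoe.

(** * Limit sets of sequences *)

(** The cluster points of a sequence; for an orbit this is the omega-limit set. It is also applied
    to pairs of orbits and to sequences of chosen points. *)
Definition lims {T : topologicalType} (u : nat -> T) (y : T) :=
  forall U, nbhs y U -> io (fun n => U (u n)).

Section Lims.
Context {T : topologicalType}.
Implicit Types (u : nat -> T) (y : T).

Lemma lims_closed u : closed (lims u).
Proof.
move=> y cy U Uy; have [z [zu]] := (closureP _ _).1 cy _ (nbhs_interior Uy).
exact: zu.
Qed.

Lemma lims_exists u : compact [set: T] -> exists y, lims u y.
Proof.
move=> cT; have [|y yP] := io_cluster u cT (Q := fun=> True).
  by move=> N; exists N.
by exists y => U /yP; apply: io_sub => n [].
Qed.

Lemma lims_in u y A : closed A -> (exists N, forall n, (N <= n)%N -> A (u n)) ->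
  lims u y -> A y.
Proof.
move=> cA [N NA] uy; rewrite (closure_id A).1 //; apply/closureP => U /uy/(_ N)[n [Nn Un]].
by exists (u n); split => //; exact: NA.
Qed.

Lemma lims_image u y (F : T -> T) : continuous F -> (forall n, u n.+1 = F (u n)) ->
  lims u y -> lims u (F y).
Proof.
move=> cF uS uy U /cF /uy UF N; have [n [Nn Un]] := UF N.
by exists n.+1; split; [exact: leqW|rewrite uS].
Qed.

(** The times at which [F (w n)] is near [y] carry a filter; a cluster point of [w] along it is
    mapped to [y] because the space is Hausdorff. *)
Lemma lims_lift (w : nat -> T) (F : T -> T) y : compact [set: T] -> hausdorff_space T ->
  continuous F -> lims (F \o w) y -> exists2 x, lims w x & F x = y.
Proof.
move=> cT hT cF uy.
pose D := [set NU : nat * set T | nbhs y NU.2].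
pose B (NU : nat * set T) := [set x | exists n, [/\ (NU.1 <= n)%N, NU.2 (F (w n)) & w n = x]].
have FB : ProperFilter (filter_from D B).
  apply: filter_from_proper; first apply: filter_from_filter.
  - by exists (0%N, setT); exact: filterT.
  - move=> [N U] [M V] /= Uy Vy; exists (maxn N M, U `&` V); first exact: filterI.
    by move=> x [n [/=]]; rewrite geq_max => /andP[? ?] [? ?] ?; split; exists n.
  - move=> [N U] /= Uy; have [n [Nn Un]] := uy _ Uy N.
    by exists (w n), n.
have [x [_ cx]] := cT _ FB filterT.
have xP U V N : nbhs x U -> nbhs y V -> exists n, [/\ (N <= n)%N, U (w n) & V (F (w n))].
  move=> Ux Vy; have [z [[n [/= ? ? zE]] Uz]] := cx (B (N, V)) U (ex_intro2 _ _ (N, V) Vy (fun _ => id)) Ux.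
  by exists n; split => //; rewrite zE.
exists x.
  by move=> U Ux N; have [n [? ? _]] := xP _ _ N Ux (@filterT _ (nbhs y) _); exists n.
apply: hT => U V UF Vy; have [n [_ Un Vn]] := xP _ _ 0%N (cF _ _ UF) Vy.
by exists (F (w n)).
Qed.

Lemma lims_back u y (F : T -> T) : compact [set: T] -> hausdorff_space T -> continuous F ->
  (forall n, u n.+1 = F (u n)) -> lims u y -> exists2 x, lims u x & F x = y.
Proof.
move=> cT hT cF uS uy; apply: lims_lift => // U /uy Uio N.
by have [[|n] [Nn Un]] := Uio N.+1; last by exists n; rewrite /= -uS.
Qed.

End Lims.

Section Orbits.
Context {R : realType} {G : metricType R}.
Implicit Types (f : G -> G) (x y p q z w : G).

Lemma separate x y : x <> y -> exists U V : set G, [/\ nbhs x U, nbhs y V & U `&` V = set0].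
Proof.
move=> xy; apply: contrapT => nUV; apply: xy; apply: (@metric_hausdorff _ G) => U V Ux Vy.
apply: contrapT => UV0; apply: nUV; exists U, V; split => //.
rewrite -subset0 => z Uz; apply: UV0; by exists z.
Qed.

Definition orb f p (n : nat) := iter n f p.

Lemma orbS f p n : orb f p n.+1 = f (orb f p n). Proof. by []. Qed.

Lemma orbD f p m n : orb f p (m + n) = iter m f (orb f p n).
Proof. by rewrite /orb iterD. Qed.

Lemma omega_limitE f x : omega_limit f x = lims (orb f x).
Proof.
apply/seteqP; split=> y.
  move=> oy U Uy N; have := oy N.+1 isT => /closureP/(_ _ Uy)[_ [[m /= Nm <-] Um]].
  by exists m; split => //; exact: ltnW.
move=> ly n /= n1; apply/closureP => U /ly/(_ n)[m [nm Um]].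
by exists (iter m f x); split=> //; exists m.
Qed.

Lemma lims_iter_shift f p N : lims (orb f (iter N f p)) = lims (orb f p).
Proof.
apply/seteqP; split=> y ly U /ly Uy M; have [m [Mm Um]] := Uy M.
  by exists (m + N)%N; split; [lia|rewrite /orb iterD].
have [m' [Mm' Um']] := Uy (M + N)%N; exists (m' - N)%N; split; first lia.
by rewrite /orb -iterD subnK //; lia.
Qed.

Lemma orb_finite f p a b : (a < b)%N -> iter a f p = iter b f p -> finite_set (lims (orb f p)).
Proof.
move=> ab e.
pose A := [set iter j f p | j in `I_b].
have fA : finite_set A by exact: finite_image.
have inA m : A (orb f p m).
  elim/ltn_ind: m => m IH; have [mb|bm] := ltnP m b; first by exists m.
  have -> : orb f p m = orb f p (m - b + a).
    by rewrite /orb iterD e -iterD subnK.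
  by apply: IH; lia.
apply: sub_finite_set (fA) => y; apply: lims_in; last by exists 0%N.
apply: compact_closed; first exact: metric_hausdorff.
exact: finite_compact.
Qed.

Lemma infinite_orb_inj f p a b : infinite_set (lims (orb f p)) -> iter a f p = iter b f p -> a = b.
Proof.
move=> iE e; have [ab|ba|//] := ltngtP a b.
  by exfalso; apply: iE; exact: orb_finite e.
by exfalso; apply: iE; exact: (orb_finite ba (esym e)).
Qed.

Lemma attracted_finite f p w a L : continuous f -> (0 < L)%N ->
  (forall U, nbhs w U -> exists n0, forall n, (n0 <= n)%N -> U (iter (a + n * L) f p)) ->
  finite_set (lims (orb f p)).
Proof.
move=> cf L0 aw.
have fA : finite_set [set iter j f w | j in `I_L] by exact: finite_image.
apply: sub_finite_set (fA) => y ly.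
apply: contrapT => ny.
have /choice[UV UVP] : forall j : 'I_L, exists UV : set G * set G, [/\ nbhs y UV.1, nbhs (iter j f w) UV.2 & UV.1 `&` UV.2 = set0].
  move=> j; have [|U [V [? ? ?]]] := @separate y (iter j f w); last by exists (U, V).
  by move=> yE; apply: ny; rewrite yE; exists (val j) => //=; exact: ltn_ord.
have /choice[n0 n0P] : forall j : 'I_L, exists n0, forall n, (n0 <= n)%N -> (UV j).2 (iter (j + (a + n * L)) f p).
  move=> j; have [_ Uj _] := UVP j.
  have [n0 n0P] := aw _ (iter_continuous cf Uj); exists n0 => n /n0P /= H.
  by rewrite iterD.
have /ly : nbhs y [set z | forall j, (UV j).1 z].
  by apply: filter_forall => j; have [] := UVP j.
pose M := (a + (\max_j n0 j).+1 * L)%N.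
move=> /(_ M)[m [Mm Um]].
pose j := Ordinal (ltn_pmod (m - a) L0).
have mE : m = (j + (a + (m - a) %/ L * L))%N.
  rewrite /= addnCA addnC [(_ %% _ + _)%N]addnC -divn_eq subnK //; rewrite /M in Mm; lia.
have [_ _ d] := UVP j.
have : ((UV j).1 `&` (UV j).2) (orb f p m).
  split; first exact: Um.
  rewrite {1}mE; apply: n0P; apply: leq_trans (leq_bigmax j) _.
  by rewrite leq_divRL // /M in Mm *; lia.
by rewrite d.
Qed.

End Orbits.

(** * Arcs that late images of small neighbourhoods do not cover *)

Section Stable.
Context {R : realType} {G : metricType R} (f : G -> G).
Hypothesis cf : continuous f.
Implicit Types (p : G) (U I : set G).

Lemma regular_closed (x : G) U : nbhs x U -> exists V, [/\ nbhs x V, closed V & V `<=` U].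
Proof.
move=> Ux; have [W Wx WU] := uniform_regular Ux.
by exists (closure W); split => //; [apply: filterS Wx; exact: subset_closure|exact: closed_closure].
Qed.

(* Otherwise two disjoint neighbourhoods inside [I] of points of the orbit of [p] would both cover
   [I] under iteration, which is a horseshoe. *)
Lemma stable p I : ~ horseshoe f -> infinite_set (lims (orb f p)) -> open I ->
  (exists e, lims (orb f p) e /\ I e) ->
  exists U N, nbhs p U /\ forall m, (N <= m)%N -> ~ I `<=` iter m f @` U.
Proof.
move=> nH iE oI [e [le Ie]]; apply: contrapT => nU; apply: nH.
have {}nU U N : nbhs p U -> exists m, (N <= m)%N /\ I `<=` iter m f @` U.
  move=> Up; apply: contrapT => nm; apply: nU; exists U, N; split => // m Nm IU.
  by apply: nm; exists m.
have Ie' : nbhs e I by apply: open_nbhs_nbhs.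
have [a [_ Ia]] := le _ Ie' 0%N; have [b [ab Ib]] := le _ Ie' a.+1.
have nab : orb f p a <> orb f p b.
  by move=> /(infinite_orb_inj iE) abE; move: ab; rewrite abE ltnn.
have [U' [V' [Ua Vb dUV]]] := separate nab.
have nI x : I x -> nbhs x I by move=> Ix; apply: open_nbhs_nbhs.
have [V1 [V1a cV1 V1U]] := regular_closed (filterI Ua (nI _ Ia)).
have [V2 [V2b cV2 V2U]] := regular_closed (filterI Vb (nI _ Ib)).
have cov c V : nbhs (orb f p c) V -> exists s, I `<=` iter s f @` V.
  move=> Vc; have [m [cm Im]] := nU _ c (iter_continuous cf Vc).
  exists (m - c)%N => x /Im[y /= Vy <-]; exists (iter c f y) => //.
  by rewrite -iterD subnK.
have [s1 s1P] := cov _ _ V1a; have [s2 s2P] := cov _ _ V2b.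
exists I, V1, V2, s1, s2; split => //.
- by exists e.
- by split=> x; [move/V1U => []|move/V2U => []].
- rewrite -subset0 => x [/V1U[x1 _] /V2U[x2 _]].
  by have : (U' `&` V') x by []; rewrite dUV.
Qed.

Lemma stable_family p (r : nat) (I : nat -> set G) : ~ horseshoe f ->
  infinite_set (lims (orb f p)) ->
  (forall k, (k < r)%N -> open (I k) /\ exists e, lims (orb f p) e /\ I k e) ->
  exists U N, nbhs p U /\ forall k m, (k < r)%N -> (N <= m)%N -> ~ I k `<=` iter m f @` U.
Proof.
move=> nH iE; elim: r => [|r IH] IP.
  by exists setT, 0%N; split => //; exact: filterT.
have [U [N [Up UN]]] := IH (fun k kr => IP k (ltnW kr)).
have [oI eI] := IP r (ltnSn r).
have [V [M [Vp VM]]] := stable nH iE oI eI.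
exists (U `&` V), (maxn N M); split; first exact: filterI.
move=> k m; rewrite ltnS leq_eqVlt => /orP[/eqP ->|kr]; rewrite geq_max => /andP[Nm Mm] H.
  by apply: (VM m Mm); apply: subset_trans H _; apply: image_subset => x [].
by apply: (UN k m kr Nm); apply: subset_trans H _; apply: image_subset => x [].
Qed.

Lemma horseshoe_iter k : horseshoe (iter k f) -> horseshoe f.
Proof.
move=> [A [A1 [A2 [s1 [s2 [? ? ? ? [h1 h2]]]]]]].
exists A, A1, A2, (s1 * k)%N, (s2 * k)%N; split => //.
have E s : iter (s * k) f = iter s (iter k f) by apply/funext => x; rewrite iterM.
by rewrite !E.
Qed.

End Stable.

(** * Minimal sets *)

Section Minimal.
Context {T : topologicalType} (f : T -> T).
Hypothesis cf : continuous f.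

(** Zorn's lemma is applied to complements, that is, to open sets [A] which contain their preimage
    and do not contain [D]; compactness keeps [D] uncovered along chains. *)
Lemma minimal_exists (D : set T) : compact D -> closed D -> D !=set0 -> (forall x, D x -> D (f x)) ->
  exists M, [/\ M `<=` D, closed M, M !=set0, (forall x, M x -> M (f x)) &
    forall M', M' `<=` M -> closed M' -> M' !=set0 -> (forall x, M' x -> M' (f x)) -> M' = M].
Proof.
move=> kD cD D0 fD.
pose P (A : set T) := [/\ open A, (forall x, A (f x) -> A x) & D `\` A !=set0].
have [F FP tF|A [[oA fA DA] Amax]] := @Zorn_bigcup T P.
  split.
  - by apply: bigcup_open => A /FP[].
  - by move=> x [A FA Afx]; exists A => //; have [_ + _] := FP _ FA; apply.
  - have [[A0 FA0]|F0] := pselect (F !=set0); last first.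
      have [x Dx] := D0; exists x; split => // -[A FA _].
      by apply: F0; exists A.
    have FB : ProperFilter (filter_from F (fun A => D `\` A)).
      apply: filter_from_proper; first apply: filter_from_filter.
      + by exists A0.
      + move=> A B FA FB; have [AB|BA] := tF A B FA FB.
          by exists B => // x [Dx nB]; split; split => // /AB.
        by exists A => // x [Dx nA]; split; split => // /BA.
      + by move=> A /FP[].
    have [|x [Dx cx]] := kD _ FB; first by exists A0 => // x [].
    exists x; split => // -[A FA Ax].
    have oAx : nbhs x A by apply: open_nbhs_nbhs; split => //; have [] := FP _ FA.
    have [y [[_ ?] ?]] := cx (D `\` A) A (ex_intro2 _ _ A FA (fun _ => id)) oAx.
    by [].
exists (D `\` A); split => //.
- by rewrite setDE; apply: closedI => //; exact: open_closedC.
- by move=> x [Dx nA]; split; [exact: fD|move=> /fA].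
move=> M' M'M cM' M'0 fM'; apply/seteqP; split => // x [Dx nAx].
apply: contrapT => nM'x; apply: (Amax (~` M')).
  split; first by move=> y Ay M'y; have [] := M'M _ M'y.
  by move=> /(_ x nM'x).
split; first exact: closed_openC.
- by move=> y nM' M'y; apply: nM'; exact: fM'.
- by have [y M'y] := M'0; exists y; split; [have [] := M'M _ M'y|exact].
Qed.

End Minimal.

(** * Connected sets in the coordinate of an edge *)

Section Charts.
Context {R : realType} {G : metricType R}.
Context n (h : 'I_n -> R -> G) (g : 'I_n -> G -> R).
Hypothesis E : edges [set: G] h g.
Implicit Types (Y U V : set G) (i : 'I_n).
Local Notation arc i a b := (h i @` `]a, b[%classic).

Lemma arcP i a b s : 0 <= a -> b <= 1 -> 0 <= s <= 1 -> arc i a b (h i s) <-> a < s < b.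
Proof.
move=> a0 b1 s01; split=> [[t /=]|sab]; last by exists s => //=; rewrite in_itv.
rewrite in_itv /= => tab /(edge_inj E) e; have <- : t = s by apply: e; lra.
by [].
Qed.

Lemma arc_interval i Y s t r : connected Y -> Y `<=` h i @` `[0, 1] ->
  0 <= s -> t <= 1 -> s <= r <= t -> Y (h i s) -> Y (h i t) -> Y (h i r).
Proof.
move=> cY Yi s0 t1 srt Ys Yt.
have iY := homeo_coord_interval (edge_homeo E i) Yi cY.
have [y Yy gy] : (g i @` Y) r.
  by apply: (iY s t) => //; [exists (h i s)|exists (h i t)] => //; rewrite (edge_K E) //; lra.
have [r' /=] := Yi _ Yy; rewrite in_itv /= => r'01 r'y.
by move: gy; rewrite -r'y (edge_K E) // => <-; rewrite r'y.
Qed.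

Lemma arc_sub01 i a b : 0 <= a -> b <= 1 -> arc i a b `<=` h i @` `[0, 1].
Proof. by move=> a0 b1 _ [s /= + <-]; rewrite in_itv /= => ?; exists s => //=; rewrite in_itv /=; lra. Qed.

(** One missed point on each flanking arc suffices to trap [Y]. With flanks that late images do not
    cover, this is how the absence of horseshoes localises images. *)
Lemma hull i Y a b c d s : connected Y -> 0 <= a -> a < b -> b <= s <= c -> c < d -> d <= 1 ->
  Y (h i s) -> ~ arc i a b `<=` Y -> ~ arc i c d `<=` Y -> Y `<=` arc i a d.
Proof.
move=> cY a0 ab bsc cd d1 Ys /existsNP[_ /not_implyP[[u /= + <-]]].
rewrite in_itv /= => uab nu /existsNP[_ /not_implyP[[v /= + <-]]].
rewrite in_itv /= => vcd nv.
have : Y `<=` arc i u v by apply: (trap_edge E cY _ _ _ Ys) => //; lra.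
move=> /subset_trans; apply=> _ [t /= + <-]; rewrite in_itv /= => ?.
by exists t => //=; rewrite in_itv /=; lra.
Qed.

Lemma locally_connected (x : G) U : nbhs x U -> exists V, [/\ nbhs x V, connected V & V `<=` U].
Proof.
move=> Ux; have [I [gam S]] := star_exists E x; have [[g0 _ _] cg nb nw] := S.
have [e e01 eU] := nb _ Ux; exists (nstar gam e); split=> //; first exact: nw.
have -> : nstar gam e = \bigcup_k gam k @` `[0, e[.
  apply/seteqP; split=> y.
    by move=> [k [s [? ->]]]; exists k => //; exists s => //=; rewrite in_itv.
  by move=> [k _ [s /=]]; rewrite in_itv /= => ? <-; exists k, s.
apply: bigcup_connected.
  by exists x => k _; exists 0 => //; rewrite /= in_itv /=; lra.
move=> k _; apply: connected_continuous_connected.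
  exact/connected_intervalP/interval_is_interval.
by apply: continuous_subspaceW (cg k) => s /=; rewrite !in_itv /= => ?; lra.
Qed.

(** Reversing every edge exchanges left and right, so that later arguments need only one
    orientation. *)
Lemma edges_flip : edges [set: G] (fun i s => h i (1 - s)) (fun i x => 1 - g i x).
Proof.
have [H K I J] := E.
have flip i : (fun s => h i (1 - s)) @` `[0, 1] = h i @` `[0, 1].
  apply/seteqP; split=> _ [s /= + <-]; rewrite in_itv /= => ?; exists (1 - s) => //=;
    rewrite ?in_itv /= ?subKr //; lra.
have c1 : continuous (fun s : R => 1 - s).
  by move=> s; apply: cvgB; [exact: cvg_cst|exact: cvg_id].
split.
- move=> i; rewrite flip; have [h1 h2 h3 h4] := H i; split => //.
  + by move=> s /=; rewrite in_itv /= => ?; rewrite h2 ?subKr //= in_itv /=; lra.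
  + apply/subspace_continuousP => s /=; rewrite in_itv /= => s01 V Vs.
    have [|e e0 eV] := edge_continuous E _ Vs; first lra.
    apply/nbhs_ballP; exists e => // t; rewrite /ball /= in_itv /= => ts t01.
    apply: eV; first lra.
    by have -> : 1 - t - (1 - s) = s - t by lra.
  + move=> x; apply: cvgB; [exact: cvg_cst|exact: h4].
- by rewrite K; apply: eq_bigcupr => i _; rewrite flip.
- move=> i j s t ij s01 t01 e.
  have [| |] := I i j (1 - s) (1 - t) ij _ _ e; [lra|lra|].
  by move=> [?|?] [?|?]; split; first [left; lra | right; lra].
- move=> i j s t s' t' ij s01 t01 s'01 t'01 e e'.
  have : 1 - s = 1 - s' by apply: (J i j _ (1 - t) _ (1 - t') ij _ _ _ _ e e'); lra.
  lra.
Qed.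

End Charts.

(** * Connected tails of orbits of neighbourhoods *)

Definition tail_orbit {T : Type} (f : T -> T) (U : set T) (N : nat) : set T :=
  \bigcup_(m in [set m | (N <= m)%N]) iter m f @` U.

Lemma iter_periodic_mod {T : Type} (f : T -> T) z d a :
  iter d f z = z -> iter a f z = iter (a %% d) f z.
Proof.
move=> dz; rewrite [in LHS](divn_eq a d) addnC iterD; congr iter.
by elim: (a %/ d)%N => // m IH; rewrite mulSn iterD IH dz.
Qed.

Section NonSolenoidal.
Context {R : realType} {G : metricType R}.
Context n (h : 'I_n -> R -> G) (g : 'I_n -> G -> R).
Hypothesis E : edges [set: G] h g.
Context (f : G -> G) (p : G).
Hypotheses (cf : continuous f) (nH : ~ horseshoe f).
Hypothesis iE : infinite_set (lims (orb f p)).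
Local Notation arc i a b := (h i @` `]a, b[%classic).
Local Notation cG := (graph_compact E).

Lemma cut_edge (A : set G) r : infinite_set A -> exists i (c : nat -> R),
  [/\ forall k, (k <= r)%N -> 0 < c k < 1,
   forall j k, (j < k)%N -> (k <= r)%N -> c j < c k &
   forall k, (k < r)%N -> exists e, A e /\ arc i (c k) (c k.+1) e].
Proof.
move=> /(infinite_edge E)[i iA]; have [|c [c01 cc cA]] := infinite_cuts r iA.
  by move=> x [].
exists i, c; split=> // k /cA[x [[_ Ax] xc]]; exists (h i x); split => //;
  by exists x => //=; rewrite in_itv.
Qed.

Lemma arcs_stable r i (c : nat -> R) :
  (forall k, (k <= r)%N -> 0 < c k < 1) ->
  (forall k, (k < r)%N -> exists e, lims (orb f p) e /\ arc i (c k) (c k.+1) e) ->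
  exists U N, nbhs p U /\ forall k m V, (k < r)%N -> (N <= m)%N -> V `<=` U ->
    ~ arc i (c k) (c k.+1) `<=` iter m f @` V.
Proof.
move=> c01 cE.
have [|U [N [Up UN]]] := @stable_family _ _ f cf p r (fun k => arc i (c k) (c k.+1)) nH iE.
  move=> k kr; split; last exact: cE.
  by have := c01 k (ltnW kr); have := c01 k.+1 kr => *; apply: (edge_open E); lra.
exists U, N; split=> // k m V kr Nm VU H; apply: (UN k m kr Nm).
by apply: subset_trans H _; exact: image_subset.
Qed.

Lemma visit_arc i (a b : R) M : 0 < a < 1 -> 0 < b < 1 ->
  (exists e, lims (orb f p) e /\ arc i a b e) ->
  exists m (s : R), [/\ (M <= m)%N, a < s < b & h i s = orb f p m].
Proof.
move=> a01 b01 [e [le Ie]].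
have oI : open (arc i a b) by apply: (edge_open E); lra.
have [m [Mm [s /= + sE]]] := le _ (open_nbhs_nbhs (conj oI Ie)) M.
by rewrite in_itv /= => sab; exists m, s.
Qed.

(** At a visit of the orbit to the middle one of three consecutive arcs, the image of [V] covers
    neither outer arc, hence stays within the three. *)
Lemma thin_visit r i (c : nat -> R) U N V k M :
  (forall k, (k <= r)%N -> 0 < c k < 1) ->
  (forall j k, (j < k)%N -> (k <= r)%N -> c j < c k) ->
  (forall k, (k < r)%N -> exists e, lims (orb f p) e /\ arc i (c k) (c k.+1) e) ->
  (forall k m V, (k < r)%N -> (N <= m)%N -> V `<=` U ->
    ~ arc i (c k) (c k.+1) `<=` iter m f @` V) ->
  V p -> connected V -> V `<=` U -> (N <= M)%N -> (k.+2 < r)%N ->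
  exists2 m, (M <= m)%N & iter m f @` V `<=` arc i (c k) (c k.+3).
Proof.
move=> c01 cc cE UN Vp cV VU NM k2.
have k1 := ltnW k2; have k0 := ltnW k1.
have [c0 c1 c2 c3] := And4 (c01 _ (ltnW k0)) (c01 _ k0) (c01 _ k1) (c01 _ k2).
have [l01 l12 l23] := And3 (cc _ _ (ltnSn k) k0) (cc _ _ (ltnSn k.+1) k1) (cc _ _ (ltnSn k.+2) k2).
have [m [s [Mm sc sE]]] := visit_arc M c1 c2 (cE _ k1).
exists m => //; have Nm := leq_trans NM Mm.
apply: (@hull R G n h g E i (iter m f @` V) _ (c k.+1) (c k.+2) _ s); [exact: iter_connected|lra|lra|lra|lra|lra| | |].
- by exists p => //; rewrite sE.
- exact: UN.
- exact: UN.
Qed.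

(** Once an image contains a point of the cycle, so do all later ones. The edge is cut into [d.+1]
    disjoint blocks of three arcs; each block contains a later image, hence a point of a cycle with
    at most [d] points. *)
Lemma avoid_periodic z d : (0 < d)%N -> iter d f z = z ->
  exists U N, nbhs p U /\ forall m j, (N <= m)%N -> ~ (iter m f @` U) (iter j f z).
Proof.
move=> d0 dz; pose r := (3 * d.+1)%N.
have kr (k : 'I_d.+1) : ((3 * k).+2 < r)%N by have := ltn_ord k; rewrite /r; lia.
have klr (k l : 'I_d.+1) : (k < l)%N -> ((3 * k).+3 <= 3 * l)%N by lia.
have [i [c [c01 cc cE]]] := cut_edge r iE.
have [U [N [Up UN]]] := arcs_stable c01 cE.
have [V [Vp cV VU]] := locally_connected E Up.
exists V, N; split=> // m j Nm [y Vy yz].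
have /choice[a aP] : forall k : 'I_d.+1, exists a : 'I_d, arc i (c (3 * k)%N) (c (3 * k).+3) (iter a f z).
  move=> k; have [m' mm' Ym] := thin_visit c01 cc cE UN (nbhs_singleton Vp) cV VU Nm (kr k).
  exists (Ordinal (ltn_pmod (m' - m + j) d0)); rewrite /= -iter_periodic_mod //.
  by apply: Ym; exists y => //; rewrite iterD -yz -iterD subnK.
suff : (#|'I_d.+1| <= #|'I_d|)%N by rewrite !card_ord ltnn.
apply: (leq_card a).
have key (k l : 'I_d.+1) : (k < l)%N -> a k = a l -> False.
  move=> kl akl.
  have lr := ltnW (ltnW (kr l)).
  have c3kl : c (3 * k).+3 <= c (3 * l)%N.
    have := klr _ _ kl; rewrite leq_eqVlt => /orP[/eqP -> //|lt]; apply/ltW; apply: cc lt (ltnW lr).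
  have [c0 c1 c2 c3] := And4 (c01 _ (ltnW (ltnW (ltnW (kr k))))) (c01 _ (kr k)) (c01 _ (ltnW lr)) (c01 _ (kr l)).
  have := aP k; have := aP l; rewrite akl => -[s /= + sE] [t /= + tE].
  rewrite !in_itv /= => ls kt.
  have : s = t by apply: (@edge_inj _ _ _ _ _ E i); [lra|lra|rewrite sE tE].
  lra.
move=> k l akl; apply: val_inj => /=; have [kl|lk|//] := ltngtP k l.
  by case: (key _ _ kl akl).
by case: (key _ _ lk (esym akl)).
Qed.

Hypothesis tail_connected : exists U0, nbhs p U0 /\ forall U, nbhs p U -> connected U ->
  U `<=` U0 -> exists N, forall N', (N <= N')%N -> connected (tail_orbit f U N').

(* The cycle of a periodic point in a late image would have points at two places of one edge; the
   connected tail of a neighbourhood avoiding the cycle would be trapped between them, although the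
   orbit of [p] also visits the edge elsewhere. *)
Lemma no_periodic : exists U N, nbhs p U /\ forall m z d, (N <= m)%N -> (0 < d)%N ->
  iter d f z = z -> ~ (iter m f @` U) z.
Proof.
(* Arcs 0 to 2 and arcs 4 to 6 will each hold a point of the cycle; arc 3 between them and arc 7
   beyond them are visited by the orbit of [p]. *)
have [i [c [c01 cc cE]]] := cut_edge 8 iE.
have [U [N [Up UN]]] := arcs_stable c01 cE.
have [V [Vp cV VU]] := locally_connected E Up.
exists V, N; split=> // m z d Nm d0 dz [y Vy yz].
have Ez k : (k.+2 < 8)%N -> exists j, arc i (c k) (c k.+3) (iter j f z).
  move=> k8; have [m' mm' Ym] := thin_visit c01 cc cE UN (nbhs_singleton Vp) cV VU Nm k8.
  exists (m' - m)%N; apply: Ym; exists y => //.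
  by rewrite -yz -iterD subnK.
have [ja za] := Ez 0%N isT; have [jb zb] := Ez 4%N isT.
have [U2 [N2 [U2p U2N]]] := avoid_periodic d0 dz.
have [U0 [U0p U0c]] := tail_connected.
have [W [Wp cW WU]] := locally_connected E (filterI U2p U0p).
have [N0 N0c] := U0c W Wp cW (fun x Wx => (WU x Wx).2).
pose M := maxn N0 N2; have cO := N0c M (leq_maxl _ _).
have nO j : ~ tail_orbit f W M (iter j f z).
  move=> [m' /= Mm' [x Wx xE]]; apply: (U2N m' j).
    by apply: leq_trans Mm'; exact: leq_maxr.
  by exists x => //; have [] := WU x Wx.
have Op k : (k < 8)%N -> exists s, c k < s < c k.+1 /\ tail_orbit f W M (h i s).
  move=> k8; have [c0 c1] := conj (c01 k (ltnW k8)) (c01 k.+1 k8).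
  have [m' [s [mm' sc sE]]] := visit_arc M c0 c1 (cE k k8).
  exists s; split => //; rewrite sE; exists m' => //.
  by exists p => //; exact: nbhs_singleton.
have [s [sc Os]] := Op 3%N isT; have [t [tc Ot]] := Op 7%N isT.
move: za zb => [a /=]; rewrite in_itv /= => ac aE [b /=]; rewrite in_itv /= => bc bE.
have := c01 0%N isT; have := c01 3%N isT; have := c01 4%N isT; have := c01 7%N isT; have := c01 8%N isT.
move=> ? ? ? ? ?.
have sub : tail_orbit f W M `<=` arc i a b.
  apply: (trap_edge E cO _ _ _ Os); [lra|lra|lra|rewrite aE; exact: nO|rewrite bE; exact: nO].
have := sub _ Ot; rewrite (arcP E); lra.
Qed.

End NonSolenoidal.

Lemma finite_pigeonhole {T : choiceType} (A : set T) (u : nat -> T) :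
  finite_set A -> (forall k, A (u k)) -> exists i j, (i < j)%N /\ u i = u j.
Proof.
move=> /finite_seqP[s ->] uA; apply: contrapT => nu.
have uu : uniq (map u (iota 0 (size s).+1)).
  rewrite map_inj_in_uniq ?iota_uniq // => i j _ _ uij; apply: contrapT => /eqP.
  rewrite neq_ltn => /orP[ij|ji]; apply: nu; first by exists i, j.
  by exists j, i.
have := uniq_leq_size uu (s2 := s); rewrite size_map size_iota ltnn => H.
suff : false by []. apply: H => x /mapP[i _ ->]; exact: uA.
Qed.

(** Two equal points on a backward orbit of [t] close up to a cycle through [t]. *)
Lemma finite_surj_periodic {T : choiceType} (A : set T) (f : T -> T) : finite_set A ->
  (forall t, A t -> exists2 t', A t' & f t' = t) ->
  forall t, A t -> exists2 d, (0 < d)%N & iter d f t = t.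
Proof.
move=> fA fS t At.
have /choice[b bP] : forall t, exists t', A t -> A t' /\ f t' = t.
  move=> x; have [/fS[t' ? ?]|nA] := pselect (A x); first by exists t'.
  by exists x => /nA.
have bA k : A (iter k b t) by elim: k => //= k /bP[].
have bK k : iter k f (iter k b t) = t.
  by elim: k => // k IH; rewrite iterSr /= (bP _ (bA k)).2 IH.
have [i [j [ij e]]] := finite_pigeonhole fA bA.
exists (j - i)%N; first by rewrite subn_gt0.
by rewrite -{1}(bK i) e -iterD subnK ?bK //; exact: ltnW.
Qed.

Lemma common_multiple {T : eqType} (s : seq T) (P : T -> nat -> Prop) :
  (forall t k m, P t k -> P t (k * m)%N) ->
  (forall t, t \in s -> exists2 d, (0 < d)%N & P t d) ->
  exists2 K, (0 < K)%N & forall t, t \in s -> P t K.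
Proof.
move=> PM; elim: s => [|a s IH] Ps; first by exists 1%N.
have [|K K0 KP] := IH; first by move=> t ts; apply: Ps; rewrite inE ts orbT.
have [|d d0 dP] := Ps a; first by rewrite inE eqxx.
exists (d * K)%N; first by rewrite muln_gt0 d0.
by move=> t; rewrite inE => /orP[/eqP ->|/KP]; [exact: PM|rewrite mulnC; exact: PM].
Qed.

(** * Attraction along an arm of a star *)

Section Attract.
Context {R : realType} {G : metricType R}.
Context (w : G) (I : finType) (gam : I -> R -> G).
Hypothesis S : star w gam.

Lemma star_continuous k s U : 0 <= s <= 1 -> nbhs (gam k s) U ->
  exists2 e, 0 < e & forall t, 0 <= t <= 1 -> `|t - s| < e -> U (gam k t).
Proof.
move=> s01 Us; have [_ /(_ k) /subspace_continuousP ck _ _] := S.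
have /(_ U Us) : gam k @ within (`[0, 1] : set R) (nbhs s) --> gam k s by apply: ck.
rewrite /= => /nbhs_ballP[e /= e0 eU]; exists e => // t t01 tse.
by apply: eU => //; rewrite /ball /= distrC.
Qed.

(** Every point of the arm up to [t0] moves strictly towards [w] along the arm. Indeed, goodness of
    a parameter is an open condition, and at the supremum of the bad parameters the image lies, by
    continuity from above, on the arm and not further out; being neither [w] nor the point itself,
    it is strictly closer. The decreasing parameters have no positive limit, since such a limit
    would also be moved closer to [w], and with it the nearby parameters. *)
Lemma star_attract (H : G -> G) k t0 t1 : continuous H -> t0 <= 1 -> 0 < t1 < t0 ->
  H (gam k t0) = gam k t1 ->
  (forall t, 0 < t <= t0 -> H (gam k t) <> w /\ H (gam k t) <> gam k t) ->
  forall U, nbhs w U -> exists n0, forall m, (n0 <= m)%N -> U (iter m H (gam k t0)).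
Proof.
move=> cH t01 t10 Ht0 nH.
have [[g0 og inj] _ nb _] := S.
have Hc s U : 0 <= s <= 1 -> nbhs (H (gam k s)) U ->
  exists2 e, 0 < e & forall t, 0 <= t <= 1 -> `|t - s| < e -> U (H (gam k t)).
  by move=> s01 /cH; exact: star_continuous.
have key t : 0 < t <= t0 -> exists2 t', 0 < t' < t & H (gam k t) = gam k t'.
  pose good t := exists2 t', 0 < t' < t & H (gam k t) = gam k t'.
  pose Bad := [set t | 0 < t <= t0 /\ ~ good t].
  move=> tt0; apply: contrapT => ngt.
  have Bt : Bad t by [].
  have ubB : ubound Bad t0 by move=> x [/andP[]].
  have hsB : has_sup Bad by split; [exists t|exists t0].
  pose s := sup Bad.
  have ts : t <= s by apply: sup_upper_bound.
  have st0 : s <= t0 by apply: ge_sup => //; exists t.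
  have [[s' s's Hs']|ngs] := pselect (good s).
    have Vn : nbhs (H (gam k s)) (gam k @` `]0, ((s' + s) / 2)[).
      apply: open_nbhs_nbhs; split; first by apply: og; lra.
      by exists s'; [rewrite /= in_itv /=; lra|rewrite Hs'].
    have [|e e0 eP] := Hc s _ _ Vn; first lra.
    have m0 : 0 < Num.min e ((s - s') / 2) by rewrite lt_min e0; lra.
    have [r [rt0 ngr] rs] := sup_adherent m0 hsB.
    have rs' : r <= s by apply: sup_upper_bound.
    have := rs; rewrite -/s ltrBlDr -ltrBlDl lt_min => /andP[re rm].
    have [||u /=] := eP r; [lra|by rewrite ltr_norml; lra|].
    by rewrite in_itv /= => uu ue; apply: ngr; exists u; [lra|].
  have lt_st0 : s < t0.
    rewrite lt_neqAle st0 andbT; apply/eqP => sE; apply: ngs; exists t1; rewrite ?sE //.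
  have cl t'' : s < t'' <= t0 -> exists2 r, 0 <= r <= t'' & H (gam k s) = gam k r.
    move=> st''; have cC : closed (gam k @` `[0, t'']) by apply: (star_closed S); lra.
    suff : (gam k @` `[0, t'']) (H (gam k s)) by move=> [r /=]; rewrite in_itv /= => ? ?; exists r.
    rewrite (closure_id (gam k @` `[0, t''])).1 //; apply/closureP => U /(Hc s)[|e e0 eP]; first lra.
    pose u := s + Num.min (e / 2) (t'' - s).
    have u1 : s < u <= t''.
      have : 0 < Num.min (e / 2) (t'' - s) by rewrite lt_min; lra.
      have : Num.min (e / 2) (t'' - s) <= t'' - s by rewrite ge_min lexx orbT.
      rewrite /u; lra.
    have u2 : `|u - s| < e.
      have : Num.min (e / 2) (t'' - s) <= e / 2 by rewrite ge_min lexx.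
      rewrite ger0_norm; rewrite /u in u1 *; lra.
    have : good u.
      apply: contrapT => ngu; have : u <= s by apply: sup_upper_bound => //; split=> //; lra.
      lra.
    move=> [r rr Hr]; exists (H (gam k u)); split; last by apply: eP => //; lra.
    by exists r => //=; rewrite in_itv /=; lra.
  have [|r rt0 Hr] := cl t0; first lra.
  have [Hw Hs] := nH s ltac:(lra).
  have r0 : r != 0 by apply/eqP => rE; apply: Hw; rewrite Hr rE g0.
  have rs0 : r != s by apply/eqP => rE; apply: Hs; rewrite Hr rE.
  have rs : r <= s.
    rewrite leNgt; apply/negP => sr.
    have [|r' r's Hr'] := cl ((s + r) / 2); first lra.
    have [_ rr'] : k = k /\ r = r' by apply: inj; [lra|lra|rewrite -Hr -Hr'].
    lra.
  apply: ngs; exists r => //; rewrite !lt_neqAle rs (eq_sym 0) r0 rs0; lra.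
have /choice[tau tauP] : forall t, exists t', 0 < t <= t0 -> 0 < t' < t /\ H (gam k t) = gam k t'.
  move=> t; have [/key[t' ? ?]|nt] := pselect (is_true (0 < t <= t0)); first by exists t'.
  by exists 0 => /nt.
pose T m := iter m tau t0.
have T0 m : 0 < T m <= t0.
  elim: m => [|m IH]; first by rewrite /T /=; lra.
  by have [? _] := tauP _ IH; rewrite /T /= -/(T m); lra.
have TS m : T m.+1 < T m by have [] := tauP _ (T0 m) => /andP[].
have TH m : iter m H (gam k t0) = gam k (T m).
  by elim: m => //= m ->; have [_ ->] := tauP _ (T0 m).
have Tdec m m' : (m <= m')%N -> T m' <= T m.
  move=> /subnK <-; elim: (m' - m)%N => // j IH.
  by rewrite addSn; apply: le_trans IH; apply: ltW; exact: TS.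
have Tsmall e : 0 < e -> exists m, T m < e.
  move=> e0; apply: contrapT => /forallNP nT.
  have {}nT m : e <= T m by rewrite leNgt; apply/negP/nT.
  have hiT : has_inf (range T) by split; [exists t0, 0%N|exists e => _ [m _ <-]].
  pose L := inf (range T).
  have LT m : L <= T m by apply: ge_inf; [have [] := hiT|exists m].
  have eL : e <= L by apply: lb_le_inf => [|_ [m _ <-]] //; exists t0, 0%N.
  have L0 : 0 < L <= t0 by have := LT 0%N; rewrite /T /=; lra.
  have [s's Hs'] := tauP _ L0.
  have Vn : nbhs (H (gam k L)) (gam k @` `]0, L[).
    apply: open_nbhs_nbhs; split; first by apply: og; lra.
    by exists (tau L); [rewrite /= in_itv /=; lra|rewrite Hs'].
  have [|d d0 dP] := Hc L _ _ Vn; first lra.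
  have [_ [m _ <-] mL] := inf_adherent d0 hiT.
  have LTm := LT m; have := T0 m => Tm0.
  rewrite -/L in mL; have [||u /=] := dP (T m); [lra|by rewrite ltr_norml; lra|].
  rewrite in_itv /= => uL; have [_ ->] := tauP _ Tm0 => uE.
  have TSm := T0 m.+1; have LTS := LT m.+1; rewrite /T /= -/(T m) in TSm LTS.
  have [_ uu] : k = k /\ u = tau (T m) by apply: inj => //; lra.
  lra.
move=> U /nb[e e01 eU].
have [|n0 n0P] := Tsmall e; first lra.
exists n0 => m nm; rewrite TH; apply: eU; exists k, (T m); split => //.
have := Tdec _ _ nm; have := T0 m; lra.
Qed.

End Attract.

(** * Limit sets inside invariant connected sets *)

Section OmegaInvariant.
Context {R : realType} {G : metricType R}.
Context n (h : 'I_n -> R -> G) (g : 'I_n -> G -> R).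
Hypothesis E : edges [set: G] h g.
Context (f : G -> G).
Hypothesis cf : continuous f.
Local Notation cG := (graph_compact E).

Lemma omega_surj p e : lims (orb f p) e -> exists2 e', lims (orb f p) e' & f e' = e.
Proof. by apply: lims_back => //; [exact: cG|exact: metric_hausdorff]. Qed.

(** Otherwise orbit points tending to [w] have [K]-th predecessors off the star of radius [e]; a
    limit [y] of these is a limit point of the orbit, different from [w], with [f^K y = w]. *)
Lemma backward_close p w K (I : finType) (gam : I -> R -> G) :
  star w gam -> (forall m, orb f p m <> w) ->
  (forall x, lims (orb f p) x -> iter K f x = w -> x = w) ->
  forall e, 0 < e <= 1 -> exists2 e', 0 < e' <= e & forall m, (K <= m)%N ->
    nstar gam e' (orb f p m) -> nstar gam e (orb f p (m - K)).
Proof.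
move=> S pw back e e01; apply: contrapT => ne.
have : forall a, exists m, [/\ (K <= m)%N, nstar gam (e / a.+1%:R) (orb f p m) &
    ~ nstar gam e (orb f p (m - K))].
  move=> a; apply: contrapT => nm; apply: ne; exists (e / a.+1%:R).
    have a1 : 1 <= a.+1%:R :> R by rewrite ler1n.
    by rewrite divr_gt0 ?ler_pdivrMr ?ltr0n //=; nra.
  move=> m Km ms; apply: contrapT => nms; apply: nm; by exists m.
move=> /choice[m mP].
have small U : nbhs w U -> exists a0, forall a, (a0 <= a)%N -> U (orb f p (m a)).
  move=> Uw; have [_ _ nb _] := S; have [d d01 dU] := nb _ Uw.
  have [a0 _ a0P] := near_infty_natSinv_lt (PosNum (let: conj a _ := andP d01 in a)).
  exists a0 => a /a0P /= ad; apply: dU; have [_ [k [s [sa ->]]] _] := mP a.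
  exists k, s; split=> //; have ed : e / a.+1%:R < d.
    by apply: le_lt_trans ad; rewrite ler_piMl ?invr_ge0 //; lra.
  by case/andP: sa => s0 sa; rewrite s0 /=; exact: lt_trans ed.
have [y ly] := lims_exists (fun a => orb f p (m a - K)) cG.
have ny : ~ nstar gam e y.
  apply: (lims_in (A := ~` nstar gam e)) ly; first by apply: open_closedC; exact: (nstar_open S e01).
  by exists 0%N => a _; have [] := mP a.
have fy : iter K f y = w.
  apply: contrapT => /separate[U [V [Uy Vw UV]]].
  have [a0 a0P] := small _ Vw.
  have [a [a0a Ua]] := ly _ (iter_continuous cf Uy) a0.
  have : (U `&` V) (orb f p (m a)).
    split; last exact: a0P.
    by have [Km _ _] := mP a; have := Ua; rewrite /= /orb -iterD subnKC.
  by rewrite UV.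
(* The times [m a] are unbounded, because the first [N + K] orbit points differ from [w] and avoid a
   small star around it. *)
have Ey : lims (orb f p) y.
  move=> U Uy N.
  have [d d01 dP] := nstar_avoid S (fun j : 'I_(N + K) => pw j).
  have [_ _ _ nw] := S; have [a0 a0P] := small _ (nw _ d01).
  have [a [/a0P a0a Ua]] := ly _ Uy a0.
  exists (m a - K)%N; split=> //; rewrite leqNgt; apply/negP => lt.
  have lt' : (m a < N + K)%N by have [Km _ _] := mP a; rewrite -(subnK Km) ltn_add2r.
  exact: (dP (Ordinal lt')) a0a.
apply: ny; rewrite (back _ Ey fy); have [[g0 _ _] _ _ nw] := S.
exact: nbhs_singleton (nw _ e01).
Qed.

(** The missed limit points [T] lie on the boundary of [O] and are covered by their own image, so
    they are finitely many periodic points. Consider the first entries of the orbit into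
    successively smaller stars around such a point [w0]: with more stars than arms, two of them lie
    on one arm, the later one closer to [w0]. Then [star_attract] makes the orbit converge to [w0]
    along a residue class, and the limit set is finite. *)
Lemma omega_sub_orbit (O : set G) p : connected O -> (forall x, O x -> O (f x)) ->
  (forall z d, (0 < d)%N -> iter d f z = z -> ~ O z) ->
  (forall m, O (orb f p m)) -> infinite_set (lims (orb f p)) -> lims (orb f p) `<=` O.
Proof.
move=> cO fO perO Op iE w0 Ew0; apply: contrapT => nO0.
pose T := [set t | lims (orb f p) t /\ ~ O t].
have Ecl x : lims (orb f p) x -> closure O x.
  by apply: lims_in; [exact: closed_closure|exists 0%N => m _; exact: subset_closure].
have finT : finite_set T.
  apply: sub_finite_set (boundary_finite E cO) => t [lt nOt]; split; first exact: Ecl.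
  by move=> /nbhs_singleton.
have preT x j : lims (orb f p) x -> ~ O (iter j f x) -> T x.
  move=> lx nOj; split=> // Ox; apply: nOj; elim: j => //= j; exact: fO.
have surjT t : T t -> exists2 t', T t' & f t' = t.
  move=> [/omega_surj[e le fe] nOt]; exists e => //; apply: (preT e 1%N) => //=.
  by rewrite fe.
have perT := finite_surj_periodic finT surjT.
have /finite_seqP[s TE] := finT.
have [|t ts|K K0 KP] := @common_multiple _ s (fun t d => iter d f t = t).
- move=> t k m kt; rewrite mulnC iterM; by elim: m => //= m ->.
- by apply: perT; rewrite TE.
have {}KP t : T t -> iter K f t = t by rewrite TE => /KP.
have Tw : T w0 by [].
have [I [gam S]] := star_exists E w0.
have [[g0 og inj] cg nb nw] := S.
have pw m : orb f p m <> w0 by move=> pm; apply: nO0; rewrite -pm.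
have back x : lims (orb f p) x -> iter K f x = w0 -> x = w0.
  move=> lx xw; have Tx : T x by apply: (preT x K) => //; rewrite xw.
  by rewrite -(KP _ Tx).
have [e0 e001 e0P] := nstar_avoid S (fun j : 'I_K => pw j).
have good k : exists2 c, 0 < c <= e0 & forall t, 0 < t < c -> O (gam k t) -> forall u, 0 < u < c -> O (gam k u).
  have [all|] := pselect (forall u, 0 < u < e0 -> O (gam k u)).
    by exists e0; [lra|move=> _ _ _].
  move=> /existsNP[c /not_implyP[ce nOc]]; exists c; first lra.
  move=> t tc Ot; exfalso; apply: (e0P (Ordinal K0)).
  have /(_ _ (Op 0%N))[r /= + <-] : O `<=` gam k @` `]0, c[.
    by apply: (star_trap S cO nO0 _ nOc tc Ot); lra.
  by rewrite in_itv /= => rc; exists k, r; split=> //; lra.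
have /choice[c cP] : forall k, exists c, 0 < c <= e0 /\ forall t, 0 < t < c -> O (gam k t) -> forall u, 0 < u < c -> O (gam k u).
  by move=> k; have [c ? ?] := good k; exists c.
have [e1 e10 e1c] := finType_min (fun k => let: conj a _ := andP (cP k).1 in a).
pose e2 := Num.min e1 e0.
have e201 : 0 < e2 <= 1 by rewrite lt_min ge_min; apply/andP; split; [lra|apply/orP; right; lra].
have e2e0 : e2 <= e0 by rewrite ge_min lexx orbT.
have e2e1 : e2 <= e1 by rewrite ge_min lexx.
have /choice[b bP] : forall e, exists e', 0 < e <= 1 -> 0 < e' <= e /\ (forall m, (K <= m)%N ->
    nstar gam e' (orb f p m) -> nstar gam e (orb f p (m - K))).
  move=> e; have [e01|ne] := pselect (is_true (0 < e <= 1)); last by exists 0 => /ne.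
  by have [e' ? ?] := backward_close S pw back e01; exists e'.
(* An orbit point in the star of radius [eps k.+1] was in the star of radius [eps k] already [K]
   steps before; this makes the first entry times strictly increasing. *)
pose eps k := iter k b e2.
have eps01 k : 0 < eps k <= 1.
  elim: k => [|k IH]; first exact: e201.
  by have [? _] := bP _ IH; rewrite /eps /= -/(eps k); lra.
have epsS k : eps k.+1 <= eps k by have [/andP[]] := bP _ (eps01 k).
have epsd j k : (j <= k)%N -> eps k <= eps j.
  move=> /subnK <-; elim: (k - j)%N => // a IH.
  by rewrite addSn; apply: le_trans IH; exact: epsS.
have epsb k m : (K <= m)%N -> nstar gam (eps k.+1) (orb f p m) -> nstar gam (eps k) (orb f p (m - K)).
  by have [_] := bP _ (eps01 k); apply.
have nstarS a a' x : a <= a' -> nstar gam a x -> nstar gam a' x.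
  by move=> aa' [k [s' [s'a ->]]]; exists k, s'; split=> //; lra.
pose v := #|I|.
have [m [_ mw]] := Ew0 _ (nw _ (eps01 v)) 0%N.
pose r := (m %% K)%N.
pose x j := orb f p (r + j * K).
have xm : x (m %/ K)%N = orb f p m by rewrite /x addnC -divn_eq.
have xS j : nstar gam (eps 0) (x j) -> exists j', j = j'.+1.
  case: j => [|j _]; last by exists j.
  rewrite /x mul0n addn0 => x0; exfalso.
  by apply: (e0P (Ordinal (ltn_pmod m K0))); exact: nstarS e2e0 x0.
have xb k j : nstar gam (eps k.+1) (x j.+1) -> nstar gam (eps k) (x j).
  move=> /epsb; rewrite /x mulSn addnCA addKn; apply; exact: leq_addr.
have /choice[tau tauP] : forall k, exists j, (k <= v)%N -> nstar gam (eps k) (x j) /\ forall j', (j' < j)%N -> ~ nstar gam (eps k) (x j').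
  move=> k; have [kv|kv] := leqP k v; last by exists 0%N.
  have ex : exists j, `[< nstar gam (eps k) (x j) >].
    exists (m %/ K)%N; apply/asboolP; rewrite xm; exact: nstarS (epsd _ _ kv) mw.
  exists (ex_minn ex) => _; case: ex_minnP => j /asboolP ? jmin; split=> // j' jj' /asboolP /jmin.
  by rewrite leqNgt jj'.
have tauS k : (k < v)%N -> (tau k < tau k.+1)%N.
  move=> kv; have [xk1 _] := tauP _ kv; have [_ xk] := tauP _ (ltnW kv).
  have [j jE] := xS _ (nstarS _ _ _ (epsd _ _ (leq0n k.+1)) xk1).
  rewrite jE in xk1 *; rewrite ltnS leqNgt; apply/negP => /xk; apply.
  exact: xb.
have taulow k l : (k < l)%N -> (l <= v)%N -> (tau k < tau l)%N /\ ~ nstar gam (eps l) (x (tau k)).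
  move=> kl lv; have kl' : (tau k < tau l)%N.
    elim: l kl lv => // l IH; rewrite ltnS leq_eqVlt => /orP[/eqP <-|kl] lv; first exact: tauS.
    by apply: ltn_trans (IH kl (ltnW lv)) _; exact: tauS.
  by split=> //; have [_] := tauP _ lv; apply.
have /choice[ks ksP] : forall k : 'I_v.+1, exists kt : I * R, 0 < kt.2 < eps k /\ x (tau k) = gam kt.1 kt.2.
  move=> k; have [[i [t [te xE]]] _] := tauP k (leq_ord k); exists (i, t); split=> //=.
  have : t != 0 by apply/eqP => t0; apply: (pw (r + tau k * K)%N); rewrite -/(x _) xE t0 g0.
  by rewrite -normr_gt0 ger0_norm; lra.
have [k [l [kl kle]]] : exists k l : 'I_v.+1, (k < l)%N /\ (ks k).1 = (ks l).1.
  apply: contrapT => nkl; suff : (#|'I_v.+1| <= #|I|)%N by rewrite card_ord ltnn.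
  apply: (leq_card (fun k => (ks k).1)) => k l e; apply: val_inj => /=.
  have [kl|lk|//] := ltngtP k l; exfalso; apply: nkl; first by exists k, l.
  by exists l, k.
have [kt xk] := ksP k; have [lt xl] := ksP l; rewrite -kle in xl.
set i := (ks k).1 in xk xl; set t0 := (ks k).2 in kt xk; set t1 := (ks l).2 in lt xl.
have [tkl nkl] := taulow _ _ kl (leq_ord l).
have t10 : t1 < t0.
  rewrite ltNge; apply/negP => t01; apply: nkl; exists i, t0; split=> //; lra.
have ek2 : eps k <= e2 := epsd 0%N k (leq0n k).
have t0e : t0 < e2 by lra.
pose L := ((tau l - tau k) * K)%N.
have L0 : (0 < L)%N by rewrite muln_gt0 subn_gt0 tkl.
have HL : iter L f (gam i t0) = gam i t1.
  by rewrite -xk -xl /x -orbD addnCA -mulnDl subnK // ltnW.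
have Oi u : 0 < u <= t0 -> O (gam i u).
  have ci := e1c i; have [ce ciP] := cP i.
  by move=> ut; apply: (ciP t0); [lra|rewrite -xk; exact: Op|lra].
have OL u : O (gam i u) -> O (iter L f (gam i u)).
  by move=> Ou; elim: L {L0 HL} => //= L IH; exact: fO.
have attr := star_attract S (iter_continuous cf (n := L)) (_ : t0 <= 1) (_ : 0 < t1 < t0) HL.
apply: iE; apply: (@attracted_finite _ _ f p w0 (r + tau k * K) L) => // U Uw.
have [|||n0 n0P] := attr _ _ _ U Uw; [lra|lra| |].
  move=> u ut; split=> [uw|]; first by apply: nO0; rewrite -uw; exact/OL/Oi.
  by move=> /(perO _ _ L0); apply; exact: Oi.
exists n0 => a /n0P; rewrite -xk /x /orb -iterM -iterD.
by rewrite [(a * L + _)%N]addnC.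
Qed.

Lemma omega_sub_invariant (O : set G) p : connected O -> (forall x, O x -> O (f x)) ->
  (forall z d, (0 < d)%N -> iter d f z = z -> ~ O z) ->
  (exists N, forall m, (N <= m)%N -> O (orb f p m)) -> infinite_set (lims (orb f p)) ->
  lims (orb f p) `<=` O.
Proof.
move=> cO fO perO [N NO]; rewrite -(lims_iter_shift f p N).
apply: omega_sub_orbit => // m; rewrite /orb -iterD; apply: NO; exact: leq_addl.
Qed.

End OmegaInvariant.

Lemma io_subseq (P : nat -> Prop) : io P ->
  exists s : nat -> nat, (forall k, P (s k)) /\ forall j k, (j < k)%N -> (s j < s k)%N.
Proof.
move=> /choice[nx nxP].
pose s := fix s k := if k is k'.+1 then nx (s k').+1 else nx 0%N.
exists s; split; first by case=> [|k] /=; [case: (nxP 0%N)|case: (nxP (s k).+1)].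
move=> j k; elim: k => // k IH; rewrite ltnS leq_eqVlt => /orP[/eqP ->|/IH jk].
  by have [? _] := nxP (s k).+1.
by apply: ltn_trans jk _; have [? _] := nxP (s k).+1.
Qed.

(** * Limit pairs of two orbits *)

Section PairImage.
Context {R : realType} {G : metricType R}.
Hypothesis cG : compact [set: G].
Implicit Types (f : G -> G) (M U V : set G).

(** A Baire argument: nested open sets with shrinking closures dodge the finite sets [F k] one at a
    time, as every open set meeting [M] contains infinitely many of its points. *)
Lemma finite_union_avoid M (F : nat -> set G) : closed M -> M !=set0 ->
  (forall U, open U -> (U `&` M) !=set0 -> infinite_set (U `&` M)) ->
  (forall k, finite_set (F k)) -> exists x, M x /\ forall k, ~ F k x.
Proof.
move=> cM M0 iM fF.
have step (V : set G) k : exists V' : set G, open V /\ (V `&` M) !=set0 ->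
    [/\ open V', (V' `&` M) !=set0, closure V' `<=` V & forall x, closure V' x -> ~ F k x].
  have [[oV VM]|nV] := pselect (open V /\ (V `&` M) !=set0); last by exists V.
  have [y [[Vy My] nFy]] := infinite_setN0 (infinite_setD (iM V oV VM) (fF k)).
  have cF : closed (F k).
    apply: compact_closed; [exact: metric_hausdorff|exact: finite_compact].
  have Uy : nbhs y (V `&` ~` F k).
    by apply: filterI; apply: open_nbhs_nbhs; split => //; exact: closed_openC.
  have [W [Wy cW WU]] := regular_closed Uy.
  have clW : closure (interior W) `<=` W.
    by rewrite [X in _ `<=` X](closure_id W).1 //; apply: closureS; exact: interior_subset.
  exists (interior W) => _; split.
  - exact: open_interior.
  - by exists y; split.
  - by move=> x /clW/WU[].
  - by move=> x /clW/WU[].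
have [nx nxP] : exists nx : set G -> nat -> set G, forall V k, open V /\ (V `&` M) !=set0 ->
    [/\ open (nx V k), (nx V k `&` M) !=set0, closure (nx V k) `<=` V & forall x, closure (nx V k) x -> ~ F k x].
  have /choice[nx nxP] : forall Vk : set G * nat, exists V' : set G, open Vk.1 /\ (Vk.1 `&` M) !=set0 ->
    [/\ open V', (V' `&` M) !=set0, closure V' `<=` Vk.1 & forall x, closure V' x -> ~ F Vk.2 x].
    by move=> [V k]; exact: step.
  by exists (fun V k => nx (V, k)) => V k; exact: (nxP (V, k)).
pose V := fix V k := if k is k'.+1 then nx (V k') k' else [set: G].
have VP k : open (V k) /\ (V k `&` M) !=set0.
  elim: k => [|k IH]; last by have [? ? _ _] := nxP _ k IH.
  split; first exact: openT.
  by have [x ?] := M0; exists x.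
have VS k : closure (V k.+1) `<=` V k /\ forall x, closure (V k.+1) x -> ~ F k x.
  by have [_ _ ? ?] := nxP _ k (VP k).
have Vdec j k : (j <= k)%N -> V k `<=` V j.
  move=> /subnK <-; elim: (k - j)%N => // a IH.
  by rewrite addSn; apply: subset_trans IH => x Vx; apply: (VS _).1; exact: subset_closure.
have /choice[u uP] : forall k, exists x, V k x /\ M x by move=> k; have [_ [x []]] := VP k; exists x.
have [y ly] := lims_exists u cG; exists y; split.
  by apply: (lims_in cM _ ly); exists 0%N => k _; case: (uP k).
move=> k; apply: (VS k).2; apply: (lims_in (@closed_closure _ _) _ ly).
by exists k.+1 => j kj; apply: subset_closure; apply: Vdec kj _ _; case: (uP j).
Qed.

Definition pair_orb f p q m : G * G := (orb f p m, orb f q m).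

(** Together with [separated_io], the two halves of [scrambled] without extended reals; see
    [scrambledP]. *)
Definition proximal f p q := forall e : R, 0 < e -> io (fun m => mdist (orb f p m) (orb f q m) < e).
Definition separated_io f p q :=
  exists2 d : R, 0 < d & io (fun m => d <= mdist (orb f p m) (orb f q m)).

Lemma nbhs_pair (x y : G) (W : set (G * G)) : nbhs (x, y) W <->
  exists U V, [/\ nbhs x U, nbhs y V & U `*` V `<=` W].
Proof.
split=> [[[U V] /= [Ux Vy] UV]|[U [V [Ux Vy UV]]]]; first by exists U, V.
by exists (U, V).
Qed.

Lemma proximal_diag f p q : proximal f p q ->
  exists u, lims (pair_orb f p q) (u, u).
Proof.
move=> prox.
have /choice[m mP] : forall a : nat, exists m, (a <= m)%N /\ mdist (orb f p m) (orb f q m) < a.+1%:R^-1.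
  by move=> a; apply: prox; rewrite invr_gt0.
have [u lu] := lims_exists (fun a => orb f p (m a)) cG.
exists u => W /nbhs_pair[U [V [Uu Vu UV]]] N.
have [e /= e0 eU] := (nbhs_ballP _ _).1 (filterI Uu Vu).
have [a0 _ a0P] := near_infty_natSinv_lt (PosNum (divr_gt0 e0 (ltr0Sn R 1))).
have bu : nbhs u (ball u (e / 2)) by apply: nbhsx_ballx; rewrite divr_gt0.
have [a [aN ua]] := lu _ bu (maxn N a0); move: aN; rewrite geq_max => /andP[Na a0a].
have [am dm] := mP a; exists (m a); split; first exact: leq_trans Na am.
have {}dm := lt_trans dm (a0P a a0a : a.+1%:R^-1 < e / 2).
move: ua; rewrite ballEmdist /= => ua.
apply: UV; split => /=.
  have [] // := eU (orb f p (m a)); rewrite ballEmdist /=; lra.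
have [] // := eU (orb f q (m a)); rewrite ballEmdist /=.
have := metric_triangle u (orb f p (m a)) (orb f q (m a)); lra.
Qed.

Lemma pair_lims_fst f p q x y : lims (pair_orb f p q) (x, y) -> lims (orb f p) x.
Proof.
move=> l U Ux; apply: io_sub (l (U `*` setT) _); first by move=> m [].
by apply/nbhs_pair; exists U, setT; split => //; exact: filterT.
Qed.

Lemma pair_lims_snd f p q x y : lims (pair_orb f p q) (x, y) -> lims (orb f q) y.
Proof.
move=> l U Uy; apply: io_sub (l (setT `*` U) _); first by move=> m [].
by apply/nbhs_pair; exists setT, U; split => //; exact: filterT.
Qed.

(** Points of a minimal set recur. With only finitely many points available in [U], the returning
    orbit would repeat itself and [M] would contain a cycle. *)
Lemma minimal_open_infinite f M U : continuous f -> closed M -> (forall x, M x -> M (f x)) ->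
  (forall M', M' `<=` M -> closed M' -> M' !=set0 -> (forall x, M' x -> M' (f x)) -> M' = M) ->
  (forall z d, (0 < d)%N -> iter d f z = z -> ~ M z) ->
  open U -> (U `&` M) !=set0 -> infinite_set (U `&` M).
Proof.
move=> cf cM fM minM perM oU [x [Ux Mx]] fUM.
have Mo m : M (orb f x m) by elim: m => //= m; exact: fM.
have lx : lims (orb f x) x.
  rewrite (minM (lims (orb f x))) //.
  - by move=> y; apply: lims_in => //; exists 0%N.
  - exact: lims_closed.
  - by have [y ?] := lims_exists (orb f x) cG; exists y.
  - by move=> y; apply: lims_image.
have [s [sU sinc]] := io_subseq (lx _ (open_nbhs_nbhs (conj oU Ux))).
have [i [j [ij e]]] := finite_pigeonhole fUM (fun k => conj (sU k) (Mo (s k))).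
have lt := sinc _ _ ij.
apply: (perM (orb f x (s i)) (s j - s i)%N) (Mo _); first by rewrite subn_gt0.
by rewrite -orbD subnK ?(ltnW lt).
Qed.

Context n (h : 'I_n -> R -> G) (g : 'I_n -> G -> R).
Hypothesis E : edges [set: G] h g.

(* A diagonal limit point can be chosen in a minimal set and, by Baire, outside the finite
   frontiers of the images of [U]. *)
Lemma pair_in_image f p q U N : continuous f ->
  proximal f p q ->
  connected U -> lims (orb f p) `<=` tail_orbit f U N ->
  (forall z d, (0 < d)%N -> iter d f z = z -> ~ lims (orb f p) z) ->
  exists m s, [/\ (N <= s)%N, (iter s f @` U) (orb f p m) & (iter s f @` U) (orb f q m)].
Proof.
move=> cf prox cU EO perE.
pose D := [set u | lims (pair_orb f p q) (u, u)].
have cD : closed D.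
  move=> y cy; apply: (@lims_closed _ (pair_orb f p q)); apply/closureP => W /nbhs_pair[V1 [V2 [V1y V2y V12]]].
  have [z [Dz [/= z1 z2]]] := (closureP _ _).1 cy _ (filterI V1y V2y).
  by exists (z, z); split => //; exact: V12.
have fD x : D x -> D (f x).
  move=> Dx W /nbhs_pair[V1 [V2 [V1y V2y V12]]] K.
  have [|m [Km [m1 m2]]] := Dx ((f @^-1` V1) `*` (f @^-1` V2)) _ K.
    by apply/nbhs_pair; exists (f @^-1` V1), (f @^-1` V2); split => //; exact: cf.
  by exists m.+1; split; [exact: leqW|apply: V12].
have kD : compact D by apply: subclosed_compact cG _.
have [M [MD cM M0 fM minM]] := minimal_exists kD cD (proximal_diag prox) fD.
have ME x : M x -> lims (orb f p) x by move=> /MD/pair_lims_fst.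
have iM V : open V -> (V `&` M) !=set0 -> infinite_set (V `&` M).
  by apply: (@minimal_open_infinite f) => // z d d0 /(perE _ _ d0) nz /ME.
have [k [x [Mx ix]]] : exists k x, M x /\ interior (iter (N + k) f @` U) x.
  apply: contrapT => nk.
  have [|x [Mx nx]] := @finite_union_avoid M (fun k => M `&` iter (N + k) f @` U) cM M0 iM.
    move=> k /=; apply: (sub_finite_set _ (boundary_finite E (iter_connected (n := N + k) cf cU))).
    move=> x [Mx Yx]; split; first exact: subset_closure.
    by move=> ix; apply: nk; exists k, x.
  have [m /= Nm Ym] := EO _ (ME _ Mx); apply: (nx (m - N)%N).
  by rewrite subnKC.
have [|m [_ [m1 m2]]] := MD _ Mx (iter (N + k) f @` U `*` iter (N + k) f @` U) _ 0%N.
  by apply/nbhs_pair; exists (iter (N + k) f @` U), (iter (N + k) f @` U); split.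
by exists m, (N + k)%N; split=> //; exact: leq_addr.
Qed.

End PairImage.

(** The index [s] of the common image can be taken arbitrarily large but need not equal the time
    [t], as [q] need not lie in [U]. *)
Definition shadowed {R : realType} {G : metricType R} (f : G -> G) p q (U : set G) :=
  forall M, exists N, forall t, (N <= t)%N ->
    exists s, [/\ (M <= s)%N, (iter s f @` U) (orb f p t) & (iter s f @` U) (orb f q t)].

Lemma half_min {R : realType} (e e1 : R) : 0 < e -> 0 < e1 ->
  exists e2 : R, [/\ 0 < e2, e2 <= e / 2 & e2 <= e1].
Proof.
move=> e0 e10; exists (Num.min (e / 2) e1); rewrite lt_min e10 divr_gt0 //.
by rewrite !ge_min !lexx orbT.
Qed.

Lemma below3 {R : realType} (x y z : R) : 0 < x -> 0 < y -> 0 < z ->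
  exists e : R, [/\ 0 < e, e <= x, e <= y & e <= z].
Proof.
move=> x0 y0 z0; exists (Num.min x (Num.min y z)).
by rewrite !lt_min !ge_min !lexx !orbT x0 y0 z0.
Qed.

Lemma close_ge {R : realType} (u a s e : R) : `|u - a| < e -> e <= a - s -> s <= u.
Proof. by rewrite ltr_norml; lra. Qed.

Lemma close_le {R : realType} (u b s e : R) : `|u - b| < e -> e <= s - b -> u <= s.
Proof. by rewrite ltr_norml; lra. Qed.

(** Intervals none of which contains another are ordered alike by left ends and by right ends; the
    middle one of the three contains [[a, b]] strictly on both sides. *)
Lemma three_overlapping {R : realType} (a b s1 s1' s2 s2' s3 s3' : R) :
  s1 <= a -> b <= s1' -> s2 <= a -> b <= s2' -> s3 <= a -> b <= s3' ->
  ~ ((s1 <= s2 /\ s2' <= s1') \/ (s2 <= s1 /\ s1' <= s2')) ->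
  ~ ((s2 <= s3 /\ s3' <= s2') \/ (s3 <= s2 /\ s2' <= s3')) ->
  ~ ((s1 <= s3 /\ s3' <= s1') \/ (s3 <= s1 /\ s1' <= s3')) ->
  [\/ s1 < a /\ b < s1', s2 < a /\ b < s2' | s3 < a /\ b < s3'].
Proof.
move=> l1 r1 l2 r2 l3 r3 o12 o23 o13.
have strict (s s' u u' : R) : ~ ((s <= u /\ u' <= s') \/ (u <= s /\ s' <= u')) ->
    (s < u /\ s' < u') \/ (u < s /\ u' < s').
  move=> o; have [su|us] := leP s u; have [su'|us'] := leP s' u'.
  - left; split; rewrite lt_neqAle ?su ?su' andbT; apply/eqP => e; apply: o; [right|left]; lra.
  - by case: o; left; split=> //; exact: ltW.
  - by case: o; right; split=> //; exact: ltW.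
  - by right.
have {}o12 := strict _ _ _ _ o12; have {}o13 := strict _ _ _ _ o13.
have {}o23 := strict _ _ _ _ o23.
by case: o12 => [[? ?]|[? ?]]; case: o23 => [[? ?]|[? ?]]; case: o13 => [[? ?]|[? ?]];
  first [constructor 1; lra | constructor 2; lra | constructor 3; lra | lra].
Qed.

(** * Exclusion of a limit pair inside one edge *)

Section Oriented.
Context {R : realType} {G : metricType R}.
Context n (h : 'I_n -> R -> G) (g : 'I_n -> G -> R).
Hypothesis E : edges [set: G] h g.
Local Notation arc i a b := (h i @` `]a, b[%classic).
Context (f : G -> G) (p q : G).
Hypotheses (cf : continuous f) (nH : ~ horseshoe f).
Hypothesis iE : infinite_set (lims (orb f p)).
Hypothesis perE : forall z d, (0 < d)%N -> iter d f z = z -> ~ lims (orb f p) z.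
Hypothesis perU : exists U N, nbhs p U /\ forall m z d, (N <= m)%N -> (0 < d)%N ->
  iter d f z = z -> ~ (iter m f @` U) z.
Hypothesis shadow : forall W, nbhs p W -> exists U, [/\ nbhs p U, connected U, U `<=` W & shadowed f p q U].
Variables (i : 'I_n) (c0 c1 c2 c3 c4 c5 a b : R).
Hypothesis order : [/\ 0 < c0 < c1, c1 < c2 < c3, c3 < c4 < c5, c5 < 1 &
  [/\ c2 < a < c3, a < b & b <= c4]].
Hypothesis I0 : exists e, lims (orb f p) e /\ arc i c0 c1 e.
Hypothesis I1 : exists e, lims (orb f p) e /\ arc i c1 c2 e.
Hypothesis I3 : exists e, lims (orb f p) e /\ arc i c3 c4 e.
Hypothesis I4 : exists e, lims (orb f p) e /\ arc i c4 c5 e.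
Hypothesis lab : lims (pair_orb f p q) (h i a, h i b).

Let la : lims (orb f p) (h i a). Proof. exact: pair_lims_fst lab. Qed.

Lemma stable_arc (u v : R) : 0 <= u -> v <= 1 -> (exists e, lims (orb f p) e /\ arc i u v e) ->
  exists W N, nbhs p W /\ forall m V, (N <= m)%N -> V `<=` W -> ~ arc i u v `<=` iter m f @` V.
Proof.
move=> u0 v1 e; have [W [N [Wp WN]]] := stable cf nH iE (edge_open E i u0 v1) e.
exists W, N; split=> // m V Nm VW H; apply: (WN m Nm); apply: subset_trans H _.
exact: image_subset.
Qed.

(** Two layers are needed because [b] may lie beyond [c3]: the inner one starts from a point near
    [a], the outer one from any point between [a] and [b]. *)
Definition trapped U N := (forall m (s : R), (N <= m)%N -> c2 <= s <= c3 -> (iter m f @` U) (h i s) ->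
    iter m f @` U `<=` arc i c1 c4) /\
  (forall m (s : R), (N <= m)%N -> c1 <= s <= c4 -> (iter m f @` U) (h i s) ->
    iter m f @` U `<=` arc i c0 c5) /\
  (forall m z d, (N <= m)%N -> (0 < d)%N -> iter d f z = z -> ~ (iter m f @` U) z).

Lemma trapped_exists : exists W N, nbhs p W /\ forall U, U `<=` W -> connected U -> trapped U N.
Proof.
have [c01 c12 c34 c51 [aI ab bI]] := order.
have [B0 B1 B3 B4] : [/\ 0 <= c0 /\ c1 <= 1, 0 <= c1 /\ c2 <= 1, 0 <= c3 /\ c4 <= 1 & 0 <= c4 /\ c5 <= 1].
  by split; split; lra.
have [W0 [N0 [W0p W0N]]] := stable_arc B0.1 B0.2 I0.
have [W1 [N1 [W1p W1N]]] := stable_arc B1.1 B1.2 I1.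
have [W3 [N3 [W3p W3N]]] := stable_arc B3.1 B3.2 I3.
have [W4 [N4 [W4p W4N]]] := stable_arc B4.1 B4.2 I4.
have [W5 [N5 [W5p W5N]]] := perU.
exists (W0 `&` W1 `&` W3 `&` W4 `&` W5), (maxn (maxn (maxn N0 N1) (maxn N3 N4)) N5).
split; first by do !apply: filterI.
move=> U UW cU.
have [U0 U1 U3 U4 U5] : [/\ U `<=` W0, U `<=` W1, U `<=` W3, U `<=` W4 & U `<=` W5].
  by split=> x /UW[[[[]]]].
split; last split.
- move=> m s; rewrite !geq_max => /andP[/andP[/andP[m0 m1] /andP[m3 m4]] m5] sc Ys.
  apply: (@hull R G n h g E i _ c1 c2 c3 c4 s) => //; [exact: iter_connected|lra|lra|lra|lra| |].
    exact: W1N.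
  exact: W3N.
- move=> m s; rewrite !geq_max => /andP[/andP[/andP[m0 m1] /andP[m3 m4]] m5] sc Ys.
  apply: (@hull R G n h g E i _ c0 c1 c4 c5 s) => //; [exact: iter_connected|lra|lra|lra|lra| |].
    exact: W0N.
  exact: W4N.
- move=> m z d; rewrite !geq_max => /andP[/andP[/andP[m0 m1] /andP[m3 m4]] m5] d0 dz [x Ux xz].
  by apply: (W5N m z d m5 d0 dz); exists x => //; exact: U5.
Qed.

Definition near_at (e : R) t := exists s s' : R, [/\ `|s - a| < e, `|s' - b| < e,
  orb f p t = h i s, orb f q t = h i s' & 0 <= s' <= 1].

Lemma near_io (e : R) : 0 < e -> io (near_at e).
Proof.
have [c01 c12 c34 c51 [aI ab bI]] := order.
move=> e0.
have a01 : 0 < a < 1 by lra.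
have b01 : 0 < b < 1 by lra.
have [u [v [[u0 v1] uv eu ve Na]]] := edge_nbhs E i a01 e0.
have [u' [v' [[u'0 v'1] uv' eu' ve' Nb]]] := edge_nbhs E i b01 e0.
have Nab : nbhs (h i a, h i b) (arc i u v `*` arc i u' v').
  by apply/nbhs_pair; exists (arc i u v), (arc i u' v'); split.
apply: io_sub (lab Nab) => t [[s /= + sE] [s' /= + s'E]]; rewrite !in_itv /= => su s'u.
by exists s, s'; split; rewrite ?ltr_norml //; lra.
Qed.

(** At a time when the two orbits are near [h i a] and [h i b] they lie in a common image of [U];
    being connected and confined to the edge, it contains everything in between. *)
Lemma interval_in_image W : nbhs p W -> exists U, [/\ nbhs p U, connected U, U `<=` W &
  forall (e : R) M, 0 < e -> exists2 s, (M <= s)%N & forall r : R, a + e <= r <= b - e -> (iter s f @` U) (h i r)].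
Proof.
have [c01 c12 c34 c51 [aI ab bI]] := order.
move=> Wp; have [W0 [N0 [W0p W0P]]] := trapped_exists.
have [U [Up cU UW shU]] := shadow (filterI Wp W0p).
exists U; split => //; first by move=> x /UW[].
move=> e M e0; have [T1 [_ _]] := W0P U (fun x Ux => (UW x Ux).2) cU.
have [N NP] := shU (maxn M N0).
have [e1 [e10 e1e e1a e1c]] : exists e1 : R, [/\ 0 < e1, e1 <= e, e1 <= a - c2 & e1 <= c3 - a].
  by apply: below3; lra.
have [t [Nt [s [s' [sa sb ps qs s'01]]]]] := near_io e10 N.
have [m [+ pm qm]] := NP t Nt; rewrite geq_max => /andP[Mm N0m].
exists m => // r re; move: sa sb; rewrite !ltr_norml => sa sb.
rewrite ps in pm; rewrite qs in qm.
have sub := T1 m s N0m ltac:(lra) pm.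
apply: (arc_interval E (iter_connected cf cU) _ _ _ _ pm qm); [|lra|lra|lra].
by apply: subset_trans sub _; apply: arc_sub01; lra.
Qed.

(* The whole segment between [a] and [b] is covered by images of small neighbourhoods of [p]. *)
Lemma gap_disjoint (s : R) : a < s < b -> ~ lims (orb f p) (h i s).
Proof.
have [c01 c12 c34 c51 [aI ab bI]] := order.
move=> sab ls; pose d := Num.min (s - a) (b - s) / 2.
have [d0 da db] : [/\ 0 < d, d <= (s - a) / 2 & d <= (b - s) / 2].
  rewrite /d; have : Num.min (s - a) (b - s) <= s - a by rewrite ge_min lexx.
  have : Num.min (s - a) (b - s) <= b - s by rewrite ge_min lexx orbT.
  have : 0 < Num.min (s - a) (b - s) by rewrite lt_min; lra.
  by move=> ? ? ?; split; lra.
have [|||W [N [Wp WN]]] := @stable_arc (s - d) (s + d); [lra|lra| |].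
  by exists (h i s); split=> //; exists s => //=; rewrite in_itv /=; lra.
have [U [Up cU UW /(_ d N d0)[m Nm mP]]] := interval_in_image Wp.
apply: (WN m U Nm UW) => _ [r /= + <-]; rewrite in_itv /= => rs.
by apply: mP; lra.
Qed.

(* The image of [h i a] is the first point of the limit set to the right of [b], whatever [d]. *)
Lemma gap_return r0 t d (v v' : R) : orb f r0 t = h i v -> orb f r0 (t + d) = h i v' ->
  (0 < d)%N -> a < v < b -> a < v' < b ->
  exists a' : R, [/\ a < a', a' <= 1, iter d f (h i a) = h i a', lims (orb f p) (h i a') &
    forall s : R, a < s < a' -> ~ lims (orb f p) (h i s)].
Proof.
have [c01 c12 c34 c51 [aI ab bI]] := order.
move=> rv rv' d0 vab v'ab.
pose C (e : R) := iter d f @` (h i @` `[a + e, b - e]).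
have cC (e : R) : 0 < e -> connected (C e).
  move=> e0; apply: iter_connected => //; apply: (homeo_connected (edge_homeo E i)).
    by move=> x /=; rewrite !in_itv /=; lra.
  exact: interval_is_interval.
have CP (e : R) x : C e x -> exists2 r : R, a + e <= r <= b - e & x = iter d f (h i r).
  by move=> [_ [r /= + <-] <-]; rewrite in_itv /= => ?; exists r.
have PC (e r : R) : a + e <= r <= b - e -> C e (iter d f (h i r)).
  by move=> re; exists (h i r) => //; exists r => //=; rewrite in_itv.
have CU W : nbhs p W -> exists2 U, U `<=` W /\ connected U & forall (e : R) M, 0 < e ->
    exists2 m, (M <= m)%N & C e `<=` iter m f @` U.
  move=> /interval_in_image[U [Up cU UW UP]]; exists U => // e M e0.
  have [m Mm mP] := UP e M e0; exists (d + m)%N; first exact: leq_trans Mm (leq_addl _ _).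
  by rewrite image_iterD => x /CP[r /mP rr ->]; exists (h i r).
have [e1 [e10 e1a e1b _]] : exists e1 : R, [/\ 0 < e1, e1 <= v - a, e1 <= b - v & e1 <= b - v].
  by apply: below3; lra.
have c05 : 0 <= c0 /\ c5 <= 1 by lra.
have fv : iter d f (h i v) = h i v' by rewrite -rv -rv' addnC orbD.
have Cv' (e : R) : 0 < e <= e1 -> C e (h i v') by move=> e01; rewrite -fv; apply: PC; lra.
have C05 (e : R) : 0 < e <= e1 -> C e `<=` arc i c0 c5.
  move=> e01; have [W0 [N0 [W0p W0P]]] := trapped_exists.
  have [U [UW cU] /(_ e N0)[|m N0m mP]] := CU _ W0p; first lra.
  have [_ [T2 _]] := W0P U UW cU.
  apply: (subset_trans mP); apply: (T2 m v' N0m); first lra.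
  by apply: mP; exact: Cv'.
have [a' a'05 fa] : exists2 a' : R, c0 <= a' <= c5 & iter d f (h i a) = h i a'.
  suff : (h i @` `[c0, c5]) (iter d f (h i a)).
    by move=> [x /=]; rewrite in_itv /= => ? <-; exists x.
  rewrite (closure_id (h i @` `[c0, c5])).1; last by apply: (edge_closed E); lra.
  apply/closureP => V /(iter_continuous cf)/(edge_continuous E)[|e e0 eP]; first lra.
  have [e2 [e20 e2e e21]] := half_min e0 e10.
  have ae2 : a + e2 <= a + e2 <= b - e2 by lra.
  have e201 : 0 < e2 <= e1 by lra.
  have [x /= + xE] := C05 e2 e201 _ (PC e2 _ ae2).
  rewrite in_itv /= => xc; exists (iter d f (h i (a + e2))); split.
    by rewrite -xE; exists x => //=; rewrite in_itv /=; lra.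
  by apply: eP; [lra|rewrite addrAC subrr add0r gtr0_norm //; lra].
have la' : lims (orb f p) (h i a').
  by rewrite -fa; elim: {rv rv' fv d0 C cC CP PC CU Cv' C05 fa} d => //= k IH; apply: lims_image.
have aa' : a' <> a.
  by move=> e; apply: (perE d0 _ la); rewrite fa e.
(* As [e] shrinks, [C e] reaches from near [a'] to [v']. A limit point strictly in between would
   have a neighbourhood covered by late images of small sets, against [stable_arc]. *)
have betw (s : R) : (a' < s < v') \/ (v' < s < a') -> ~ lims (orb f p) (h i s).
  move=> sb ls.
  pose m1 := (a' + s) / 2; pose m2 := (s + v') / 2.
  pose u1 := Num.min m1 m2; pose u2 := Num.max m1 m2.
  have [u12 u1m u2m] : [/\ u1 < s < u2, (u1 = m1 /\ u2 = m2) \/ (u1 = m2 /\ u2 = m1) & 0 <= u1 /\ u2 <= 1].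
    rewrite /u1 /u2 /m1 /m2; case: sb => ?.
      rewrite min_l ?max_r; [|lra|lra].
      by split; [lra|left|lra].
    rewrite min_r ?max_l; [|lra|lra].
    by split; [lra|right|lra].
  have [|W [N [Wp WN]]] := stable_arc u2m.1 u2m.2.
    by exists (h i s); split=> //; exists s => //=; rewrite in_itv.
  have w0 : 0 < `|s - a'| / 2 by rewrite divr_gt0 // normr_gt0 subr_eq0; apply/eqP; lra.
  have a'01 : 0 < a' < 1 by lra.
  have [u [w [[u0 w1] uw eu we Na']]] := edge_nbhs E i a'01 w0.
  have {}Na' : nbhs (iter d f (h i a)) (arc i u w) by rewrite fa.
  have [|e e0 eP] := edge_continuous E _ (iter_continuous cf Na'); first lra.
  have [e2 [e20 e2e e21]] := half_min e0 e10.
  have [x xuw Cx] : exists2 x : R, u < x < w & C e2 (h i x).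
    have [||x /= + xE] := eP (a + e2); [lra|by rewrite addrAC subrr add0r gtr0_norm //; lra|].
    by rewrite in_itv /= => ?; exists x => //; rewrite xE; apply: PC; lra.
  have sub : arc i u1 u2 `<=` C e2.
    have C01 : C e2 `<=` h i @` `[0, 1].
      by apply: subset_trans (C05 e2 _) (arc_sub01 c05.1 c05.2); rewrite e20.
    move=> _ [y /= + <-]; rewrite in_itv /= => yu.
    have Cv2 : C e2 (h i v') by apply: Cv'; rewrite e20.
    case: sb => sb.
      move: eu we; rewrite ger0_norm; last lra.
      move=> eu we; apply: (arc_interval E (cC _ e20) C01 _ _ _ Cx Cv2); [lra|lra|].
      move: u1m; rewrite /m1 /m2; lra.
    move: eu we; rewrite ler0_norm; last lra.
    move=> eu we; apply: (arc_interval E (cC _ e20) C01 _ _ _ Cv2 Cx); [lra|lra|].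
    move: u1m; rewrite /m1 /m2; lra.
  have [U [UW cU] /(_ e2 N e20)[m Nm mP]] := CU _ Wp.
  by apply: (WN m U Nm UW); apply: subset_trans sub mP.
have a'ge : b <= a'.
  rewrite leNgt; apply/negP => a'b; have [a'a|aa''] := ltP a' a.
    by apply: (betw a) => //; left; lra.
  apply: (@gap_disjoint a') => //.
  by rewrite a'b andbT lt_neqAle aa'' andbT eq_sym; apply/eqP.
exists a'; split=> //; [lra|lra|].
move=> s sa'; have [sb|bs] := ltP s b; first by apply: gap_disjoint; lra.
by apply: betw; right; lra.
Qed.

(** By [gap_return] the differences [t2 - t1] and [t3 - t1] of three visits send [h i a] to the same
    limit point, which [f^(t3 - t2)] then fixes. *)
Lemma gap_no_return r0 : ~ io (fun t => exists2 v : R, a < v < b & orb f r0 t = h i v).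
Proof.
move=> iov; have [t1 [_ [v1 v1ab r1]]] := iov 0%N.
have [t2 [t12 [v2 v2ab r2]]] := iov t1.+1; have [t3 [t23 [v3 v3ab r3]]] := iov t2.+1.
have t13 : (t1 < t3)%N by exact: ltn_trans t12 t23.
rewrite -(subnKC (ltnW t12)) in r2; rewrite -(subnKC (ltnW t13)) in r3.
have d20 : (0 < t2 - t1)%N by rewrite subn_gt0.
have d30 : (0 < t3 - t1)%N by rewrite subn_gt0.
have [x [ax x1 xE lx nx]] := gap_return r1 r2 d20 v1ab v2ab.
have [y [ay y1 yE ly ny]] := gap_return r1 r3 d30 v1ab v3ab.
have xy : x = y.
  apply/eqP; rewrite eq_le !leNgt; apply/andP; split; apply/negP => lt.
    by apply: (nx y) => //; rewrite ay.
  by apply: (ny x) => //; rewrite ax.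
have d23 : (0 < t3 - t2)%N by rewrite subn_gt0.
apply: (perE d23 _ lx); rewrite -xE -iterD.
have -> : (t3 - t2 + (t2 - t1) = t3 - t1)%N by rewrite addnBA ?(ltnW t12) // subnK ?(ltnW t23).
by rewrite xE yE xy.
Qed.

(** At two late times near the limit pair the coordinate intervals of the two orbits cannot be
    nested: by [osc], the iterate between these times would have a fixed point in an image of [U].
    Both orbits visit the gap only finitely often, so the intervals contain [[a, b]], and among
    three of them one contains it strictly. A later interval close enough to [[a, b]] is nested in
    that one. *)
Lemma oriented_limit_pair_absurd : False.
Proof.
have [c01 c12 c34 c51 [aI ab bI]] := order.
have [W0 [N0 [W0p W0P]]] := trapped_exists.
have [U [Up cU UW shU]] := shadow W0p.
have [T1 [_ T3]] := W0P U UW cU.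
have [N NP] := shU N0.
(* The bound [(b - a) / 2] keeps the two coordinates in order; the other two keep the first
   coordinate in the window where [T1] applies. *)
have [e0 [e00 e0b e0a e0c]] : exists e0 : R, [/\ 0 < e0, e0 <= (b - a) / 2, e0 <= a - c2 & e0 <= c3 - a].
  by apply: below3; lra.
have osc t t' (s s' u u' : R) : (N <= t)%N -> (t < t')%N -> 0 <= s' <= 1 -> 0 <= u' <= 1 ->
    `|s - a| < e0 -> `|s' - b| < e0 -> orb f p t = h i s -> orb f q t = h i s' ->
    `|u - a| < e0 -> `|u' - b| < e0 -> orb f p t' = h i u -> orb f q t' = h i u' ->
    ~ ((s <= u /\ u' <= s') \/ (u <= s /\ s' <= u')).
  rewrite !ltr_norml => Nt tt' s'01 u'01 sa sb pt qt ua ub pt' qt' H.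
  have [m [N0m pm qm]] := NP t Nt; rewrite pt in pm; rewrite qt in qm.
  have sub := T1 m s N0m ltac:(lra) pm.
  have cm := iter_connected (n := m) cf cU.
  have mid (r : R) : s <= r <= s' -> (iter m f @` U) (h i r).
    move=> rs; apply: (arc_interval E cm _ _ _ rs pm qm); [|lra|lra].
    by apply: subset_trans sub _; apply: arc_sub01; lra.
  have N0m' : (N0 <= t' - t + m)%N by exact: leq_trans N0m (leq_addl _ _).
  have pu : iter (t' - t) f (h i s) = h i u by rewrite -pt -pt' -orbD subnK // ltnW.
  have qu : iter (t' - t) f (h i s') = h i u' by rewrite -qt -qt' -orbD subnK // ltnW.
  have img (r : R) : s <= r <= s' -> (iter (t' - t + m) f @` U) (iter (t' - t) f (h i r)).
    by move=> /mid mr; rewrite image_iterD; exists (h i r).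
  have um : (iter (t' - t + m) f @` U) (h i u) by rewrite -pu; apply: img; lra.
  have sub' := T1 _ u N0m' ltac:(lra) um.
  have [s0 ss' s'1] : [/\ 0 <= s, s <= s' & s' <= 1] by split; lra.
  have u01 : 0 <= u <= 1 by lra.
  have Fr (r : R) : s <= r <= s' -> exists2 x, 0 <= x <= 1 & iter (t' - t) f (h i r) = h i x.
    move=> /img/sub'[x /= + xE]; rewrite in_itv /= => xc; exists x => //; lra.
  have [r rs fr] := edge_fixpt E (iter_continuous cf) s0 ss' s'1 Fr u01 u'01 pu qu H.
  apply: (T3 m (h i r) (t' - t)%N N0m _ fr); [by rewrite subn_gt0|exact: mid].
have [//|np] := pselect (io (fun t => exists2 v : R, a < v < b & orb f p t = h i v)).
  exact: gap_no_return.
have [//|nq] := pselect (io (fun t => exists2 v : R, a < v < b & orb f q t = h i v)).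
  exact: gap_no_return.
move: np nq => /existsNP[Np np] /existsNP[Nq nq].
pose K := maxn N (maxn Np Nq).
have KP t (s s' : R) : (K <= t)%N -> `|s - a| < e0 -> `|s' - b| < e0 -> orb f p t = h i s ->
    orb f q t = h i s' -> [/\ (N <= t)%N, s <= a & b <= s'].
  rewrite !geq_max !ltr_norml => /and3P[Nt Npt Nqt] sa sb pt qt; split=> //.
    rewrite leNgt; apply/negP => as_; apply: np; exists t; split=> //; exists s => //; lra.
  rewrite leNgt; apply/negP => sb_; apply: nq; exists t; split=> //; exists s' => //; lra.
have [t1 [Kt1 [s1 [s1' [s1a s1b p1 q1 i1]]]]] := near_io e00 K.
have [t2 [t12 [s2 [s2' [s2a s2b p2 q2 i2]]]]] := near_io e00 t1.+1.
have [t3 [t23 [s3 [s3' [s3a s3b p3 q3 i3]]]]] := near_io e00 t2.+1.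
have Kt2 := leq_trans Kt1 (ltnW t12); have Kt3 := leq_trans Kt2 (ltnW t23).
have [N1 l1 r1] := KP _ _ _ Kt1 s1a s1b p1 q1.
have [N2 l2 r2] := KP _ _ _ Kt2 s2a s2b p2 q2.
have [N3 l3 r3] := KP _ _ _ Kt3 s3a s3b p3 q3.
have o12 := osc _ _ _ _ _ _ N1 t12 i1 i2 s1a s1b p1 q1 s2a s2b p2 q2.
have o23 := osc _ _ _ _ _ _ N2 t23 i2 i3 s2a s2b p2 q2 s3a s3b p3 q3.
have o13 := osc _ _ _ _ _ _ N1 (ltn_trans t12 t23) i1 i3 s1a s1b p1 q1 s3a s3b p3 q3.
have [t [s [s' [Nt sa sb [pt qt] [lt_sa lt_bs s'01]]]]] : exists t (s s' : R), [/\ (N <= t)%N,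
    `|s - a| < e0, `|s' - b| < e0, orb f p t = h i s /\ orb f q t = h i s' & [/\ s < a, b < s' & 0 <= s' <= 1]].
  by have [[? ?]|[? ?]|[? ?]] := three_overlapping l1 r1 l2 r2 l3 r3 o12 o23 o13;
    [exists t1, s1, s1'|exists t2, s2, s2'|exists t3, s3, s3'].
have [e1 [e10 e1e e1a e1b]] : exists e1 : R, [/\ 0 < e1, e1 <= e0, e1 <= a - s & e1 <= s' - b].
  by apply: below3; rewrite ?subr_gt0.
have [t' [tt' [u [u' [ua ub pt' qt' u'01]]]]] := near_io e10 t.+1.
apply: (osc _ _ _ _ _ _ Nt tt' s'01 u'01 sa sb pt qt _ _ pt' qt').
- exact: lt_le_trans ua e1e.
- exact: lt_le_trans ub e1e.
- by left; split; [exact: close_ge ua e1a|exact: close_le ub e1b].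
Qed.

End Oriented.

Lemma pair_hausdorff {R : realType} (G : metricType R) : hausdorff_space (G * G)%type.
Proof.
move=> [x y] [x' y'] cl.
have sub (U V U' V' : set G) : nbhs x U -> nbhs y V -> nbhs x' U' -> nbhs y' V' ->
    (U `&` U') !=set0 /\ (V `&` V') !=set0.
  move=> Ux Vy Ux' Vy'.
  have n1 : nbhs (x, y) (U `*` V) by apply/nbhs_pair; exists U, V; split.
  have n2 : nbhs (x', y') (U' `*` V') by apply/nbhs_pair; exists U', V'; split.
  have [[a b] [[Ua Vb] [Ua' Vb']]] := cl _ _ n1 n2.
  by split; [exists a|exists b].
have hx : x = x'.
  apply: contrapT => /separate[U [U' [Ux Ux' UU']]].
  have [[z]] := sub U setT U' setT Ux filterT Ux' filterT; by rewrite UU'.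
have hy : y = y'.
  apply: contrapT => /separate[U [U' [Ux Ux' UU']]].
  have [_ [z]] := sub setT U setT U' filterT Ux filterT Ux'; by rewrite UU'.
by rewrite hx hy.
Qed.

(** * No scrambled pair when all tails are connected *)

Section TailConnected.
Context {R : realType} {G : metricType R}.
Context n (h : 'I_n -> R -> G) (g : 'I_n -> G -> R).
Hypothesis E : edges [set: G] h g.
Context (f : G -> G) (p q : G).
Hypotheses (cf : continuous f) (nH : ~ horseshoe f).
Hypothesis iE : infinite_set (lims (orb f p)).
Hypothesis tail_connected : exists U0, nbhs p U0 /\ forall U, nbhs p U -> connected U ->
  U `<=` U0 -> exists N, forall N', (N <= N')%N -> connected (tail_orbit f U N').
Hypothesis prox : proximal f p q.
Hypothesis sep : separated_io f p q.
Local Notation arc i a b := (h i @` `]a, b[%classic).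
Local Notation cG := (graph_compact E).

Lemma omega_sub_tails : exists U1, nbhs p U1 /\ forall U N, nbhs p U -> connected U -> U `<=` U1 ->
  lims (orb f p) `<=` tail_orbit f U N.
Proof.
have [U1 [N1 [U1p U1N]]] := no_periodic E cf nH iE tail_connected.
have [U0 [U0p U0c]] := tail_connected.
exists (U0 `&` U1); split; first exact: filterI.
move=> U N Up cU; rewrite subsetI => -[UU0 UU1]; have [N2 N2c] := U0c U Up cU UU0.
pose M := maxn N (maxn N1 N2).
have [NM N1M N2M] : [/\ N <= M, N1 <= M & N2 <= M]%N.
  by rewrite /M !leq_max !leqnn ?orbT.
apply: (@subset_trans _ (tail_orbit f U M)).
  apply: (omega_sub_invariant E cf (N2c M N2M)) => //.
  - move=> x [m /= Mm [z Uz <-]]; exists m.+1; first exact: leqW.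
    by exists z.
  - move=> z d d0 dz [m /= Mm [x Ux xz]].
    by apply: (U1N m z d (leq_trans N1M Mm) d0 dz); exists x => //; exact: UU1.
  - exists M => m Mm; exists m => //; exists p => //; exact: nbhs_singleton.
by move=> x [m /= Mm mx]; exists m => //=; exact: leq_trans Mm.
Qed.

Lemma omega_no_periodic z d : (0 < d)%N -> iter d f z = z -> ~ lims (orb f p) z.
Proof.
have [U1 [N1 [U1p U1N]]] := no_periodic E cf nH iE tail_connected.
have [U2 [U2p U2P]] := omega_sub_tails.
have [V [Vp cV VU]] := locally_connected E (filterI U1p U2p).
move=> d0 dz /(U2P V N1 Vp cV (fun x Vx => (VU x Vx).2))[m /= Nm [x Vx xz]].
by apply: (U1N m z d Nm d0 dz); exists x => //; exact: (VU x Vx).1.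
Qed.

(** A single simultaneous visit to an image of [U], given by [pair_in_image], is carried by
    [f^(t - m)] to all later times. *)
Lemma shadow_exists W : nbhs p W -> exists U, [/\ nbhs p U, connected U, U `<=` W & shadowed f p q U].
Proof.
move=> Wp; have [U2 [U2p U2P]] := omega_sub_tails.
have [V [Vp cV VU]] := locally_connected E (filterI Wp U2p).
exists V; split=> // [x /VU[]//|M].
have [m [s [Ms ps qs]]] := pair_in_image cG E cf prox cV
  (U2P V M Vp cV (fun x Vx => (VU x Vx).2)) omega_no_periodic.
exists m => t mt; exists (t - m + s)%N; split; first exact: leq_trans Ms (leq_addl _ _).
  by rewrite image_iterD; exists (orb f p m) => //; rewrite -orbD subnK.
by rewrite image_iterD; exists (orb f q m) => //; rewrite -orbD subnK.
Qed.

Lemma pair_limit : exists x y, lims (pair_orb f p q) (x, y) /\ x <> y.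
Proof.
have [d d0 dio] := sep.
have cGG : compact [set: G * G] by rewrite -setXTT; apply: compact_setX; exact: (graph_compact E).
have [[x y] H] := io_cluster (pair_orb f p q) cGG dio.
exists x, y; split; first by move=> U /H; apply: io_sub => k [].
move=> xy; rewrite -xy in H.
have d20 : 0 < d / 2 by rewrite divr_gt0.
have nb : nbhs (x, x) (ball x (d / 2) `*` ball x (d / 2)).
  by apply/nbhs_pair; exists (ball x (d / 2)), (ball x (d / 2)); split=> //; exact: nbhsx_ballx.
have [k [_ [dk [/=]]]] := H _ nb 0%N; rewrite !ballEmdist /= => k1 k2.
have := metric_triangle (orb f p k) x (orb f q k); rewrite metric_sym in k1; lra.
Qed.

(** A backward orbit of a non-diagonal limit pair stays off the diagonal, and its first coordinates
    are distinct because the limit set has no periodic points. *)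
Lemma infinite_pair_limits : exists A : set (G * G), [/\ infinite_set (fst @` A),
  A `<=` lims (pair_orb f p q) & forall z, A z -> z.1 <> z.2].
Proof.
have [x [y [lxy xy]]] := pair_limit.
have cGG : compact [set: G * G] by rewrite -setXTT; apply: compact_setX; exact: (graph_compact E).
pose F (z : G * G) := (f z.1, f z.2).
have cF : continuous F.
  move=> z; apply: cvg_pair => /=.
    apply: (cvg_comp fst f); [exact: cvg_fst|exact: cf].
  apply: (cvg_comp snd f); [exact: cvg_snd|exact: cf].
have hGG := @pair_hausdorff R G.
have back z : lims (pair_orb f p q) z -> exists z', lims (pair_orb f p q) z' /\ F z' = z.
  by move=> /(lims_back cGG hGG cF)[//|z' lz' zz]; exists z'.
have /choice[b bP] : forall z, exists z', lims (pair_orb f p q) z -> lims (pair_orb f p q) z' /\ F z' = z.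
  by move=> z; have [/back[z' ?]|?] := pselect (lims (pair_orb f p q) z); [exists z'|exists z].
pose w k := iter k b (x, y).
have lw k : lims (pair_orb f p q) (w k) by elim: k => // k IH; exact: (bP _ IH).1.
have Fw k : F (w k.+1) = w k by exact: (bP _ (lw k)).2.
have Fw1 k j : iter j f (w (j + k)%N).1 = (w k).1.
  by elim: j => // j IH; rewrite addSn iterSr -IH -(Fw (j + k)%N).
have Fw2 k j : iter j f (w (j + k)%N).2 = (w k).2.
  by elim: j => // j IH; rewrite addSn iterSr -IH -(Fw (j + k)%N).
exists (range w); split.
- move=> fin; have [|i [j [ij wij]]] := @finite_pigeonhole _ _ (fun k => (w k).1) fin.
    by move=> k; exists (w k) => //; exists k.
  have d0 : (0 < j - i)%N by rewrite subn_gt0.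
  apply: (omega_no_periodic d0 _ (pair_lims_fst (y := (w j).2) (x := (w j).1) _)).
    by have := Fw1 i (j - i)%N; rewrite subnK ?(ltnW ij) // => ->.
  by rewrite -surjective_pairing; exact: lw.
- by move=> _ [k _ <-].
- move=> _ [k _ <-] e; apply: xy; have := Fw1 0%N k; have := Fw2 0%N k.
  by rewrite addn0 /= => <- <-; rewrite e.
Qed.

(** Five arcs of one edge, each containing first coordinates of limit pairs, provide a pair starting
    in the middle arc with two uncovered arcs on either side, as [oriented_limit_pair_absurd]
    demands; if [b < a], the edges are reversed. *)
Lemma tail_connected_not_scrambled : False.
Proof.
have [A [iA AL A12]] := infinite_pair_limits.
have [i [c [c01 cc cA]]] := cut_edge E 5 iA.
have Al x : (fst @` A) x -> lims (orb f p) x.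
  by move=> [[y y'] /AL ly <-]; exact: pair_lims_fst ly.
have cE k : (k < 5)%N -> exists e, lims (orb f p) e /\ arc i (c k) (c k.+1) e.
  by move=> /cA[e [/Al]]; exists e.
have [e [[[x y] Axy xe] [a /= + ae]]] := cA 2%N isT.
rewrite in_itv /= => ac; rewrite /= in xe.
have lxy := AL _ Axy; have nxy : x <> y := A12 _ Axy.
have [k0 o1 o2 o3 o4] : [/\ c 0%N < c 1%N, c 1%N < c 2%N, c 2%N < c 3%N, c 3%N < c 4%N & c 4%N < c 5%N].
  by split; apply: cc.
have [c00 c51] : 0 < c 0%N /\ c 5%N < 1.
  by move: (c01 0%N isT) (c01 5%N isT); lra.
have xa : x = h i a by rewrite ae.
(* When the orbit of [p] visits the middle arc, the common image is confined by the flanking arcs,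
   and with it the orbit of [q]; so [y] lies on the same edge. *)
have [b bc yb] : exists2 b : R, c 1%N <= b <= c 4%N & y = h i b.
  suff : (h i @` `[c 1%N, c 4%N]) y.
    by move=> [b /= +] <-; rewrite in_itv /= => ?; exists b.
  have [W [M [Wp WM]]] := arcs_stable E cf nH iE c01 cE.
  have [U [Up cU UW shU]] := shadow_exists Wp.
  have [N NP] := shU M.
  rewrite (closure_id (h i @` `[c 1%N, c 4%N])).1; last by apply: (edge_closed E); lra.
  apply/closureP => V Vy.
  have nx : nbhs x (arc i (c 2%N) (c 3%N)).
    apply: open_nbhs_nbhs; split; first by apply: (edge_open E); lra.
    by rewrite xa; exists a => //=; rewrite in_itv.
  have nb : nbhs (x, y) (arc i (c 2%N) (c 3%N) `*` V).
    by apply/nbhs_pair; exists (arc i (c 2%N) (c 3%N)), V; split.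
  have [t [Nt [[s /= + sp] Vq]]] := lxy _ nb N; rewrite in_itv /= => sc.
  have [m [Mm pm qm]] := NP t Nt; exists (orb f q t); split=> //.
  have [l1' s23 l3'] : [/\ 0 <= c 1%N, c 2%N <= s <= c 3%N & c 4%N <= 1] by split; lra.
  have psm : (iter m f @` U) (h i s) by rewrite sp.
  have [z /= + <-] := hull E (iter_connected cf cU) l1' o1 s23 o3 l3' psm
    (WM 1%N m U isT Mm UW) (WM 3%N m U isT Mm UW) qm.
  by rewrite in_itv /= => zc; exists z => //=; rewrite in_itv /=; lra.
have perU := no_periodic E cf nH iE tail_connected.
have ab : a <> b by move=> e_; apply: nxy; rewrite xa yb e_.
rewrite xa yb in lxy.
have [lt|ge] := ltP a b.
  apply: (oriented_limit_pair_absurd E cf nH iE omega_no_periodic perU shadow_exists _ _ _ _ _ lxy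
    (c0 := c 0%N) (c1 := c 1%N) (c2 := c 2%N) (c3 := c 3%N) (c4 := c 4%N) (c5 := c 5%N));
    [|exact: (cE 0%N)|exact: (cE 1%N)|exact: (cE 3%N)|exact: (cE 4%N)].
  by split; [lra|lra|lra|lra|split; lra].
have flip k : (k < 5)%N -> exists e, lims (orb f p) e /\
    ((fun s => h i (1 - s)) @` `]1 - c k.+1, 1 - c k[%classic) e.
  move=> /cE[z [lz [s /= + sz]]]; rewrite in_itv /= => sc; exists z; split=> //.
  by exists (1 - s); [rewrite /= in_itv /=; lra|rewrite subKr].
apply: (oriented_limit_pair_absurd (edges_flip E) (i := i) (a := 1 - a) (b := 1 - b) cf nH iE omega_no_periodic perU shadow_exists
    _ (flip 4%N isT) (flip 3%N isT) (flip 1%N isT) (flip 0%N isT)); last by rewrite !subKr.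
have ba : b < a by rewrite lt_neqAle ge andbT eq_sym; apply/eqP.
by split; [lra|lra|lra|lra|split; lra].
Qed.

End TailConnected.

(** * Residue classes of meeting images *)

Section Classes.
Context {T : topologicalType}.
Variable B : nat -> set T.
Hypothesis cB : forall m, connected (B m).
Hypothesis B0 : forall m, B m !=set0.
Hypothesis shift : forall m m', (B m `&` B m') !=set0 -> (B m.+1 `&` B m'.+1) !=set0.

Definition common_period c := forall m m', (B m `&` B m') !=set0 -> m = m' %[mod c].

(* The chains only use indices above [m], so that they survive in tails of the sequence. *)
Definition chained k := exists n, forall m, (n <= m)%N -> exists A : set nat,
  [/\ A m /\ A (m + k)%N, connected (\bigcup_(j in A) B j) &
    forall j, A j -> (m <= j)%N /\ forall c, common_period c -> m = j %[mod c]].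

Lemma meet_shift m m' k : (B m `&` B m') !=set0 -> (B (k + m)%N `&` B (k + m')%N) !=set0.
Proof. by move=> mm; elim: k => // k IH; exact: shift. Qed.

Lemma chained_meet m k : (B m `&` B (m + k)) !=set0 -> chained k.
Proof.
move=> mk; exists m => m1 mm1; exists [set m1; (m1 + k)%N].
have mm : (B m1 `&` B (m1 + k)) !=set0.
  by have := meet_shift (m1 - m) mk; rewrite addnA subnK.
split; [by split; [left|right]| |].
  rewrite bigcup_setU !bigcup_set1; exact: connectedU.

move=> j [->|->]; split=> //; [exact: leq_addr|].
by move=> c cc; exact: cc.
Qed.

(** The chains from [m] to [m + a] and from [m + (a - b)] to [m + a] share [B (m + a)], so their
    union links [m] to [m + (a - b)]. *)
Lemma chained_sub a b : (b <= a)%N -> chained a -> chained b -> chained (a - b).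
Proof.
move=> ba [n nP] [n' n'P]; exists (maxn n n') => m; rewrite geq_max => /andP[nm n'm].
have [A [[Am Ama] cA AP]] := nP m nm.
have [|A' [[Am' Ama'] cA' AP']] := n'P (m + (a - b))%N; first exact: leq_trans n'm (leq_addr _ _).
rewrite -addnA subnK // in Ama'.
exists (A `|` A'); split; first by split; [left|right].
  rewrite bigcup_setU; apply: connectedU => //.
  by have [x xB] := B0 (m + a); exists x; split; exists (m + a)%N.
move=> j [/AP//|/AP'[mj jc]]; split; first exact: leq_trans (leq_addr _ _) mj.
move=> c cc; rewrite -(jc c cc).
have [_ /(_ c cc) e1] := AP _ Ama; have [_ /(_ c cc) e2] := AP' _ Ama'.
by rewrite e2.
Qed.

Lemma chained_mod k a : (0 < k)%N -> chained k -> chained a -> chained (a %% k).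
Proof.
move=> k0 ck; elim/ltn_ind: a => a IH ca; have [ak|ka] := ltnP a k; first by rewrite modn_small.
have -> : (a %% k = (a - k) %% k)%N by rewrite -{1}(subnK ka) modnDr.
apply: IH; last exact: chained_sub.
by rewrite -subn_gt0 subKn.
Qed.

(** By Euclid's algorithm the least positive chained [k] divides every chained number, so it is a
    common period. Chains from [m + j * k] to [m + j.+1 * k] connect the class of [m], and the chain
    from [n] to [n + k] shows that every common period divides [k]. *)
Lemma gcd_components : (exists m d, (0 < d)%N /\ (B m `&` B (m + d)) !=set0) ->
  exists k n, [/\ (0 < k)%N, common_period k,
    forall m, (n <= m)%N -> connected (\bigcup_j B (m + j * k)) &
    forall c, common_period c -> (c %| k)%N].
Proof.
move=> [m0 [d0 [d00 /chained_meet cd]]].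
have ex : exists k, `[< (0 < k)%N /\ chained k >] by exists d0; apply/asboolP.
have [k /asboolP[k0 [n nP]] kmin] := ex_minnP ex.
have ck : chained k by exists n.
have dvd a : chained a -> (k %| a)%N.
  move=> ca; rewrite /dvdn; apply/eqP/eqP; rewrite -leqn0 leqNgt; apply/negP => ak.
  have : (k <= a %% k)%N by apply: kmin; apply/asboolP; split=> //; exact: chained_mod.
  by rewrite leqNgt ltn_pmod.
have cpk : common_period k.
  have le m m' : (m <= m')%N -> (B m `&` B m') !=set0 -> m = m' %[mod k].
    move=> mm' mB; have /dvd/dvdnP[j jk] : chained (m' - m) by apply: (@chained_meet m); rewrite subnKC.
    by rewrite -(subnKC mm') jk addnC modnMDl.
  move=> m m' mB; have [/le->//|m'm] := leqP m m'.
  by apply/esym/le; [exact: ltnW|rewrite setIC].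
exists k, n; split=> //; last first.
  move=> c cc; have [A [[Am Ak] _ AP]] := nP n (leqnn n).
  have [_ /(_ c cc)] := AP _ Ak.
  by rewrite -{1}(addn0 n) => /eqP; rewrite eqn_modDl mod0n => /eqP/esym/eqP.
move=> m nm; have [x0 x0B] := B0 m.
have Z j : exists Z, [/\ connected Z, Z x0, B (m + j * k) `<=` Z & Z `<=` \bigcup_j B (m + j * k)].
  elim: j => [|j [Z [cZ Zx ZB ZU]]].
    by exists (B m); rewrite mul0n addn0; split=> // x xB; exists 0%N; rewrite ?mul0n ?addn0.
  have [|A [[Am Ak] cA AP]] := nP (m + j * k)%N; first exact: leq_trans nm (leq_addr _ _).
  exists (Z `|` \bigcup_(j in A) B j); split.
  - apply: connectedU => //; have [x xB] := B0 (m + j * k).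
    by exists x; split; [exact: ZB|exists (m + j * k)%N].
  - by left.
  - by move=> x xB; right; exists (m + j.+1 * k)%N => //; rewrite mulSn [(k + _)%N]addnC addnA.
  - move=> x [/ZU//|[l /AP[ml /(_ k cpk) mlk] xl]].
    have mlm : (m <= l)%N by exact: leq_trans (leq_addr _ _) ml.
    have /dvdnP[i ik] : (k %| l - m)%N.
      by rewrite -eqn_mod_dvd // -mlk addnC modnMDl.
    by exists i => //; rewrite -ik subnKC.
have -> : \bigcup_j B (m + j * k) = \bigcup_j projT1 (cid (Z j)).
  rewrite predeqE => x; split=> [[j _ xj]|[j _]].
    by exists j => //; case: (cid (Z j)) => /= Z' [_ _ H _]; exact: H.
  by case: (cid (Z j)) => /= Z' [_ _ _ H] /H.
apply: bigcup_connected.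
  by exists x0 => j _; case: (cid (Z j)) => /= Z' [].
by move=> j _; case: (cid (Z j)) => /= Z' [].
Qed.

End Classes.

(** * Subcontinua of a graph *)

Lemma max_right {R : realType} (Z : set R) (s t M : R) : closed Z -> (forall x, Z x -> x <= M) ->
  s <= t -> `[s, t] `<=` Z ->
  exists b : R, [/\ t <= b, `[s, b] `<=` Z & forall b', `[s, b'] `<=` Z -> b' <= b].
Proof.
move=> cZ ZM st stZ; pose S := [set b : R | t <= b /\ `[s, b] `<=` Z].
have St : S t by split.
have hS : has_sup S.
  split; first by exists t.
  exists M => b [tb sb]; apply: ZM; apply: sb; rewrite /= in_itv /= lexx andbT; exact: le_trans tb.
have tb : t <= sup S by exact: (sup_upper_bound hS).
exists (sup S); split=> // [x|b' sb'].
  rewrite /= in_itv /= => /andP[sx]; rewrite le_eqVlt => /predU1P[->|xS].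
    rewrite (closure_id Z).1 //; apply/closureP => U /nbhs_ballP[e /= e0 eU].
    have [b [tb' bZ] be] := sup_adherent e0 hS.
    have bS : b <= sup S by apply: (sup_upper_bound hS); split.
    exists b; split; first by apply: bZ; rewrite /= in_itv /= lexx andbT; exact: le_trans tb'.
    by apply: eU; rewrite /ball /= ger0_norm; lra.
  have xS0 : 0 < sup S - x by rewrite subr_gt0.
  have [b [tb' bZ] be] := sup_adherent xS0 hS.
  by apply: bZ; rewrite /= in_itv /= sx /=; lra.
have [tb'|b't] := leP t b'; first by apply: (sup_upper_bound hS); split.
by apply: le_trans tb; exact: ltW.
Qed.

Lemma max_interval {R : realType} (Z : set R) (s M : R) : closed Z -> (forall x, Z x -> `|x| <= M) ->
  Z s -> exists a b : R, [/\ a <= s, s <= b, `[a, b] `<=` Z &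
    forall a' b' : R, a' <= a -> b <= b' -> `[a', b'] `<=` Z -> a' = a /\ b' = b].
Proof.
move=> cZ ZM Zs.
have ss : `[s, s] `<=` Z by move=> x; rewrite set_itv1 => ->.
have [|b [sb sbZ bm]] := max_right (M := M) cZ _ (lexx s) ss.
  by move=> x /ZM; apply: le_trans; exact: ler_norm.
have cZ' : closed [set x : R | Z (- x)].
  by apply: (closed_comp (f := fun x : R => - x)) cZ => x _; exact: opp_continuous.
have nb (u v : R) : `[- v, - u] `<=` [set x | Z (- x)] -> `[u, v] `<=` Z.
  move=> H x xuv; rewrite -(opprK x); apply: H; rewrite /= !in_itv /= in xuv *.
  by rewrite !lerN2 andbC.
have bn (u v : R) : `[u, v] `<=` Z -> `[- v, - u] `<=` [set x | Z (- x)].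
  move=> H x xuv; apply: H; move: xuv; rewrite /= !in_itv /=; lra.
have [|a [sa saZ am]] := max_right (M := M) cZ' _ (lexx (- s)) (bn _ _ ss).
  by move=> x /ZM; rewrite normrN; apply: le_trans; exact: ler_norm.
exists (- a), b; split; [lra|by []| |].
  move=> x; rewrite /= in_itv /= => /andP[ax xb]; have [xs|sx] := leP x s.
    by rewrite -(opprK x); apply: saZ; rewrite /= in_itv /=; lra.
  by apply: sbZ; rewrite /= in_itv /= xb andbT ltW.
move=> a' b' aa bb H.
have b'b : b' <= b by apply: bm => x /= xb; apply: H; move: xb; rewrite /= !in_itv /=; lra.
have a'a : - a' <= a.
  by apply: am => x /= xb; apply: H; move: xb; rewrite /= !in_itv /=; lra.
by split; lra.
Qed.

Section Subgraph.
Context {R : realType} {G : metricType R}.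
Context n (h : 'I_n -> R -> G) (g : 'I_n -> G -> R).
Hypothesis E : edges [set: G] h g.
Implicit Types (i j : 'I_n).
Local Notation arc i a b := (h i @` `]a, b[%classic).

Lemma subarc_homeo i (s t : R) : 0 <= s -> s < t -> t <= 1 ->
  homeomorphism (`[0, 1] : set R) (h i @` `[s, t])
    (fun r => h i (s + r * (t - s))) (fun x => (g i x - s) / (t - s)).
Proof.
move=> s0 st t1; have [h1 h2 h3 h4] := edge_homeo E i.
have ts0 : 0 < t - s by rewrite subr_gt0.
have param (r : R) : 0 <= r <= 1 -> s <= s + r * (t - s) <= t.
  by move=> r01; apply/andP; split; nra.
split.
- apply/seteqP; split=> _ [r /= + <-]; rewrite in_itv /= => rr.
    by exists (s + r * (t - s)) => //; rewrite /= in_itv /=; exact: param.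
  exists ((r - s) / (t - s)); last by rewrite divfK ?gt_eqF // addrC subrK.
  rewrite /= in_itv /= ler_pdivrMr // ler_pdivlMr //; lra.
- move=> r; rewrite /= in_itv /= => /param rr.
  rewrite (edge_K E); last by lra.
  by rewrite addrC addKr mulfK // gt_eqF.
- apply/subspace_continuousP => r; rewrite /= in_itv /= => r01 V Vr.
  have rr := param r r01; have [|e e0 eV] := edge_continuous E _ Vr; first lra.
  apply/nbhs_ballP; exists e => // r'; rewrite /ball /= in_itv /= => d r'01.
  apply: eV; first by have := param r' r'01; lra.
  have -> : s + r' * (t - s) - (s + r * (t - s)) = (t - s) * (r' - r) by lra.
  rewrite normrM gtr0_norm // distrC; apply: le_lt_trans d.
  rewrite ler_piMl //; lra.
- have sub : h i @` `[s, t] `<=` h i @` `[0, 1].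
    by move=> _ [r /= + <-]; rewrite in_itv /= => ?; exists r => //=; rewrite in_itv /=; lra.
  have {}h4 := continuous_subspaceW sub h4.
  by move=> x; apply: cvgMl; apply: cvgB; [exact: h4|exact: cvg_cst].
Qed.

Lemma subarc_endpoint i (s t : R) : 0 <= s -> s < t -> t <= 1 ->
  arc_endpoint (h i @` `[s, t]) (h i s) /\ arc_endpoint (h i @` `[s, t]) (h i t).
Proof.
move=> s0 st t1; have H := subarc_homeo i s0 st t1.
split; eexists _, _; (split; first exact: H).
  by left; rewrite mul0r addr0.
by right; rewrite mul1r addrC subrK.
Qed.

Variables (J : set G) (u v : G).
Hypotheses (kJ : compact J) (cJ : connected J) (Ju : J u) (Jv : J v) (uv : u <> v).

Let Z i := [set s : R | 0 <= s <= 1 /\ J (h i s)].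
Let mx i (s t : R) := `[s, t] `<=` Z i /\
  forall s' t' : R, s' <= s -> t <= t' -> `[s', t'] `<=` Z i -> s' = s /\ t' = t.

Let closedJ : closed J. Proof. by apply: compact_closed => //; exact: metric_hausdorff. Qed.

Let closedZ i : closed (Z i).
Proof.
have -> : Z i = `[0, 1] `&` [set s : R | 0 <= s <= 1 -> J (h i s)].
  by apply/seteqP; split=> s /=; rewrite in_itv /= => -[s01 H]; split=> //; exact: H.
apply/closure_id; apply/seteqP; split; first exact: subset_closure.
move=> s sc; have s01 : 0 <= s <= 1.
  have : closure (`[0, 1] : set R) s by apply: (closureS _ sc) => x [].
  rewrite -((closure_id (`[0, 1] : set R)).1 _) /= ?in_itv //; exact: itv_closed.
split=> [|_]; first by rewrite /= in_itv.
rewrite (closure_id J).1 //; apply/closureP => U /(edge_continuous E s01)[e e0 eU].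
have [t [[/= + Jt] st]] := (closureP _ _).1 sc _ (nbhsx_ballx s _ e0).
rewrite in_itv /= => t01; exists (h i t); split; first exact: Jt.
by apply: eU => //; rewrite distrC.
Qed.

Let mx_exists i s : Z i s -> exists a b : R, [/\ 0 <= a, a <= s, s <= b, b <= 1 & mx i a b].
Proof.
move=> Zs; have [|a [b [as_ sb abZ abm]]] := max_interval (M := 1) (closedZ (i := i)) _ Zs.
  by move=> x [x01 _]; rewrite ler_norml; lra.
have [a01 _] : Z i a by apply: abZ; rewrite /= in_itv /= lexx; exact: le_trans sb.
have [b01 _] : Z i b by apply: abZ; rewrite /= in_itv /= lexx andbT; exact: le_trans sb.
by exists a, b; split=> //; lra.
Qed.

(** Maximality yields missed parameters arbitrarily close to both ends of the segment, and these
    trap [J]. *)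
Let mx_interior i (a b : R) : 0 < a -> a <= b -> b < 1 -> mx i a b -> J `<=` h i @` `[a, b].
Proof.
move=> a0 ab b1 [abZ abm] x Jx.
have key (e : R) : 0 < e -> exists2 r : R, a - e <= r <= b + e & 0 <= r <= 1 /\ x = h i r.
  move=> e0; pose a' := Num.max 0 (a - e); pose b' := Num.min 1 (b + e).
  have [a'0 a'a a'e] : [/\ 0 <= a', a' < a & a - e <= a'].
    by rewrite /a' gt_max !le_max !lexx ?orbT; split=> //; lra.
  have [b'0 b'b b'e] : [/\ b' <= 1, b < b' & b' <= b + e].
    by rewrite /b' lt_min !ge_min !lexx ?orbT; split=> //; lra.
  have [c ca cZ] : exists2 c : R, a' <= c < a & ~ J (h i c).
    apply: contrapT => H; have [|ea _] := abm a' b (ltW a'a) (lexx b).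
      move=> c; rewrite /= in_itv /= => cb; have [ac|ca] := leP a c.
        by apply: abZ; rewrite /= in_itv /= ac; lra.
      split; first lra.
      by apply: contrapT => nJ; apply: H; exists c => //; lra.
    by move: a'a; rewrite ea ltxx.
  have [d bd dZ] : exists2 d : R, b < d <= b' & ~ J (h i d).
    apply: contrapT => H; have [|_ eb] := abm a b' (lexx a) (ltW b'b).
      move=> d; rewrite /= in_itv /= => ad; have [db|bd] := leP d b.
        by apply: abZ; rewrite /= in_itv /= db andbT; lra.
      split; first lra.
      by apply: contrapT => nJ; apply: H; exists d => //; lra.
    by move: b'b; rewrite eb ltxx.
  have Ja : J (h i a) by apply: (abZ a _).2; rewrite /= in_itv /= lexx.
  have [c0 cad d1] : [/\ 0 <= c, c < a < d & d <= 1] by split; lra.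
  have [r /= + <-] := trap_edge E cJ c0 cad d1 Ja cZ dZ Jx.
  by rewrite in_itv /= => cr; exists r; [lra|split; [lra|by []]].
have [r0 _ [r01 xr]] := key 1 ltr01; exists r0 => //.
have rE (e : R) : 0 < e -> a - e <= r0 <= b + e.
  by move=> /key[r re [r'01 xr']]; rewrite (@edge_inj _ _ _ _ _ E i r0 r) // -xr.
rewrite /= in_itv /=; apply/andP; split.
  by apply/ler_addgt0Pr => e /rE; lra.
by apply/ler_addgt0Pr => e /rE; lra.
Qed.

Let F : set (set G) := [set A | exists i (s t : R), [/\ 0 <= s, s < t, t <= 1, mx i s t & A = h i @` `[s, t]]].

Let F_sub A : F A -> A `<=` J.
Proof. by move=> [i [s [t [_ _ _ [stZ _] ->]]]] _ [r /stZ[_ Jr] <-]. Qed.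

Let F_compact A : F A -> compact A.
Proof. by move=> [i [s [t [s0 st t1 _ ->]]]]; apply: (homeo_compact (edge_homeo E i)). Qed.

Let F_interior i s : 0 < s < 1 -> J (h i s) -> exists2 A, F A & A (h i s).
Proof.
move=> s01 Js; have [|a [b [a0 as_ sb b1 mab]]] := @mx_exists i s; first by split=> //; lra.
exists (h i @` `[a, b]); last by exists s => //=; rewrite in_itv /= as_.
exists i, a, b; split=> //; rewrite lt_neqAle (le_trans as_ sb) andbT; apply/eqP => e.
have [a_0 b_1 ab_] : [/\ 0 < a, b < 1 & a <= b] by split; lra.
have H := mx_interior a_0 ab_ b_1 mab.
have [[x /= + xu] [y /= + yv]] := (H _ Ju, H _ Jv); rewrite !in_itv /= => xab yab.
by apply: uv; rewrite -xu -yv; congr (h i _); lra.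
Qed.

Let F_finite : finite_set F.
Proof.
pose F0 i := [set A | exists t : R, [/\ 0 < t, t <= 1, mx i 0 t & A = h i @` `[0, t]]].
pose F1 i := [set A | exists s : R, [/\ 0 <= s, s < 1, mx i s 1 & A = h i @` `[s, 1]]].
have sub1 (C : set (set G)) : (forall A B, C A -> C B -> A = B) -> finite_set C.
  move=> H; have [[A CA]|/nonemptyPn ->] := pselect (C !=set0); last exact: finite_set0.
  by apply: (sub_finite_set _ (finite_set1 A)) => B CB; rewrite /= (H A B).
apply: (@sub_finite_set _ _ ([set J] `|` (\bigcup_i F0 i `|` \bigcup_i F1 i))).
  move=> A [i [s [t [s0 st t1 m ->]]]].
  have [s_0|s_0] := ltP 0 s; last first.
    have s0E : s = 0 by lra.
    by right; left; exists i => //; exists t; rewrite -s0E.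
  have [t_1|t_1] := ltP t 1; last first.
    have t1E : t = 1 by lra.
    by right; right; exists i => //; exists s; rewrite -t1E; split=> //; rewrite -t1E in st.
  left; apply/seteqP; split; first by apply: F_sub; exists i, s, t.
  exact: (mx_interior s_0 (ltW st) t_1 m).
rewrite !finite_setU; split; first exact: finite_set1.
split; apply: bigcup_finite => // i _; apply: sub1 => A B.
- move=> [t [t0 t1 [tZ tm] ->]] [t' [t'0 t'1 [t'Z t'm] ->]].
  have [tt'|t't] := leP t t'; first by have [_ ->] := tm _ _ (lexx _) tt' t'Z.
  by have [_ ->] := t'm _ _ (lexx _) (ltW t't) tZ.
- move=> [t [t0 t1 [tZ tm] ->]] [t' [t'0 t'1 [t'Z t'm] ->]].
  have [tt'|t't] := leP t t'; first by have [-> _] := t'm _ _ tt' (lexx _) tZ.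
  by have [-> _] := tm _ _ (ltW t't) (lexx _) t'Z.
Qed.

(** Near an uncovered point [x] the set [J] contains only ends of edges, by [F_interior]. These are
    finitely many, so [x] would be isolated in the connected set [J], which has two points. *)
Let F_cover : J `<=` \bigcup_(A in F) A.
Proof.
move=> x Jx; apply: contrapT => nx.
have cF : closed (\bigcup_(A in F) A).
  by apply: closed_bigcup => // A /F_compact kA; apply: compact_closed => //; exact: metric_hausdorff.
have : nbhs x (~` \bigcup_(A in F) A) by apply: open_nbhs_nbhs; split=> //; exact: closed_openC.
move=> /nbhs_ballP[e /= e0 eF].
pose V := [set w | exists i, w = h i 0 \/ w = h i 1].
have VF y : J y -> ball x e y -> V y.
  move=> Jy /eF nF; have [i [s [s01 ys]]] := edge_cover E y; exists i.
  have [s0|s0] := ltP 0 s; last by left; rewrite ys; congr h; lra.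
  have [s1|s1] := ltP s 1; last by right; rewrite ys; congr h; lra.
  case: nF; rewrite ys; rewrite ys in Jy.
  have s01' : 0 < s < 1 by rewrite s0.
  by have [A FA Ay] := F_interior s01' Jy; exists A.
pose d (k : 'I_n * bool) := let w := h k.1 (if k.2 then 1 else 0) in
  if w == x then 1 else mdist x w.
have [k|r r0 rd] := @finType_min R _ d.
  by rewrite /d; case: eqP => // /eqP nw; rewrite mdist_gt0 eq_sym.
pose e1 := Num.min e r / 2.
have [e10 e1e e1r] : [/\ 0 < e1, 2 * e1 <= e & 2 * e1 <= r].
  have -> : 2 * e1 = Num.min e r by rewrite /e1 mulrC divfK // pnatr_eq0.
  by rewrite divr_gt0 ?lt_min ?e0 // !ge_min !lexx orbT.
have sub : J `<=` [set x].
  have H y : J y -> mdist x y < 2 * e1 -> y = x.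
    move=> Jy xy; have [|i Vi] := VF y Jy; first by rewrite ballEmdist /=; lra.
    apply: contrapT => nyx.
    have [w wy] : exists k : 'I_n * bool, y = h k.1 (if k.2 then 1 else 0).
      by case: Vi => yE; [exists (i, false)|exists (i, true)].
    have := rd w; rewrite /d -wy; case: eqP => // _; lra.
  have xx : ball x e1 x by exact: ballxx.
  have tr := @trap G J (interior (ball x e1)) x cJ Jx (nbhsx_ballx x _ e10) (@open_interior _ _).
  move=> y Jy; apply: (H y Jy).
  have {tr} : (ball x e1)^° y.
    apply: tr => // z Jz /closureP cz.
    rewrite (H z Jz); first exact: nbhsx_ballx.
    have [z' [/interior_subset]] := cz _ (nbhsx_ballx z _ e10).
    rewrite !ballEmdist /= => xz zz; have := metric_triangle x z' z.
    by rewrite (metric_sym z' z); lra.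
  by move=> /interior_subset; rewrite ballEmdist /=; lra.
by apply: uv; rewrite (sub _ Ju) (sub _ Jv).
Qed.

(** The arcs are the nondegenerate maximal segments of [J] on the edges. One that avoids both ends
    of its edge is all of [J]; the others contain an end, which leaves at most two per edge.
    Segments on different edges meet only at ends of those edges, hence at their own ends. *)
Lemma subcontinuum_graph : is_graph J.
Proof.
split; first by split=> //; exists u.
exists F; split=> //.
- move=> A [i [s [t [s0 st t1 _ ->]]]]; have H := subarc_homeo i s0 st t1.
  by eexists _, _; exact: H.
- move=> A B [i [s [t [s0 st t1 [stZ stm] ->]]]] [j [s' [t' [s'0 st' t'1 [st'Z st'm] ->]]]] AB.
  have [ij|ij] := eqVneq i j.
    rewrite -ij in st'Z st'm AB *; left; rewrite -subset0 => x [[r /= + <-] [r' /= + rr]].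
    rewrite !in_itv /= => rst r'st; have {}rr : r' = r by apply: (edge_inj E _ _ rr); lra.
    rewrite rr in r'st.
    have cov : `[Num.min s s', Num.max t t'] `<=` Z i.
      move=> y; rewrite /= in_itv /= ge_min le_max => /andP[y1 y2].
      have [yr|ry] := leP y r.
        case/orP: y1 => y1; [apply: stZ|apply: st'Z]; rewrite /= in_itv /= y1 /=; lra.
      by case/orP: y2 => y2; [apply: stZ|apply: st'Z]; rewrite /= in_itv /= y2 andbT; lra.
    have [||sE tE] := stm _ _ _ _ cov; rewrite ?ge_min ?le_max ?lexx //.
    have [||s'E t'E] := st'm _ _ _ _ cov; rewrite ?ge_min ?le_max ?lexx ?orbT //.
    by apply: AB; rewrite (etrans (esym sE) s'E) (etrans (esym tE) t'E).
  have [|/nonemptyPn] := pselect ((h i @` `[s, t] `&` h j @` `[s', t']) !=set0); last by left.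
  move=> [x [[r /= + rx] [r' /= + r'x]]]; rewrite !in_itv /= => rst r'st; right.
  have [_ _ E3 E4] := E; exists x.
  have [r01 r'01] : 0 <= r <= 1 /\ 0 <= r' <= 1 by split; lra.
  have rr' : h i r = h j r' by rewrite rx.
  have [e1 e2] := E3 i j r r' ij r01 r'01 rr'.
  have [is_ it_] := subarc_endpoint i s0 st t1; have [js_ jt_] := subarc_endpoint j s'0 st' t'1.
  split.
  + apply/seteqP; split=> y; last by move=> ->; split; [exists r|exists r'].
    move=> [[r2 /= + r2y] [r2' /= + r2'y]]; rewrite !in_itv /= => r2st r2'st.
    have rr2 : h i r2 = h j r2' by rewrite r2y.
    rewrite -r2y -rx; congr (h i _).
    by apply: (E4 i j r2 r2' r r' ij _ _ _ _ rr2 rr'); lra.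
  + rewrite -rx; case: e1 => e1.
      by have -> : r = s by lra.
    by have -> : r = t by lra.
  + rewrite -r'x; case: e2 => e2.
      by have -> : r' = s' by lra.
    by have -> : r' = t' by lra.
- apply/seteqP; split; first exact: F_cover.
  by move=> x [A /F_sub]; apply.
Qed.

End Subgraph.

(** * Solenoidal towers *)

Section Nested.
Context {R : realType} {G : metricType R}.
Hypothesis cG : compact [set: G].
Variable K : nat -> set G.
Hypotheses (clK : forall s, closed (K s)) (dK : forall s, K s.+1 `<=` K s).

Lemma nested_sub s s' : (s <= s')%N -> K s' `<=` K s.
Proof.
move=> /subnK <-; elim: (s' - s)%N => // k IH; apply: subset_trans IH; exact: dK.
Qed.

Lemma nested_lims (x : nat -> G) y : (forall s, K s (x s)) -> lims x y -> (\bigcap_s K s) y.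
Proof.
move=> Kx xy s _; apply: (lims_in (clK (s := s)) _ xy).
by exists s => m sm; exact: nested_sub (Kx m).
Qed.

Lemma nested_open O : open O -> \bigcap_s K s `<=` O -> exists s, K s `<=` O.
Proof.
move=> oO KO; apply: contrapT => H.
have /choice[x xP] : forall s, exists x, K s x /\ ~ O x.
  move=> s; apply: contrapT => nx; apply: H; exists s => x Kx.
  by apply: contrapT => nO; apply: nx; exists x.
have [y xy] := lims_exists x cG.
have := lims_in (open_closedC oO) (ex_intro _ 0%N (fun m _ => (xP m).2)) xy; apply; apply: KO.
by apply: nested_lims xy => s; exact: (xP s).1.
Qed.

Lemma nested_image (f : G -> G) : continuous f -> f @` (\bigcap_s K s) = \bigcap_s (f @` K s).
Proof.
move=> cf; apply/seteqP; split=> [_ [x Kx <-] s _|y Ky]; first by exists x => //; exact: Kx.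
have /choice[x xP] : forall s, exists x, K s x /\ f x = y.
  by move=> s; have [x ? ?] := Ky s I; exists x.
have [z xz] := lims_exists x cG.
exists z; first by apply: nested_lims xz => s; exact: (xP s).1.
have cl : closed [set x | f x = y].
  apply: (@closed_comp _ _ f [set y]) => [w _|]; first exact: cf.
  by apply: accessible_closed_set1; apply: hausdorff_accessible; exact: metric_hausdorff.
exact: (lims_in cl (ex_intro _ 0%N (fun m _ => (xP m).2)) xz).
Qed.

(** A clopen part [B] and the rest [B'] of the intersection are at a distance at least [e]. Some
    [K s] lies in the union of their [e / 3]-neighbourhoods and is trapped in that of [B]. *)
Lemma nested_connected : (forall s, connected (K s)) -> connected (\bigcap_s K s).
Proof.
move=> cK B B0 [C oC BC] [D cD BD]; apply: contrapT => nB.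
have clI : closed (\bigcap_s K s) by apply: closed_bigI => s _; exact: clK.
have clB : closed B by rewrite BD; exact: closedI.
pose B' := \bigcap_s K s `&` ~` C.
have clB' : closed B' by apply: closedI => //; exact: open_closedC.
have BB' : B `&` B' = set0.
  by rewrite -subset0 => x []; rewrite {1}BC => -[_ Cx] [_ /(_ Cx)].
have Bsub : B `<=` \bigcap_s K s by rewrite BC; exact: subIsetl.
have [c B'c] : B' !=set0.
  apply: contrapT => /nonemptyPn B'0; apply: nB; apply/seteqP; split=> // x Kx.
  rewrite BC; split=> //; apply: contrapT => nC.
  by have : B' x by []; rewrite B'0.
have [e e0 eP] := closed_disjoint_dist cG clB clB' BB'.
have e30 : 0 < e / 3 by rewrite divr_gt0.
pose U := \bigcup_(x in B) (ball x (e / 3))^°; pose V := \bigcup_(x in B') (ball x (e / 3))^°.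
have oU : open U by apply: bigcup_open => x _; exact: open_interior.
have oV : open V by apply: bigcup_open => x _; exact: open_interior.
have BU x : B x -> U x by move=> Bx; exists x => //; exact: nbhsx_ballx.
have BV x : B' x -> V x by move=> Bx; exists x => //; exact: nbhsx_ballx.
have Uball x : U x -> exists2 b, B b & mdist b x < e / 3.
  by move=> [b Bb /interior_subset]; rewrite ballEmdist /=; exists b.
have Vball x : V x -> exists2 b, B' b & mdist b x < e / 3.
  by move=> [b Bb /interior_subset]; rewrite ballEmdist /=; exists b.
have [|s sUV] := nested_open (openU oU oV).
  move=> x Kx; have [Cx|nC] := pselect (C x); first by left; apply: BU; rewrite BC.
  by right; apply: BV.
have [b Bb] := B0.
have sub : K s `<=` U.
  apply: (trap (cK s) (Bsub b Bb s I) (BU b Bb) oU) => y /sUV[//|/Vball[b' B'b' b'y]] /closureP.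
  move=> /(_ _ (nbhsx_ballx y _ e30))[z [/Uball[b2 Bb2 b2z]]]; rewrite ballEmdist /= => yz.
  have := eP _ _ Bb2 B'b'.
  have := metric_triangle b2 z b'; have := metric_triangle z y b'.
  rewrite (metric_sym z y) (metric_sym y b'); lra.
have [b2 Bb2 b2c] := Uball c (sub c (B'c.1 s I)).
have := eP _ _ Bb2 B'c; lra.
Qed.

End Nested.

(** One floor of the tower along the orbit of [p]. Only indices from [n] on are constrained, since
    residue classes become connected only in tails. *)
Definition level {R : realType} {G : metricType R} (f : G -> G) p (W : nat -> set G) N n :=
  [/\ (0 < N)%N,
      forall m, (n <= m)%N -> closed (W m) /\ connected (W m),
      forall m, (n <= m)%N -> f @` W m = W m.+1 /\ W (m + N)%N `<=` W m,
      forall m m', (n <= m)%N -> (n <= m')%N -> (W m `&` W m') !=set0 -> m = m' %[mod N] &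
      forall m, (n <= m)%N -> W m (orb f p m)].

Section Level.
Context {R : realType} {G : metricType R}.
Context n (h : 'I_n -> R -> G) (g : 'I_n -> G -> R).
Hypothesis E : edges [set: G] h g.
Context (f : G -> G) (p q : G).
Hypothesis cf : continuous f.
Local Notation cG := (graph_compact E).

Section OneLevel.
Context (W : nat -> set G) (N k : nat).
Hypothesis L : level f p W N k.

Lemma level_mono m j : (k <= m)%N -> W (m + j * N) `<=` W m.
Proof.
move=> km; have [_ _ H _ _] := L; elim: j => [|j IH]; first by rewrite mul0n addn0.
rewrite mulSn [(N + _)%N]addnC addnA; apply: subset_trans IH.
exact: (H _ (leq_trans km (leq_addr _ _))).2.
Qed.

Lemma level_iter m j : (k <= m)%N -> iter j f @` W m = W (j + m).
Proof.
move=> km; have [_ _ H _ _] := L; elim: j => [|j IH] /=; first by rewrite image_id.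
rewrite addSn -(H _ (leq_trans km (leq_addl _ _))).1 -IH.
by rewrite -image_comp.
Qed.

Lemma level_residue m : (k <= m)%N -> exists2 r, (r < N)%N & W m `<=` W (k + r).
Proof.
have [N0 _ _ _ _] := L.
move=> km; exists ((m - k) %% N)%N; first exact: ltn_pmod.
have := @level_mono (k + (m - k) %% N) ((m - k) %/ N) (leq_addr _ _).
by rewrite -addnA [((m - k) %% N + _)%N]addnC -divn_eq subnKC.
Qed.

Lemma level_omega z : lims (orb f p) z -> exists2 m, (k <= m)%N & W m z.
Proof.
have [N0 H1 _ _ Wp] := L.
move=> lz; have cl : closed (\bigcup_(r in `I_N) W (k + r)).
  apply: closed_bigcup; first exact: finite_II.
  by move=> r _; exact: (H1 _ (leq_addr _ _)).1.
have [|r _ Wr] := lims_in cl _ lz; last by exists (k + r)%N; first exact: leq_addr.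
exists k => m km; have [r rN mr] := level_residue km.
by exists r => //; apply: mr; exact: Wp.
Qed.

Definition core a := \bigcap_j W (a + j * N).

(** A class only decreases under [f^N]; its nested intersection is mapped onto itself, and the two
    points [u <> v] make it a nondegenerate continuum. *)
Lemma core_periodic a u v : (k <= a)%N -> core a u -> core a v -> u <> v ->
  periodic_subgraph f (core a) N.
Proof.
move=> ka au av uv; have [N0 H1 H2 H3 Wp] := L.
have ge j : (k <= a + j * N)%N by exact: leq_trans ka (leq_addr _ _).
have cl j : closed (W (a + j * N)) by exact: (H1 _ (ge j)).1.
have dec j : W (a + j.+1 * N) `<=` W (a + j * N).
  by rewrite mulSn [(N + _)%N]addnC addnA; exact: (H2 _ (ge j)).2.
have clc : closed (core a) by apply: closed_bigI => j _; exact: cl.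
split=> //.
- apply: (subcontinuum_graph E _ _ au av uv).
    by apply: (subclosed_compact clc cG).
  by apply: (nested_connected cG cl dec) => j; exact: (H1 _ (ge j)).2.
- move=> i j /= iN jN [x [[y ay xy] [z az xz]]].
  have inW l w : core a w -> W (l + a) (iter l f w).
    move=> aw; rewrite -(level_iter l ka); exists w => //.
    by have := aw 0%N I; rewrite mul0n addn0.
  have ia l : (k <= l + a)%N by exact: leq_trans ka (leq_addl _ _).
  have : (i + a = j + a %[mod N])%N.
    apply: H3 => //; exists x; split; first by rewrite -xy; exact: inW.
    by rewrite -xz; exact: inW.
  by move/eqP; rewrite eqn_modDr !modn_small // => /eqP.
- rewrite (nested_image cG cl dec (iter_continuous cf)).
  apply/seteqP; split=> x xa j _.
    have := xa j I; rewrite level_iter // addnC.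
    exact: (H2 _ (ge j)).2.
  by rewrite level_iter // addnCA; have := xa j.+1 I; rewrite mulSn.
Qed.

End OneLevel.

Hypothesis prox : proximal f p q.
Hypothesis sep : separated_io f p q.
Variables (W : nat -> nat -> set G) (N k : nat -> nat).
Hypothesis L : forall t, level f p (W t) (N t) (k t).
Hypothesis Nt : forall t, (t <= N t)%N.
Hypothesis WS : forall t, exists M, forall m, (M <= m)%N -> W t.+1 m `<=` W t m.

(* The orbit of a diagonal limit point is infinite, so it enters the interior of some class. *)
Lemma levels_sync t : exists m0 r0, (k t <= r0)%N /\
  forall l, W t (l + r0) (orb f p (l + m0)) /\ W t (l + r0) (orb f q (l + m0)).
Proof.
have [u lu] := proximal_diag cG prox.
have lpu := pair_lims_fst lu.
(* A coincidence would make the period of every level divide [j - i], whereas level [(j - i).+1] has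
   a larger period. *)
have inj i j : (i < j)%N -> iter i f u <> iter j f u.
  move=> ij eij; have lz : lims (orb f p) (iter i f u).
    by elim: (i) => //= l IH; exact: lims_image.
  have [m km Wz] := level_omega (L (j - i).+1) lz.
  have [N0 _ _ H _] := L (j - i).+1.
  have /H : (W (j - i).+1 m `&` W (j - i).+1 (j - i + m)) !=set0.
    exists (iter i f u); split=> //.
    rewrite -(level_iter (L _) _ km); exists (iter i f u) => //.
    by rewrite -iterD subnK // ltnW.
  move=> /(_ km (leq_trans km (leq_addl _ _)))/eqP.
  rewrite -{1}(add0n m) eqn_modDr mod0n eq_sym => /dvdn_leq; rewrite subn_gt0 ij => /(_ isT).
  by rewrite leqNgt (Nt (j - i).+1).
have [N0 H1 H2 H3 Wp] := L t.
have [a [r [kr ar]]] : exists a r, (k t <= r)%N /\ (W t r)^° (iter a f u).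
  apply: contrapT => H.
  have fin : finite_set (\bigcup_(r in `I_(N t)) (closure (W t (k t + r)) `\` interior (W t (k t + r)))).
    apply: bigcup_finite; first exact: finite_II.
    by move=> r _; apply: (boundary_finite E); exact: (H1 _ (leq_addr _ _)).2.
  have [|i [j [ij eij]]] := @finite_pigeonhole _ _ (fun a => iter a f u) fin; last exact: inj ij eij.
  move=> a; have lz : lims (orb f p) (iter a f u).
    by elim: a => //= l IH; exact: lims_image.
  have [m km Wz] := level_omega (L t) lz; have [r rN mr] := level_residue (L t) km.
  exists r => //; split; first by apply: subset_closure; exact: mr.
  by move=> intr; apply: H; exists a, (k t + r)%N; split=> //; exact: leq_addr.
have la : lims (pair_orb f p q) (iter a f u, iter a f u).
  elim: {ar} a => // b IH U /=.
  have cF : {for (iter b f u, iter b f u), continuous (fun z : G * G => (f z.1, f z.2))}.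
    apply: cvg_pair => /=.
      by apply: (cvg_comp fst f); [exact: cvg_fst|exact: cf].
    by apply: (cvg_comp snd f); [exact: cvg_snd|exact: cf].
  move=> /cF/IH H M; have [m [Mm mU]] := H M.
  by exists m.+1; split; [exact: leqW|].
have nb : nbhs (iter a f u, iter a f u) (W t r `*` W t r).
  by apply/nbhs_pair; exists (W t r), (W t r); split.
have [m [km [/= pm qm]]] := la _ nb (k t).
exists m, r; split=> // l; split.
  by rewrite -(level_iter (L t) _ kr) orbD; exists (orb f p m).
by rewrite -(level_iter (L t) _ kr) orbD; exists (orb f q m).
Qed.

Lemma closedX (A B : set G) : closed A -> closed B -> closed (A `*` B).
Proof.
move=> cA cB; have -> : A `*` B = fst @^-1` A `&` snd @^-1` B by [].
by apply: closedI; apply: closed_comp => // z _; [exact: cvg_fst|exact: cvg_snd].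
Qed.

(** From the synchronisation time on both orbits lie in the same class, so at every depth [s] the
    limit pair lies in the square of one class; since [u] belongs to it, the residue of this class
    is independent of [s]. *)
Lemma levels_core u v t : lims (pair_orb f p q) (u, v) ->
  exists2 a, (k t <= a)%N & core (W t) (N t) a u /\ core (W t) (N t) a v.
Proof.
move=> luv; have [m0 [r0 [kr0 sync]]] := levels_sync t.
have [N0 H1 H2 H3 Wp] := L t.
have ge s r : (k t <= r0 + r + s * N t)%N.
  by rewrite -addnA; exact: leq_trans kr0 (leq_addr _ _).
have /choice[r rP] : forall s, exists r, (r < N t)%N /\
    (W t (r0 + r + s * N t) u /\ W t (r0 + r + s * N t) v).
  move=> s.
  have cl : closed (\bigcup_(r in `I_(N t)) (W t (r0 + r + s * N t) `*` W t (r0 + r + s * N t))).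
    apply: closed_bigcup; first exact: finite_II.
    by move=> r _; apply: closedX; exact: (H1 _ (ge s r)).1.
  have [|r rN [/= ? ?]] := lims_in cl _ luv; last by exists r.
  exists (m0 + s * N t)%N => m sm.
  have [pm qm] := sync (m - m0)%N; rewrite subnK in pm qm; last exact: leq_trans (leq_addr _ _) sm.
  pose d := (m - m0 - s * N t)%N; exists (d %% N t)%N; first exact: ltn_pmod.
  have dE : (m - m0 + r0 = (r0 + d %% N t + s * N t) + d %/ N t * N t)%N.
    have -> : (m - m0 = d + s * N t)%N.
      by rewrite /d subnK // leq_subRL //; exact: leq_trans (leq_addr _ _) sm.
    rewrite {1}(divn_eq d (N t)); move: (_ * N t)%N (_ * N t)%N (_ %% _)%N => *; lia.
  by rewrite dE in pm qm; split; apply: (level_mono (L t) (ge s _)); [exact: pm|exact: qm].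
have r_const s : r s = r 0%N.
  have [r0N [u0 _]] := rP 0%N; have [rsN [us _]] := rP s.
  have /H3 : (W t (r0 + r s + s * N t) `&` W t (r0 + r 0 + 0 * N t)) !=set0 by exists u.
  move=> /(_ (ge _ _) (ge _ _)) /eqP; rewrite mul0n addn0 addnC modnMDl eqn_modDl !modn_small //.
  by move/eqP.
exists (r0 + r 0%N)%N; first exact: leq_trans kr0 (leq_addr _ _).
by split=> s _; have [_ [us vs]] := rP s; rewrite -(r_const s).
Qed.

Lemma solenoid_NS_pair : exists x y, NS_pair f x y.
Proof.
have [u [v [luv uv]]] := pair_limit E sep.
have /choice[a aP] : forall t, exists a, (k t <= a)%N /\ (core (W t) (N t) a u /\ core (W t) (N t) a v).
  by move=> t; have [a ka uva] := levels_core t luv; exists a.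
exists u, v; split=> //.
- by exists p => //; rewrite omega_limitE; exact: pair_lims_fst luv.
- by exists q => //; rewrite omega_limitE; exact: pair_lims_snd luv.
exists (fun t => core (W t) (N t) (a t)), N; split.
- by move=> t; have [ka [ua va]] := aP t; exact: (core_periodic (L t) ka ua va).
- move=> t x xa j _; have [ka [ua va]] := aP t; have [ka' [ua' va']] := aP t.+1.
  have [M MP] := WS t; have [N0 H1 H2 H3 Wp] := L t.
  (* An index in the residue class of level [t.+1], large enough for [W t.+1 m] to lie in [W t m].
     As [u] is in [W t m] and in [W t (a t + j * N t)], the two indices are congruent modulo
     [N t]. *)
  pose m := (a t.+1 + (M + k t + (a t + j * N t)) * N t.+1)%N.
  have N1 : (0 < N t.+1)%N by have [] := L t.+1.
  have le : (M + k t + (a t + j * N t) <= m)%N.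
    by rewrite /m; apply: leq_trans (leq_addl _ _); exact: leq_pmulr.
  have Mm : (M <= m)%N by apply: leq_trans le; rewrite -addnA leq_addr.
  have km : (k t <= m)%N by apply: leq_trans le; rewrite addnAC leq_addl.
  have am : (a t + j * N t <= m)%N by apply: leq_trans le; exact: leq_addl.
  have xm : W t m x by apply: MP => //; exact: xa.
  have um : W t m u by apply: MP => //; exact: ua'.
  have kaj : (k t <= a t + j * N t)%N by exact: leq_trans ka (leq_addr _ _).
  have /H3 : (W t (a t + j * N t) `&` W t m) !=set0 by exists u; split=> //; exact: ua.
  move=> /(_ kaj km)/eqP; rewrite eq_sym eqn_mod_dvd // => /dvdnP[i iE].
  by apply: (level_mono (L t) kaj (j := i)); rewrite -iE subnKC.
- move=> A [M _ MA]; exists M => // t /= Mt; apply: MA => /=; exact: leq_trans Mt (Nt t).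
- by move=> t; have [_ []] := aP t.
Qed.

End Level.

Lemma finite_bound {T : eqType} (s : seq T) (P : T -> nat -> Prop) :
  (forall t a b, (a <= b)%N -> P t a -> P t b) -> (forall t, exists b, P t b) ->
  exists b, forall t, t \in s -> P t b.
Proof.
move=> mono ex; elim: s => [|x s [b IH]]; first by exists 0%N.
have [c Pc] := ex x; exists (maxn b c) => t; rewrite in_cons => /predU1P[->|/IH].
  by apply: mono Pc; exact: leq_maxr.
by apply: mono; exact: leq_maxl.
Qed.

(** * Residue classes of a tail and their touching points *)

Definition tail_class {T : Type} (f : T -> T) (U : set T) k m : set T :=
  \bigcup_j (iter (m + j * k) f @` U).

Lemma tail_class_sub {T : Type} (f : T -> T) (U V : set T) k l m : U `<=` V -> (k %| l)%N ->
  tail_class f U l m `<=` tail_class f V k m.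
Proof.
move=> UV /dvdnP[c ->] x [j _ [y Uy yx]]; exists (j * c)%N => //.
by exists y; [exact: UV|rewrite -mulnA].
Qed.

Section TailClass.
Context {R : realType} {G : metricType R}.
Context n (h : 'I_n -> R -> G) (g : 'I_n -> G -> R).
Hypothesis E : edges [set: G] h g.
Context (f : G -> G) (p : G).
Hypothesis cf : continuous f.
Hypothesis iE : infinite_set (lims (orb f p)).
Local Notation cG := (graph_compact E).
Variables (U : set G) (k b : nat).
Hypotheses (Up : U p) (k0 : (0 < k)%N).
Hypothesis per : common_period (fun m => iter m f @` U) k.
Hypothesis conn : forall m, (b <= m)%N -> connected (tail_class f U k m).
Local Notation C := (tail_class f U k).
Local Notation F m := (closure (C m)).

Lemma class_image m : f @` C m = C m.+1.
Proof.
rewrite /tail_class image_bigcup; apply: eq_bigcupr => j _.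
by rewrite addSn -[in LHS](image_iterD f U 1).
Qed.

Lemma class_orb m : C m (orb f p m).
Proof. by exists 0%N => //; rewrite mul0n addn0; exists p. Qed.

Lemma class_shift m j : C (m + j * k) `<=` C m.
Proof. by move=> x [i _ H]; exists (j + i)%N => //; rewrite mulnDl addnA. Qed.

Lemma class_meet m m' : (C m `&` C m') !=set0 -> m = m' %[mod k].
Proof.
move=> [x [[j _ xj] [j' _ xj']]].
have := per (ex_intro _ x (conj xj xj')).
by rewrite addnC modnMDl addnC modnMDl.
Qed.

Lemma closure_class_image m : f @` F m = F m.+1.
Proof.
apply/seteqP; split=> [_ [x xF <-]|y].
  apply/closureP => V /cf /(((closureP _ _).1 xF) _)[z [Cz Vz]].
  by exists (f z); split=> //; rewrite -class_image; exists z.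
have : closed (f @` F m).
  apply: compact_closed; first exact: metric_hausdorff.
  apply: continuous_compact; first exact: continuous_subspaceT.
  by apply: (subclosed_compact _ cG) => //; exact: closed_closure.
move=> /closure_id ->; apply: closureS; rewrite -class_image.
by apply: image_subset; exact: subset_closure.
Qed.

Lemma closure_class_iter m j : iter j f @` F m = F (j + m).
Proof.
elim: j => [|j IH]; first by rewrite image_id.
by rewrite addSn -closure_class_image -IH -image_comp.
Qed.

Lemma class_residue m : (b <= m)%N -> exists2 r, (r < k)%N & C m `<=` C (b + r) /\ m = b + r %[mod k].
Proof.
move=> bm; exists ((m - b) %% k)%N; first exact: ltn_pmod.
have e : (m = b + (m - b) %% k + (m - b) %/ k * k)%N.
  by rewrite -addnA [((m - b) %% k + _)%N]addnC -divn_eq subnKC.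
by split; [rewrite {1}e; exact: class_shift|rewrite {1}e addnC modnMDl].
Qed.

Definition touch := [set x | exists m m', [/\ (b <= m)%N, (b <= m')%N, m <> m' %[mod k], F m x & F m' x]].

(** A point in the closure of another, disjoint class is not interior to its own, so it is one of
    the finitely many boundary points of the [k] classes. *)
Lemma touch_finite : finite_set touch.
Proof.
apply: (@sub_finite_set _ _ (\bigcup_(r in `I_k) (closure (C (b + r)) `\` interior (C (b + r))))); last first.
  apply: bigcup_finite; first exact: finite_II.
  by move=> r _; apply: (boundary_finite E); exact: conn (leq_addr _ _).
move=> x [m [m' [bm bm' mm' mx m'x]]].
have [r rk [Cr mr]] := class_residue bm; have [r' r'k [Cr' mr']] := class_residue bm'.
exists r => //; split; first exact: closureS Cr _ mx.
move=> xint; apply: mm'; rewrite mr mr'; apply: class_meet.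
have [y [yC' yint]] := (closureP _ _).1 m'x _ (open_nbhs_nbhs (conj (@open_interior _ _) xint)).
by exists y; split; [exact: interior_subset yint|exact: Cr'].
Qed.

Lemma touch_image x : touch x -> touch (f x).
Proof.
move=> [m [m' [bm bm' mm' mx m'x]]]; exists m.+1, m'.+1; split; rewrite ?leqW //.
- move=> H; apply: mm'; apply/eqP; rewrite -(eqn_modDl 1) !add1n; exact/eqP.
- by rewrite -closure_class_image; exists x.
- by rewrite -closure_class_image; exists x.
Qed.

(** A point of period [d] in one closed class lies in the [k %/ d] closed classes obtained by
    shifting the index by multiples of [d]. The classes themselves are disjoint, so their number is
    at most the valence of [z]. *)
Lemma class_periodic_bound z d (I : finType) (gam : I -> R -> G) m : star z gam -> (0 < d)%N ->
  iter d f z = z -> (b <= m)%N -> F m z -> (k <= #|I|.+1 * d)%N.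
Proof.
move=> S d0 dz bm zF; pose K := (k %/ d)%N.
have bml l : (b <= m + l * d)%N by exact: leq_trans bm (leq_addr _ _).
(* Every class contains two different orbit points, one of which is not [z]. *)
have /choice[c cP] : forall l : 'I_K, exists c, C (m + l * d) c /\ c <> z.
  move=> l; have [e|ne] := pselect (orb f p (m + l * d) = z); last first.
    by exists (orb f p (m + l * d)); split=> //; exact: class_orb.
  exists (orb f p (m + l * d + 1 * k)); split; first by apply: (@class_shift _ 1); exact: class_orb.
  rewrite -e => /(infinite_orb_inj iE)/eqP.
  by rewrite mul1n -{2}[(m + l * d)%N]addn0 eqn_add2l -leqn0 leqNgt k0.
have KI : (K <= #|I|)%N.
  rewrite -[K]card_ord.
  apply: (star_valence S (C := fun l : 'I_K => C (m + l * d)) (c := c)) => //.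
  - by move=> l; exact: conn.
  - move=> l; rewrite addnC -closure_class_iter; exists z => //.
    by elim: (nat_of_ord l) => //= i IH; rewrite mulSn iterD IH.
  - move=> i j ij; rewrite -subset0 => x ?; apply: ij; apply/val_inj => /=.
    have /eqP : (m + i * d = m + j * d %[mod k])%N by apply: class_meet; exists x.
    have lt (l : 'I_K) : (l * d < k)%N.
      by apply: leq_trans (leq_trunc_div k d); rewrite ltn_pmul2r.
    by rewrite eqn_modDl !modn_small // eqn_pmul2r // => /eqP.
apply: leq_trans (ltnW (ltn_ceil k d0)) _.
by rewrite leq_pmul2r // ltnS.
Qed.

End TailClass.

Section Solenoid.
Context {R : realType} {G : metricType R}.
Context n (h : 'I_n -> R -> G) (g : 'I_n -> G -> R).
Hypothesis E : edges [set: G] h g.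
Context (f : G -> G) (p : G).
Hypothesis cf : continuous f.
Hypothesis iE : infinite_set (lims (orb f p)).
Local Notation cG := (graph_compact E).
Variables (U : nat -> set G) (k b : nat -> nat).
Hypotheses (Up : forall i, U i p) (k0 : forall i, (0 < k i)%N).
Hypothesis per : forall i, common_period (fun m => iter m f @` U i) (k i).
Hypothesis conn : forall i m, (b i <= m)%N -> connected (tail_class f (U i) (k i) m).
Hypotheses (dU : forall i, U i.+1 `<=` U i) (dk : forall i, (k i %| k i.+1)%N) (ki : forall i, (i <= k i)%N).
Local Notation F i m := (closure (tail_class f (U i) (k i) m)).

Lemma period_dvd i j : (i <= j)%N -> (k i %| k j)%N.
Proof.
by move=> /subnK <-; elim: (j - i)%N => // l IH; rewrite addSn; exact: dvdn_trans IH (dk _).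
Qed.

Lemma class_nested i j m : (i <= j)%N -> F j m `<=` F i m.
Proof.
move=> ij; apply: closureS; apply: tail_class_sub; last exact: period_dvd.
by move: ij => /subnK <-; elim: (j - i)%N => // l IH; apply: subset_trans IH; exact: dU.
Qed.

(* A touching point is eventually periodic; if it were in a deep level, too many disjoint classes
   would accumulate at a periodic point of bounded valence. *)
Lemma avoid_touch i : exists2 j, (i < j)%N & forall m x, (b j <= m)%N ->
  F j m x -> ~ touch f (U i) (k i) (b i) x.
Proof.
have fT := touch_finite E (k0 i) (@per i) (@conn i).
have [s sT] : exists s : seq G, touch f (U i) (k i) (b i) = [set` s] by exact/finite_seqP.
pose P z B := forall d, (0 < d)%N -> iter d f z = z ->
  forall j m, (b j <= m)%N -> F j m z -> (k j <= B)%N.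
have [z a c ac Pa d d0 dz j m bm zF|z|B BP] := @finite_bound _ s P.
- by apply: leq_trans ac; exact: (Pa d d0 dz j m).
- have [[d [d0 dz]]|nd] := pselect (exists d, (0 < d)%N /\ iter d f z = z); last first.
    by exists 0%N => d d0 dz; case: nd; exists d.
  have [I [gam S]] := star_exists E z; exists (#|I|.+1 * d)%N => d' _ _ j m bm zF.
  exact: (class_periodic_bound E cf iE (Up j) (k0 j) (@per j) (@conn j) S d0 dz bm zF).
exists (maxn i B).+1; first by rewrite ltnS leq_maxl.
move=> m x bm xF Tx; set j := (maxn i B).+1 in bm xF.
have Tf a : touch f (U i) (k i) (b i) (iter a f x) by elim: a => // a IH; exact: (touch_image E cf IH).
have [a [c [ac eac]]] := @finite_pigeonhole _ _ (fun a => iter a f x) fT Tf.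
have zs : iter a f x \in s by have := Tf a; rewrite sT.
have d0 : (0 < c - a)%N by rewrite subn_gt0.
have dz : iter (c - a) f (iter a f x) = iter a f x by rewrite -iterD subnK // ltnW.
have zF : F j (a + m) (iter a f x) by rewrite -(closure_class_iter E cf); exists x.
have := BP _ zs _ d0 dz j (a + m)%N (leq_trans bm (leq_addl _ _)) zF.
rewrite leqNgt => /negP; apply; apply: leq_trans (ki j).
by rewrite ltnS leq_maxr.
Qed.

(** At a deep level [j] the closed classes avoid the touching points of level [i], so they meet only
    within a class modulo [k i]. Applying [gcd_components] to these closed classes joins them into
    classes of a period [N] that lies between [k i] and [k j] for divisibility. *)
Lemma level_above i : exists (W : nat -> set G) N a j,
  [/\ level f p W N a, (k i %| N)%N, (N %| k j)%N, (i < j)%N & forall m, W m = \bigcup_l F j (m + l * N)].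
Proof.
have [j ij av] := avoid_touch i; pose a := maxn (b i) (b j).
have bia m : (b i <= a + m)%N by exact: leq_trans (leq_maxl _ _) (leq_addr _ _).
have bja m : (b j <= a + m)%N by exact: leq_trans (leq_maxr _ _) (leq_addr _ _).
have shiftF m l : F j (m + l * k j) `<=` F j m by apply: closureS; exact: class_shift.
pose B m := F j (a + m).
have Bne m : B m !=set0.
  by exists (orb f p (a + m)); apply: subset_closure; exact: class_orb.
have [||x y [z [xz yz]]||N [c [N0 Nper Nconn Nuni]]] := @gcd_components _ B.
- by move=> m; apply: connected_closure; apply: conn; exact: bja.
- exact: Bne.
- by exists (f z); split; rewrite /B addnS -(closure_class_image E cf); exists z.
- exists 0%N, (k j); split=> //; have [z zB] := Bne (k j); exists z; split=> //.
  by apply: (shiftF _ 1%N); rewrite mul1n /B addn0.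
have kiN : (k i %| N)%N.
  apply: Nuni => m m' [z [zm zm']]; apply: contrapT => ne.
  apply: (av (a + m)%N z (bja _) zm); exists (a + m)%N, (a + m')%N; split=> //.
  - by move=> /eqP; rewrite eqn_modDl => /eqP.
  - exact: class_nested (ltnW ij) _ zm.
  - exact: class_nested (ltnW ij) _ zm'.
have Nkj : (N %| k j)%N.
  have [z zB] := Bne (k j).
  have /Nper : (B (k j) `&` B 0%N) !=set0.
    exists z; split=> //; apply: (shiftF _ 1%N); by rewrite mul1n addn0.
  by rewrite mod0n => /eqP.
exists (fun m => \bigcup_l F j (m + l * N)), N, (a + c)%N, j; split=> //.
have e m : (a + c <= m)%N -> exists2 m', m = (a + m')%N & (c <= m')%N.
  move=> acm; exists (m - a)%N; last by rewrite leq_subRL //; exact: leq_trans (leq_addr _ _) acm.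
  by rewrite subnKC //; exact: leq_trans (leq_addr _ _) acm.
split=> //.
- move=> m /e[m' -> cm']; split.
    (* Reducing [l] modulo [k j] only enlarges the closed class, so the union is finite and
       therefore closed. *)
    have -> : \bigcup_l F j (a + m' + l * N) = \bigcup_(l in `I_(k j)) F j (a + m' + l * N).
      apply/seteqP; split=> z [l lk zl]; last by exists l.
      exists (l %% k j)%N; first exact: ltn_pmod.
      apply: (shiftF _ (l %/ k j * N)%N).
      by rewrite -addnA mulnAC -mulnDl addnC [(_ %% _ + _)%N]addnC -divn_eq addnC.
    by apply: closed_bigcup; [exact: finite_II|move=> l _; exact: closed_closure].
  have -> : \bigcup_l F j (a + m' + l * N) = \bigcup_l B (m' + l * N).
    by apply: eq_bigcupr => l _; rewrite /B addnA.
  exact: Nconn.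
- move=> m acm; split.
    by rewrite image_bigcup; apply: eq_bigcupr => l _; rewrite (closure_class_image E cf).
  by move=> z [l _ zl]; exists l.+1 => //; rewrite mulSn addnA.
- move=> m m' /e[m1 -> _] /e[m2 -> _] [z [[l _ zl] [l' _ zl']]].
  have /Nper : (B (m1 + l * N)%N `&` B (m2 + l' * N)%N) !=set0.
    by exists z; rewrite /B !addnA.
  rewrite addnC modnMDl addnC modnMDl => /eqP H.
  by apply/eqP; rewrite eqn_modDl.
- move=> m _; exists 0%N => //; rewrite mul0n addn0; apply: subset_closure; exact: class_orb.
Qed.

Lemma unbounded_periods_NS_pair q : proximal f p q ->
  separated_io f p q ->
  exists x y, NS_pair f x y.
Proof.
move=> prox sep.
have /choice[D DP] : forall i, exists D : (nat -> set G) * nat * nat * nat,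
  [/\ level f p D.1.1.1 D.1.1.2 D.1.2, (k i %| D.1.1.2)%N, (D.1.1.2 %| k D.2)%N, (i < D.2)%N &
    forall m, D.1.1.1 m = \bigcup_l F D.2 (m + l * D.1.1.2)].
  by move=> i; have [W [N [a [j H]]]] := level_above i; exists (W, N, a, j).
pose nx i := (D i).2; pose idx t := iter t nx 0%N.
have idxt t : (t <= idx t)%N.
  elim: t => // t IH; apply: leq_ltn_trans IH _.
  by have [_ _ _ H _] := DP (idx t).
apply: (solenoid_NS_pair E cf prox sep (W := fun t => (D (idx t)).1.1.1)
  (N := fun t => (D (idx t)).1.1.2) (k := fun t => (D (idx t)).1.2)).
- by move=> t; have [] := DP (idx t).
- move=> t; have [[N0 _ _ _ _] kN _ _ _] := DP (idx t).
  apply: leq_trans (idxt t) _; apply: leq_trans (ki _) _; exact: dvdn_leq.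
- move=> t; exists 0%N => m _; have [_ _ Nk _ ->] := DP (idx t).
  have [_ kN _ lt ->] := DP (idx t.+1).
  have /dvdnP[c cE] : ((D (idx t)).1.1.2 %| (D (idx t.+1)).1.1.2)%N by exact: dvdn_trans Nk kN.
  move=> x [l _ xl]; exists (l * c)%N => //.
  by rewrite -mulnA -cE; exact: class_nested (ltnW lt) _ xl.
Qed.

End Solenoid.

(** * Scrambled pairs *)

Section LimsResidue.
Context {T : topologicalType}.

(** One residue [r] modulo [k] occurs infinitely often near [y], and [lims_lift] undoes the last [r]
    steps. *)
Lemma lims_residue (u : nat -> T) (F : T -> T) y k : compact [set: T] -> hausdorff_space T ->
  continuous F -> (forall n, u n.+1 = F (u n)) -> (0 < k)%N -> lims u y ->
  exists r x, [/\ (r < k)%N, lims (fun m => u (m * k)%N) x & iter r F x = y].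
Proof.
move=> cT hT cF uS k0 uy.
have uD r n : u (r + n)%N = iter r F (u n) by elim: r => // r IH; rewrite addSn uS IH.
have [r rP] : exists r : 'I_k, forall V, nbhs y V -> io (fun m => V (u (r + m * k)%N)).
  apply: contrapT => H.
  have /choice[V VP] : forall r : 'I_k, exists V, nbhs y V /\ ~ io (fun m => V (u (r + m * k)%N)).
    move=> r; apply: contrapT => nV; apply: H; exists r => V Vy.
    by apply: contrapT => nio; apply: nV; exists V.
  have Vy : nbhs y [set z | forall r : 'I_k, V r z] by apply: filter_forall => r; exact: (VP r).1.
  have /io_pigeon[r /= rio] : io (fun n => exists r : 'I_k, (n %% k = r)%N /\ V r (u n)).
    apply: io_sub (uy _ Vy) => n Vn; exists (Ordinal (ltn_pmod n k0)); split=> //; exact: Vn.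
  apply: (VP r).2 => N; have [n [Nn [nr Vn]]] := rio (r + N * k)%N.
  exists (n %/ k)%N; split; last by rewrite -nr addnC -divn_eq.
  by rewrite leq_divRL //; exact: leq_trans (leq_addl _ _) Nn.
have lr : lims (iter r F \o (fun m => u (m * k)%N)) y.
  by move=> V /rP; apply: io_sub => m /=; rewrite uD.
have [x lx xy] := lims_lift cT hT (iter_continuous cF) lr.
by exists r, x.
Qed.

End LimsResidue.

Section Scrambled.
Context {R : realType} {G : metricType R}.
Implicit Types (f : G -> G) (p q : G).

Lemma scrambledP f p q : scrambled f p q <-> proximal f p q /\ separated_io f p q.
Proof.
rewrite /scrambled; set u := fun n => (mdist (iter n f p) (iter n f q))%:E.
have uE : limn_einf u = ereal_sup (range (einfs u)).
  by rewrite limn_einf_lim; apply: cvg_lim => //; exact: cvg_einfs_sup.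
have einfsE m : einfs u m = ereal_inf [set u k | k in [set k | (m <= k)%N]] by [].
have dichot : (mdist (iter n f p) (iter n f q) @[n --> \oo] --> (0 : R)) <-> ~ separated_io f p q.
  split.
    move=> /cvgrPdist_lt cv [d d0 dio]; have [N _ NP] := cv d d0.
    have [n [Nn dn]] := dio N; have := NP n Nn.
    by rewrite sub0r normrN ger0_norm ?mdist_ge0 // ltNge dn.
  move=> ns; apply/cvgrPdist_lt => e e0.
  apply: contrapT => H; apply: ns; exists e => // N.
  apply: contrapT => nN; apply: H; exists N => // n /= Nn.
  rewrite sub0r normrN ger0_norm ?mdist_ge0 // ltNge; apply/negP => en.
  by apply: nN; exists n.
split=> [[u0 nc]|[pr se]]; split.
- move=> e e0 N; apply: contrapT => H.
  have : (e%:E <= limn_einf u)%E.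
    rewrite uE; apply: (@le_trans _ _ (einfs u N)); last by apply: ereal_sup_ubound; exists N.
    rewrite einfsE; apply: le_ereal_inf_tmp => _ [k /= Nk <-]; rewrite lee_fin leNgt; apply/negP => ke.
    by apply: H; exists k.
  by rewrite u0 lee_fin leNgt e0.
- by apply: contrapT => ns; apply: nc; exact/dichot.
- apply/eqP; rewrite uE eq_le; apply/andP; split.
    apply: ge_ereal_sup => _ [N _ <-]; rewrite einfsE; apply/lee_addgt0Pr => e e0.
    have [k [Nk ke]] := pr e e0 N; rewrite add0e.
    apply: (@le_trans _ _ (u k)); last by rewrite lee_fin ltW.
    by apply: ereal_inf_lbound; exists k.
  apply: (@le_trans _ _ (einfs u 0)); last by apply: ereal_sup_ubound; exists 0%N.
  by rewrite einfsE; apply: le_ereal_inf_tmp => _ [k _ <-]; rewrite lee_fin mdist_ge0.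
- by move/dichot; exact.
Qed.

Lemma lims_proximal f p q w : lims (pair_orb f p q) (w, w) -> proximal f p q.
Proof.
move=> lw e e0; have e20 : 0 < e / 2 by rewrite divr_gt0.
have nb : nbhs (w, w) (ball w (e / 2) `*` ball w (e / 2)).
  by apply/nbhs_pair; exists (ball w (e / 2)), (ball w (e / 2)); split=> //; exact: nbhsx_ballx.
apply: io_sub (lw _ nb) => k [/=]; rewrite !ballEmdist /= => k1 k2.
have := metric_triangle (orb f p k) w (orb f q k); rewrite metric_sym in k1; lra.
Qed.

Lemma lims_separated f p q u v : lims (pair_orb f p q) (u, v) -> u <> v -> separated_io f p q.
Proof.
move=> luv /eqP; rewrite -mdist_gt0; set d := mdist u v => d0.
have d30 : 0 < d / 3 by rewrite divr_gt0.
exists (d / 3) => //.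
have nb : nbhs (u, v) (ball u (d / 3) `*` ball v (d / 3)).
  by apply/nbhs_pair; exists (ball u (d / 3)), (ball v (d / 3)); split=> //; exact: nbhsx_ballx.
apply: io_sub (luv _ nb) => k [/=]; rewrite !ballEmdist /= => k1 k2.
have := metric_triangle u (orb f p k) v; have := metric_triangle (orb f p k) (orb f q k) v.
rewrite (metric_sym (orb f q k) v) -/d; lra.
Qed.

(* Near one of finitely many fixed limit points the sequence moves by small steps, so it cannot
   reach another one. *)
Lemma lims_fixed_unique (F : G -> G) p : compact [set: G] -> continuous F ->
  finite_set (lims (orb F p)) -> (forall z, lims (orb F p) z -> F z = z) ->
  forall x y, lims (orb F p) x -> lims (orb F p) y -> x = y.
Proof.
move=> cG cF fin fixd x y lx ly; apply: contrapT => xy.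
have acc : accessible_space G by apply: hausdorff_accessible; exact: metric_hausdorff.
have [|||e e0 eP] := @closed_disjoint_dist R G [set x] (lims (orb F p) `\ x) cG.
- exact: accessible_closed_set1.
- apply: accessible_finite_set_closed.1 => //; exact: sub_finite_set fin.
- by rewrite -subset0 => z [/= -> [_]]; apply.
have far z : lims (orb F p) z -> z <> x -> e <= mdist x z by move=> lz zx; exact: eP.
have e30 : 0 < e / 3 by rewrite divr_gt0.
pose O1 := [set z | mdist x z < e / 3].
have clust Q : io Q -> (forall n, Q n -> mdist x (orb F p n) < e / 3 /\ e / 3 <= mdist x (F (orb F p n))) -> False.
  move=> Qio QP; have [z zP] := io_cluster (orb F p) cG Qio.
  have lz : lims (orb F p) z by move=> U /zP; apply: io_sub => k [].
  have zx : z = x.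
    apply: contrapT => /(far z lz) ez.
    have [n [_ [/QP[n1 _]]]] := zP _ (nbhsx_ballx z _ e30) 0%N; rewrite ballEmdist /= => zn.
    have := metric_triangle x (orb F p n) z; rewrite (metric_sym (orb F p n) z); lra.
  rewrite zx in zP lz.
  have nb : nbhs (F x) (ball x (e / 3)) by rewrite (fixd x lz); exact: nbhsx_ballx.
  have [n [_ [/QP[_ n2]]]] := zP _ (cF _ _ nb) 0%N; rewrite /= ballEmdist /=; lra.
have [M MP] : exists M, forall n, (M <= n)%N -> mdist x (orb F p n) < e / 3 \/ 2 * (e / 3) < mdist x (orb F p n).
  apply: contrapT => H.
  have mid : io (fun n => e / 3 <= mdist x (orb F p n) <= 2 * (e / 3)).
    move=> N; apply: contrapT => nN; apply: H; exists N => n Nn.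
    have [?|h1] := ltP (mdist x (orb F p n)) (e / 3); first by left.
    have [?|h2] := ltP (2 * (e / 3)) (mdist x (orb F p n)); first by right.
    by case: nN; exists n; split=> //; rewrite h1.
  have [z zP] := io_cluster (orb F p) cG mid.
  have lz : lims (orb F p) z by move=> U /zP; apply: io_sub => k [].
  have [n [_ [/andP[n1 n2]]]] := zP _ (nbhsx_ballx z _ e30) 0%N; rewrite ballEmdist /= => zn.
  have [zx|zx] := pselect (z = x); first by move: zn; rewrite zx; lra.
  have := far z lz zx; have := metric_triangle x (orb F p n) z; rewrite (metric_sym (orb F p n) z); lra.
apply: (clust (fun n => mdist x (orb F p n) < e / 3 /\ e / 3 <= mdist x (F (orb F p n)))) => // N.
have [n0 [n0N n0x]] := lx _ (nbhsx_ballx x _ e30) (maxn M N).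
have [n1 [n1n n1y]] := ly _ (nbhsx_ballx y _ e30) n0.
move: n0x n1y; rewrite !ballEmdist /= => n0x n1y.
move: n0N; rewrite geq_max => /andP[Mn0 Nn0].
have far1 : e / 3 <= mdist x (orb F p n1).
  have := far y ly (fun h => xy (esym h)).
  have := metric_triangle x (orb F p n1) y; rewrite (metric_sym (orb F p n1) y); lra.
apply: contrapT => H.
have stay k : mdist x (orb F p (k + n0)%N) < e / 3.
  elim: k => // k IH; rewrite addSn orbS ltNge; apply/negP => ge; apply: H.
  by exists (k + n0)%N; split=> //; exact: leq_trans Nn0 (leq_addl _ _).
have := stay (n1 - n0)%N; rewrite subnK // ; lra.
Qed.

Lemma iterM_fix (f : G -> G) k j z : iter k f z = z -> iter (k * j) f z = z.
Proof. by move=> kz; elim: j => [|j IH]; rewrite ?muln0 // mulnS iterD IH. Qed.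

Lemma orb_iter f p k m : orb (iter k f) p m = orb f p (m * k).
Proof. by elim: m => // m IH; rewrite mulSn orbD -IH. Qed.

Lemma lims_iter_sub f p k : (0 < k)%N -> lims (orb (iter k f) p) `<=` lims (orb f p).
Proof.
move=> k0 x lx U /lx Uio N; have [m [Nm Um]] := Uio N.
by exists (m * k)%N; rewrite -orb_iter; split=> //; apply: leq_trans Nm _; exact: leq_pmulr.
Qed.

Lemma pair_orb_iter f p q k m : pair_orb (iter k f) p q m = pair_orb f p q (m * k).
Proof. by rewrite /pair_orb !orb_iter. Qed.

Lemma pair_lims_residue f p q k u v : compact [set: G] -> continuous f -> (0 < k)%N ->
  lims (pair_orb f p q) (u, v) ->
  exists r x y, [/\ (r < k)%N, lims (pair_orb (iter k f) p q) (x, y), iter r f x = u & iter r f y = v].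
Proof.
move=> cG cf k0 luv.
have cGG : compact [set: G * G] by rewrite -setXTT; exact: compact_setX.
pose F (z : G * G) := (f z.1, f z.2).
have cF : continuous F.
  move=> z; apply: cvg_pair => /=.
    by apply: (cvg_comp fst f); [exact: cvg_fst|exact: cf].
  by apply: (cvg_comp snd f); [exact: cvg_snd|exact: cf].
have [|r [[x y] [rk lxy e]]] := lims_residue (F := F) cGG (@pair_hausdorff R G) cF _ k0 luv.
  by [].
have iF : iter r F (x, y) = (iter r f x, iter r f y) by elim: (r) => //= j ->.
move: e; rewrite iF => -[e1 e2]; exists r, x, y; split=> //.
by move=> U /lxy; apply: io_sub => m; rewrite pair_orb_iter.
Qed.

Lemma finite_lims_fixed f p q : compact [set: G] -> continuous f ->
  (forall r e, lims (orb f r) e -> exists2 e', lims (orb f r) e' & f e' = e) ->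
  finite_set (lims (orb f p)) -> finite_set (lims (orb f q)) ->
  exists2 k, (0 < k)%N & forall z, lims (orb f p) z \/ lims (orb f q) z -> iter k f z = z.
Proof.
move=> cG cf surj fp fq.
have /finite_seqP[s sE] : finite_set (lims (orb f p) `|` lims (orb f q)) by rewrite finite_setU.
have [||k k0 kP] := @common_multiple G s (fun z k => iter k f z = z).
- by move=> t k m; exact: iterM_fix.
- move=> t ts; have : (lims (orb f p) `|` lims (orb f q)) t by rewrite sE.
  case=> lt; [exact: (finite_surj_periodic fp (surj p) lt)|exact: (finite_surj_periodic fq (surj q) lt)].
exists k => // z lz; apply: kP.
by have : (lims (orb f p) `|` lims (orb f q)) z by []; rewrite sE.
Qed.

(** For a common period [k] of all limit points, each orbit has a single limit point under [f^k],
    say [x] and [y]. The diagonal limit pair gives [f^s x = f^s y] with [s < k], and [f^(k - s)]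
    turns this into [x = y]; then every limit pair is diagonal. *)
Lemma finite_lims_not_scrambled f p q : compact [set: G] -> continuous f ->
  (forall r e, lims (orb f r) e -> exists2 e', lims (orb f r) e' & f e' = e) ->
  finite_set (lims (orb f p)) -> finite_set (lims (orb f q)) ->
  (exists w, lims (pair_orb f p q) (w, w)) ->
  (exists u v, lims (pair_orb f p q) (u, v) /\ u <> v) -> False.
Proof.
move=> cG cf surj fp fq [w lw] [u [v [luv uv]]].
have [k k0 kP] := finite_lims_fixed cG cf surj fp fq.
have sub r := @lims_iter_sub f r k k0.
have ck : continuous (iter k f) by exact: iter_continuous.
have up := lims_fixed_unique cG ck (sub_finite_set (sub p) fp) (fun z lz => kP z (or_introl (sub p z lz))).
have uq := lims_fixed_unique cG ck (sub_finite_set (sub q) fq) (fun z lz => kP z (or_intror (sub q z lz))).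
have [r [x [y [rk lxy xu yv]]]] := pair_lims_residue cG cf k0 luv.
have [s [x' [y' [sk lxy' x'w y'w]]]] := pair_lims_residue cG cf k0 lw.
have lx := pair_lims_fst lxy; have ly := pair_lims_snd lxy.
rewrite -(up _ _ lx (pair_lims_fst lxy')) in x'w; rewrite -(uq _ _ ly (pair_lims_snd lxy')) in y'w.
apply: uv; rewrite -xu -yv; congr iter.
rewrite -(kP x (or_introl (sub p x lx))) -(kP y (or_intror (sub q y ly))).
by rewrite -(subnK (ltnW sk)) !iterD x'w y'w.
Qed.

End Scrambled.

(** * From chaos to NS-pairs *)

Lemma infinite_seq {T : eqType} (A : set T) : infinite_set A ->
  exists x : nat -> T, (forall n, A (x n)) /\ forall m n, (m < n)%N -> x m <> x n.
Proof.
move=> iA.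
have /choice[c cP] : forall s : seq T, exists x, A x /\ x \notin s.
  move=> s; apply: contrapT => H; apply: iA.
  apply: (@sub_finite_set _ _ [set` s]); last exact: finite_seq.
  move=> x Ax /=.
  by apply: contrapT => /negP xs; apply: H; exists x.
pose s n := iter n (fun t => c t :: t) [::].
exists (c \o s); split=> [n|m n mn /= e]; first exact: (cP _).1.
have /negP := (cP (s n)).2; apply; rewrite -e.
elim: n mn {e} => // n IH; rewrite ltnS leq_eqVlt => /predU1P[->|/IH H].
  by rewrite /s /= in_cons eqxx.
by rewrite /s /= in_cons H orbT.
Qed.

Section Forward.
Context {R : realType} {G : metricType R}.

(** If every point of [S] were isolated in [S], then [S] would be the countable union of the [A k],
    whose points are uniformly separated and hence finitely many by compactness. *)
Lemma uncountable_accumulation (S : set G) : compact [set: G] -> ~ countable S ->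
  exists p, S p /\ forall U, nbhs p U -> exists q, [/\ S q, U q & q <> p].
Proof.
move=> cG ucS; apply: contrapT => H; apply: ucS.
pose A (k : nat) := [set p | S p /\ forall q, S q -> mdist p q < k.+1%:R^-1 -> q = p].
have -> : S = \bigcup_k A k.
  apply/seteqP; split=> [p Sp|p [k _ []]//].
  have [U [Up UP]] : exists U, nbhs p U /\ forall q, S q -> U q -> q = p.
    apply: contrapT => nU; apply: H; exists p; split=> // U Up.
    apply: contrapT => nq; apply: nU; exists U; split=> // q Sq Uq.
    by apply: contrapT => qp; apply: nq; exists q.
  have [e /= e0 eU] := (nbhs_ballP _ _).1 Up.
  have [k _ /(_ k (leqnn k)) ke] := near_infty_natSinv_lt (PosNum e0).
  exists k => //; split=> // q Sq pq; apply: UP => //; apply: eU; rewrite ballEmdist /=.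
  exact: lt_trans pq ke.
apply: bigcup_countable => // k _; apply: finite_set_countable.
apply: contrapT => /infinite_seq[x [xA xI]].
have [y xy] := lims_exists x cG.
have k0 : 0 < k.+1%:R^-1 / 2 :> R by rewrite divr_gt0 // invr_gt0.
have [n1 [_]] := xy _ (nbhsx_ballx y _ k0) 0%N.
have [n2 [n12]] := xy _ (nbhsx_ballx y _ k0) n1.+1.
rewrite !ballEmdist /= => n2y n1y; apply: (xI _ _ n12); apply/esym.
apply: (xA n1).2; first exact: (xA n2).1.
have half (e : R) : mdist y (x n2) < e / 2 -> mdist y (x n1) < e / 2 -> mdist (x n1) (x n2) < e.
  by have := metric_triangle (x n1) y (x n2); rewrite (metric_sym (x n1) y); lra.
exact: half n2y n1y.
Qed.

Context n (h : 'I_n -> R -> G) (g : 'I_n -> G -> R).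
Hypothesis E : edges [set: G] h g.
Context (f : G -> G).
Hypotheses (cf : continuous f) (nH : ~ horseshoe f).
Local Notation cG := (graph_compact E).

Section Dichotomy.
Context (p : G).
Hypothesis iE : infinite_set (lims (orb f p)).
Hypothesis partner : forall U, nbhs p U -> exists q, [/\ U q, proximal f p q & separated_io f p q].

(** The last clause makes [k] the greatest common period, hence unique for [U]; [b] is only a
    threshold. *)
Definition regular_period (U : set G) k b := [/\ (0 < k)%N, common_period (fun m => iter m f @` U) k,
  forall m, (b <= m)%N -> connected (tail_class f U k m) &
  forall c, common_period (fun m => iter m f @` U) c -> (c %| k)%N].

Lemma regular_period_exists U : nbhs p U -> connected U -> exists k b, regular_period U k b.
Proof.
move=> Up cU; have [q [Uq _ [d d0 dio]]] := partner Up.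
have pU : U p by exact: nbhs_singleton.
apply: gcd_components.
- by move=> m; exact: iter_connected.
- by move=> m; exists (iter m f p); exists p.
- by move=> m m' [_ [[x Ux <-] [y Uy yx]]]; exists (iter m.+1 f x); split; [exists x|exists y => //=; rewrite yx].
- apply: contrapT => H; apply: (@disjoint_connected_small R G cG (star_exists E)
    (fun m => iter m f @` U) (orb f p) (orb f q) d d0 _ _ _ dio).
  + by move=> m; exact: iter_connected.
  + by move=> m; split; [exists p|exists q].
  + move=> m m' mm'; rewrite -subset0 => x ?; apply: H; exists m, (m' - m)%N.
    by rewrite subn_gt0 mm' subnKC ?(ltnW mm') //; split=> //; exists x.
Qed.

Lemma regular_period_dvd U V k b l c : U `<=` V -> regular_period V k b -> regular_period U l c -> (k %| l)%N.
Proof.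
move=> UV [_ kV _ _] [_ _ _]; apply=> m m' [x [[y Uy yx] [z Uz zx]]]; apply: kV.
by exists x; split; [exists y => //; exact: UV|exists z => //; exact: UV].
Qed.

(** Under [f^k] a tail of a smaller neighbourhood is one class modulo [k], hence connected. An
    infinite limit set, proximality and separation all pass to [f^k], so
    [tail_connected_not_scrambled] applies. *)
Lemma stable_period_absurd U k b : nbhs p U -> connected U -> regular_period U k b ->
  (forall V l c, nbhs p V -> connected V -> V `<=` U -> regular_period V l c -> l = k) -> False.
Proof.
move=> Up cU [k0 _ _ _] stab.
have [q [_ pr [d d0 dio]]] := partner (@filterT _ (nbhs p) _).
have [w lw] := proximal_diag cG pr.
have [u [v [luv uv]]] := pair_limit E (ex_intro2 _ _ d d0 dio).
have cFk : continuous (iter k f) by exact: iter_continuous.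
apply: (@tail_connected_not_scrambled R G n h g E (iter k f) p q cFk).
- by move=> /horseshoe_iter; exact: nH.
- move=> fin; apply: iE.
  apply: (sub_finite_set (B := \bigcup_(r in `I_k) (iter r f @` lims (orb (iter k f) p)))).
    move=> y ly; have [|r [x [rk lx xy]]] := lims_residue (F := f) cG (@metric_hausdorff _ G) cf _ k0 ly.
      by [].
    exists r => //; exists x => //.
    by move=> V /lx; apply: io_sub => m; rewrite orb_iter.
  by apply: bigcup_finite => [|r _]; [exact: finite_II|exact: finite_image].
- exists U; split=> // V Vp cV VU.
  have [l [c Vl]] := regular_period_exists Vp cV.
  have lk := stab V l c Vp cV VU Vl; rewrite lk in Vl; have [_ _ conn _] := Vl.
  exists c => N' cN'.
  have -> : tail_orbit (iter k f) V N' = tail_class f V k (N' * k).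
    have it m : iter m (iter k f) = iter (m * k) f by apply/funext => x; exact: orb_iter.
    apply/seteqP; split=> x.
      move=> [m /= Nm xm]; exists (m - N')%N => //.
      by rewrite -mulnDl subnKC // -it.
    move=> [j _ xj]; exists (N' + j)%N; first exact: leq_addr.
    by rewrite it mulnDl.
  by apply: conn; apply: leq_trans cN' _; exact: leq_pmulr.
- have [r [x [y [rk lxy xw yw]]]] := pair_lims_residue cG cf k0 lw.
  have kx z : iter k f z = iter (k - r) f (iter r f z) by rewrite -iterD subnK // ltnW.
  apply: (lims_proximal (w := iter (k - r) f w)).
  have -> : (iter (k - r) f w, iter (k - r) f w) = (iter k f x, iter k f y) by rewrite !kx xw yw.
  have cF : {for (x, y), continuous (fun z : G * G => (iter k f z.1, iter k f z.2))}.
    apply: cvg_pair => /=.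
      by apply: (cvg_comp fst (iter k f)); [exact: cvg_fst|exact: cFk].
    by apply: (cvg_comp snd (iter k f)); [exact: cvg_snd|exact: cFk].
  move=> V /cF/lxy H N; have [m [Nm Vm]] := H N.
  by exists m.+1; split; [exact: leqW|].
- have [r [x [y [rk lxy xu yv]]]] := pair_lims_residue cG cf k0 luv.
  apply: (lims_separated lxy) => xy; apply: uv; by rewrite -xu -yv xy.
Qed.

Lemma scrambled_NS_pair : exists x y, NS_pair f x y.
Proof.
pose good (D : set G * nat * nat) := [/\ nbhs p D.1.1, connected D.1.1 & regular_period D.1.1 D.1.2 D.2].
have step D : good D -> exists D', good D' /\ [/\ D'.1.1 `<=` D.1.1, (D.1.2 %| D'.1.2)%N & (D.1.2 < D'.1.2)%N].
  case: D => [[U k] b] [/= Up cU Uk]; apply: contrapT => H.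
  apply: (stable_period_absurd Up cU Uk) => V l c Vp cV VU Vl; apply: contrapT => lk; apply: H.
  have kl := regular_period_dvd VU Uk Vl.
  exists (V, l, c); split=> //; split=> //=; rewrite ltn_neqAle eq_sym; apply/andP; split; first exact/eqP.
  by apply: dvdn_leq => //; have [] := Vl.
have [U0 [Up0 cU0 _]] := locally_connected E (@filterT _ (nbhs p) _).
have [k0 [b0 Uk0]] := regular_period_exists Up0 cU0.
have /choice[nx nxP] : forall D, exists D', good D -> good D' /\ [/\ D'.1.1 `<=` D.1.1, (D.1.2 %| D'.1.2)%N & (D.1.2 < D'.1.2)%N].
  by move=> D; have [/step[D' ?]|?] := pselect (good D); [exists D'|exists D].
pose D i := iter i nx (U0, k0, b0).
have gD i : good (D i) by elim: i => // i IH; exact: (nxP _ IH).1.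
have DS i := (nxP _ (gD i)).2.
have [q [_ pr se]] := partner (@filterT _ (nbhs p) _).
apply: (unbounded_periods_NS_pair E cf iE (U := fun i => (D i).1.1) (k := fun i => (D i).1.2) (b := fun i => (D i).2) _ _ _ _ _ _ _ pr se).
- by move=> i; have [/nbhs_singleton] := gD i.
- by move=> i; have [_ _ []] := gD i.
- by move=> i; have [_ _ []] := gD i.
- by move=> i m; have [_ _ [_ _ H _]] := gD i; exact: H.
- by move=> i; have [] := DS i.
- by move=> i; have [] := DS i.
- by elim=> // i IH; have [_ _ lt] := DS i; exact: leq_ltn_trans IH lt.
Qed.

End Dichotomy.

(** At most one point of the scrambled set has a finite limit set, by [finite_lims_not_scrambled].
    The remaining points are still uncountably many, so one of them is accumulated by its scrambled
    partners. *)
Lemma Li_Yorke_NS_pair : Li_Yorke_chaotic f -> exists x y, NS_pair f x y.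
Proof.
move=> [S [ucS Sscr]].
have scr x y : S x -> S y -> x <> y -> proximal f x y /\ separated_io f x y.
  by move=> Sx Sy xy; apply/scrambledP; exact: Sscr.
pose A := [set x | S x /\ finite_set (lims (orb f x))].
have cA : countable A.
  have [[a [Sa fa]]|/nonemptyPn ->] := pselect (A !=set0); last exact: countable0.
  apply: (@sub_countable _ _ _ [set a]); last exact: countable1.
  apply: subset_card_le => b [Sb fb]; apply: contrapT => ba.
  have [pr se] := scr b a Sb Sa ba.
  apply: (finite_lims_not_scrambled cG cf _ fb fa (proximal_diag cG pr)).
    by move=> r e; exact: (omega_surj E cf).
  exact: (pair_limit E se).
have ucS' : ~ countable (S `\` A).
  move=> c; apply: ucS; apply: (@sub_countable _ _ _ (\bigcup_(b in [set: bool]) (if b then A else S `\` A))); last first.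
    by apply: bigcup_countable => // -[].
  by apply: subset_card_le => x Sx; have [Ax|nA] := pselect (A x); [exists true|exists false].
have [p [[Sp nA] acc]] := uncountable_accumulation cG ucS'.
apply: (@scrambled_NS_pair p) => [fin|U /acc[q [[Sq _] Uq qp]]]; first by apply: nA.
exists q; have [pr se] := scr p q Sp Sq (fun e => qp (esym e)).
by split.
Qed.

End Forward.

(** * From NS-pairs to chaos *)

(** What is kept of the tower of periodic subgraphs when the graph structure is dropped; this form
    is inherited by backward images, without showing these to be graphs. *)
Definition solenoid {R : realType} {G : metricType R} (f : G -> G) (J : nat -> set G) (m : nat -> nat) :=
  [/\ forall n, closed (J n) /\ connected (J n),
      forall n, (0 < m n)%N /\ iter (m n) f @` J n = J n,
      forall n i j, (iter i f @` J n `&` iter j f @` J n) !=set0 -> i = j %[mod m n],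
      forall n, J n.+1 `<=` J n &
      forall N, exists n, forall n', (n <= n')%N -> (N <= m n')%N].

Section Solenoid.
Context {R : realType} {G : metricType R}.
Context n0 (h : 'I_n0 -> R -> G) (g : 'I_n0 -> G -> R).
Hypothesis E : edges [set: G] h g.
Context (f : G -> G).
Hypothesis cf : continuous f.
Local Notation cG := (graph_compact E).

Lemma NS_pair_solenoid x y : NS_pair f x y -> exists J m, [/\ solenoid f J m, x <> y,
  forall n, J n x /\ J n y, exists z, lims (orb f z) x & exists z, lims (orb f z) y].
Proof.
move=> [xy [z _ xz] [z' _ yz'] [J [m [pJ dJ mJ JJ]]]]; rewrite !omega_limitE in xz yz'.
exists J, m; split=> //; [|by exists z|by exists z'].
have iJ n k : iter (k * m n) f @` J n = J n.
  have [_ m0 _ mn] := pJ n; elim: k => [|k IH]; first by rewrite image_id.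
  by rewrite mulSn image_iterD IH.
have modJ n r : iter r f @` J n = iter (r %% m n) f @` J n.
  by rewrite {1}(divn_eq r (m n)) addnC image_iterD iJ.
split=> //.
- move=> n; have [[[_ kJ cJ] _] _ _ _] := pJ n.
  by split=> //; apply: compact_closed => //; exact: metric_hausdorff.
- by move=> n; have [_ ? _ ?] := pJ n.
- move=> n i j; have [_ m0 tr _] := pJ n; rewrite (modJ n i) (modJ n j) => ij.
  by apply: tr => //=; exact: ltn_pmod.
- move=> N; have [M _ MP] := mJ _ (nbhs_infty_ge N); by exists M => n Mn; exact: MP.
Qed.

Section Facts.
Context (J : nat -> set G) (m : nat -> nat).
Hypothesis S : solenoid f J m.
Local Notation Q n r := (iter r f @` J n).

Lemma sol_mul n k : Q n (k * m n) = J n.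
Proof.
have [_ H _ _ _] := S; elim: k => [|k IH]; first by rewrite image_id.
by rewrite mulSn image_iterD IH (H n).2.
Qed.

Lemma sol_mod n r r' : r = r' %[mod m n] -> Q n r = Q n r'.
Proof.
have modJ l : Q n l = Q n (l %% m n) by rewrite {1}(divn_eq l (m n)) addnC image_iterD sol_mul.
by move=> e; rewrite modJ e -modJ.
Qed.

Lemma sol_sub n n' : (n <= n')%N -> J n' `<=` J n.
Proof. by have [_ _ _ H _] := S; move=> nn; exact: (nested_sub H nn). Qed.

Lemma sol_image_sub n n' r : (n <= n')%N -> Q n' r `<=` Q n r.
Proof. by move=> nn'; apply: image_subset; exact: sol_sub. Qed.

Lemma sol_period_dvd n n' : (n <= n')%N -> J n' !=set0 -> (m n %| m n')%N.
Proof.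
move=> nn' [x xJ]; have [_ H1 H _ _] := S.
have xQ : Q n' (m n') x by rewrite (H1 n').2.
have /H : (Q n (m n') `&` Q n 0) !=set0.
  by exists x; split; [exact: sol_image_sub nn' _ xQ|rewrite image_id; exact: sol_sub nn' _ xJ].
by rewrite mod0n => /eqP.
Qed.

Lemma sol_disjoint i j x : (\bigcap_n Q n i) x -> (\bigcap_n Q n j) x -> i = j.
Proof.
move=> xi xj; have [_ _ H _ H5] := S; have [n nP] := H5 (maxn i j).+1.
have := nP n (leqnn n); rewrite gtn_max => /andP[im jm].
have /H : (Q n i `&` Q n j) !=set0 by exists x; split; [exact: xi|exact: xj].
by rewrite !modn_small.
Qed.

(** The iterates of [x] are distinct, while the members of the cycle of [J n] have finitely many
    boundary points. So some iterate of [x] is interior to a member, and the orbit of [z] enters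
    there. *)
Lemma sol_enter x z n : (forall n, J n x) -> lims (orb f z) x ->
  exists T c, forall t, Q n (t + c) (orb f z (t + T)).
Proof.
move=> Jx lz; have [H1 H2 H3 H4 H5] := S.
have xQ a n' : Q n' a (iter a f x) by exists x.
have [a [r ar]] : exists a r, (Q n r)^° (iter a f x).
  apply: contrapT => H.
  have fin : finite_set (\bigcup_(r in `I_(m n)) (closure (Q n r) `\` interior (Q n r))).
    apply: bigcup_finite; first exact: finite_II.
    by move=> r _; apply: (boundary_finite E); apply: iter_connected => //; exact: (H1 n).2.
  have [|i [j [ij eij]]] := @finite_pigeonhole _ _ (fun a => iter a f x) fin.
    move=> a; exists (a %% m n)%N; first exact: ltn_pmod (H2 n).1.
    split; last by move=> H'; apply: H; exists a, (a %% m n)%N.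
    apply: subset_closure; rewrite -(@sol_mod n a) ?modn_mod //; exact: xQ.
  have e : i = j by apply: (@sol_disjoint i j (iter i f x)) => n' _; [|rewrite eij]; exact: xQ.
  by rewrite e ltnn in ij.
have la : lims (orb f z) (iter a f x) by elim: {ar} a => //= a; exact: lims_image.
have [T [_ TQ]] := la _ ar 0%N; exists T, r => t.
by rewrite image_iterD orbD; exists (orb f z T).
Qed.

Lemma sol_closed n r : closed (Q n r).
Proof.
have [H1 _ _ _ _] := S; apply: compact_closed; first exact: metric_hausdorff.
by apply: iter_compact => //; exact: (subclosed_compact (H1 n).1 cG).
Qed.

Lemma sol_omega x z n y : (forall n, J n x) -> lims (orb f z) x -> lims (orb f z) y -> exists r, Q n r y.
Proof.
move=> Jx lx ly; have [T [c TP]] := sol_enter n Jx lx; have [_ H2 _ _ _] := S.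
have cl : closed (\bigcup_(r in `I_(m n)) Q n r).
  by apply: closed_bigcup => [|r _]; [exact: finite_II|exact: sol_closed].
have [|r _ yr] := lims_in cl _ ly; last by exists r.
exists T => t Tt; exists ((t - T + c) %% m n)%N; first exact: ltn_pmod (H2 n).1.
by have := TP (t - T)%N; rewrite subnK // (@sol_mod n _ ((t - T + c) %% m n)) // modn_mod.
Qed.

(* The [k]-th backward image of [J n] along its cycle. *)
Definition back k n := Q n (m n * k - k).

Lemma sol_dvd x n n' : (forall n, J n x) -> (n <= n')%N -> (m n %| m n')%N.
Proof. by move=> Jx nn'; apply: sol_period_dvd => //; exists x. Qed.

(** The exponent [m n * k - k] is a natural number congruent to [-k] modulo [m n]. *)
Lemma back_mod k n : (m n * k - k + k = 0 %[mod m n])%N.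
Proof.
have [_ H2 _ _ _] := S.
by rewrite subnK ?mod0n ?modnMr // leq_pmull // (H2 n).1.
Qed.

Lemma back_solenoid x k : (forall n, J n x) -> solenoid f (back k) m.
Proof.
move=> Jx; have [H1 H2 H3 H4 H5] := S; split=> //.
- by move=> n; split; [exact: sol_closed|apply: iter_connected => //; exact: (H1 n).2].
- move=> n; split; first exact: (H2 n).1.
  by rewrite /back -image_iterDC image_iterD (H2 n).2.
- move=> n i j; rewrite /back -!image_iterD => /H3/eqP.
  by rewrite eqn_modDr => /eqP.
- move=> n; rewrite /back.
  have -> : Q n (m n * k - k) = Q n (m n.+1 * k - k).
    apply: sol_mod; apply/eqP; rewrite -(eqn_modDr k) back_mod mod0n subnK; last first.
      by rewrite leq_pmull // (H2 _).1.
    by rewrite eq_sym -/(dvdn _ _) dvdn_mulr // (sol_dvd Jx).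
  exact: sol_image_sub.
Qed.

(** A [k]-th preimage of [x] in the limit set lies in some member of the cycle of [J n]; as [f^k]
    brings it to [J n], this member is [back k n]. *)
Lemma back_point x z k : (forall n, J n x) -> lims (orb f z) x ->
  exists x', [/\ lims (orb f z) x', iter k f x' = x & forall n, back k n x'].
Proof.
move=> Jx lz; have [_ H2 H3 _ _] := S.
have [x' lx' kx'] : exists2 x', lims (orb f z) x' & iter k f x' = x.
  elim: k => [|k [y ly yx]]; first by exists x.
  have [y' ly' yy'] := lims_back cG (@metric_hausdorff _ G) cf (fun n => erefl) ly.
  by exists y' => //; rewrite iterSr yy'.
exists x'; split=> // n; have [r rx'] := sol_omega n Jx lz lx'.
have /H3 e : (Q n (k + r) `&` Q n 0) !=set0.
  by exists x; split; [rewrite image_iterD -kx'; exists x'|rewrite image_id].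
rewrite /back (@sol_mod n _ r) //; apply/eqP.
by rewrite -(eqn_modDr k) back_mod [(r + k)%N]addnC e.
Qed.

(** For different [k] the intersections of the backward images are disjoint, so a finite set cannot
    meet them all. *)
Lemma back_avoid (V : set G) : finite_set V -> exists k, forall v, V v -> ~ (\bigcap_n back k n) v.
Proof.
move=> fV; apply: contrapT => H; have [_ H2 H3 _ H5] := S.
have /choice[v vP] : forall k, exists v, V v /\ (\bigcap_n back k n) v.
  move=> k; apply: contrapT => nv; apply: H; exists k => v Vv vk.
  by apply: nv; exists v.
have [k [k' [kk' e]]] := finite_pigeonhole fV (fun k => (vP k).1).
have [n nP] := H5 k'.+1; have k'm := nP n (leqnn n).
have /H3/eqP : (back k n `&` back k' n) !=set0.
  by exists (v k); split; [exact: (vP k).2|rewrite e; exact: (vP k').2].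
have e1 l l' : (m n * l - l + (l + l') = l' %[mod m n])%N.
  by rewrite addnA -modnDml back_mod modnDml add0n.
rewrite -(eqn_modDr (k + k')) e1 [(k + k')%N]addnC e1 !modn_small //; last exact: ltn_trans kk' _.
by move=> /eqP e'; rewrite e' ltnn in kk'.
Qed.

End Facts.
End Solenoid.

(** * Returns to the two sides of the segment [K] *)

Section Key.
Context {R : realType} {G : metricType R}.
Context n0 (h : 'I_n0 -> R -> G) (g : 'I_n0 -> G -> R).
Hypothesis E : edges [set: G] h g.
Context (f : G -> G).
Hypothesis cf : continuous f.
Local Notation arc i a b := (h i @` `]a, b[%classic).
Local Notation cG := (graph_compact E).
Context (J : nat -> set G) (m : nat -> nat) (i : 'I_n0) (a b : R) (z : G).
Hypothesis S : solenoid f J m.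
Hypothesis ab : 0 < a /\ a < b < 1.
Hypothesis Jarc : forall n, J n `<=` arc i 0 1.
Hypothesis KE : \bigcap_n J n = h i @` `[a, b].
Hypothesis lz : lims (orb f z) (h i b).
Local Notation Q n r := (iter r f @` J n).

Definition left_part N := [set x | J N x /\ exists r : R, 0 < r <= a /\ x = h i r].
Definition right_part N := [set x | J N x /\ exists r : R, b <= r < 1 /\ x = h i r].
(** The time [s] is common to both parts, since points with different itineraries have to be
    compared at the same times; [N < n] lets the construction descend. *)
Definition covering N := exists s n, [/\ (N < n)%N, J n `<=` iter s f @` left_part N &
  J n `<=` iter s f @` right_part N].
Definition lft j := exists r : R, 0 < r < a /\ iter j f (h i a) = h i r.
Definition rgt j := exists r : R, b < r < 1 /\ iter j f (h i a) = h i r.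
Definition lefts (Y : set G) := forall r : R, 0 < r < 1 -> Y (h i r) -> r < a.
Definition rights (Y : set G) := forall r : R, 0 < r < 1 -> Y (h i r) -> b < r.

Let inK (r : R) n : a <= r <= b -> J n (h i r).
Proof.
move=> rab; have : (\bigcap_n J n) (h i r) by rewrite KE; exists r => //=; rewrite in_itv.
exact.
Qed.

Let Ja n : J n (h i a). Proof. by have [a0 ab1] := ab; apply: inK; lra. Qed.
Let Jb n : J n (h i b). Proof. by have [a0 ab1] := ab; apply: inK; lra. Qed.

Let par n x : J n x -> exists2 r : R, 0 < r < 1 & x = h i r.
Proof. by move=> /Jarc[r /= + <-]; rewrite in_itv /=; exists r. Qed.

Let conv n (s t r : R) (Y : set G) : connected Y -> Y `<=` J n -> 0 <= s -> t <= 1 ->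
  s <= r <= t -> Y (h i s) -> Y (h i t) -> Y (h i r).
Proof.
move=> cY YJ s0 t1 rst Ys Yt; apply: (arc_interval E cY _ s0 t1 rst Ys Yt).
by apply: (subset_trans YJ); apply: (subset_trans (Jarc (n := n))); apply: arc_sub01.
Qed.

Let dvd n n' : (n <= n')%N -> (m n %| m n')%N.
Proof. exact: (sol_dvd S Ja). Qed.

Let Qconn n r : connected (Q n r).
Proof. by have [H1 _ _ _ _] := S; apply: iter_connected => //; exact: (H1 n).2. Qed.

Let Qxa n j : Q n j (iter j f (h i a)). Proof. by exists (h i a). Qed.
Let Qxb n j : Q n j (iter j f (h i b)). Proof. by exists (h i b). Qed.

Let Qdvd n N j : (N <= n)%N -> (m N %| j)%N -> Q n j `<=` J N.
Proof.
move=> Nn Nj; apply: (subset_trans (sol_image_sub S (r := j) Nn)).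
by rewrite (sol_mod S (r' := 0%N)) ?image_id // mod0n; apply/eqP.
Qed.

Let Qndvd n j x : ~~ (m n %| j)%N -> J n x -> ~ Q n j x.
Proof.
move=> nj Jx Qx; have [_ _ H _ _] := S; case/negP: nj.
have /H : (Q n j `&` Q n 0) !=set0 by exists x; split=> //; rewrite image_id.
by rewrite mod0n => /eqP.
Qed.

Let deep j : (0 < j)%N -> exists n, forall n', (n <= n')%N -> ~~ (m n' %| j)%N.
Proof.
move=> j0; have [_ _ _ _ H] := S; have [n nP] := H j.+1; exists n => n' nn'.
by apply/negP => /dvdn_leq => /(_ j0); rewrite leqNgt nP.
Qed.

Lemma lft_or_rgt N j : (0 < j)%N -> (m N %| j)%N -> lft j \/ rgt j.
Proof.
have [a0 ab1] := ab.
move=> j0 Nj; have [r r01 e] := par (Qdvd (leqnn N) Nj (Qxa N j)).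
have nK : ~ a <= r <= b.
  move=> rab; have /= e0 : j = 0%N.
    apply: (sol_disjoint S (x := iter j f (h i a))) => n _; first exact: Qxa.
    by rewrite image_id e; exact: inK.
  by rewrite e0 in j0.
have [ra|ar] := ltP r a; first by left; exists r; split=> //; lra.
by right; exists r; split=> //; lra.
Qed.

(** When [m n] does not divide [j], the connected set [f^j(J n)] is disjoint from [J n] and so
    cannot cross the point [h i a] of [J n]. *)
Lemma lefts_image n N j : (N <= n)%N -> (m N %| j)%N -> ~~ (m n %| j)%N -> lft j -> lefts (Q n j).
Proof.
have [a0 ab1] := ab.
move=> Nn Nj nj [r [ra e]] s s01 Qs; rewrite ltNge; apply/negP => as_.
apply: (Qndvd nj (Ja n)); apply: (conv (@Qconn n j) (Qdvd Nn Nj) (s := r) (t := s)) => //; [lra|lra|lra|].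
by rewrite -e.
Qed.

Lemma rights_image n N j : (N <= n)%N -> (m N %| j)%N -> ~~ (m n %| j)%N -> rgt j -> rights (Q n j).
Proof.
have [a0 ab1] := ab.
move=> Nn Nj nj [r [ra e]] s s01 Qs; rewrite ltNge; apply/negP => sb.
apply: (Qndvd nj (Jb n)); apply: (conv (@Qconn n j) (Qdvd Nn Nj) (s := s) (t := r)) => //; [lra|lra|lra|].
by rewrite -e.
Qed.

Lemma lft_right_end N j : (0 < j)%N -> (m N %| j)%N -> lft j ->
  exists r : R, 0 < r < a /\ iter j f (h i b) = h i r.
Proof.
move=> j0 Nj lj; have [n nP] := deep j0; pose n' := maxn n N.
have [nn' Nn'] : (n <= n')%N /\ (N <= n')%N by rewrite leq_maxl leq_maxr.
have [r r01 e] := par (Qdvd Nn' Nj (Qxb n' j)); exists r; split=> //.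
have := Qxb n' j; rewrite e => /(lefts_image Nn' Nj (nP _ nn') lj r01).
by case/andP: r01 => -> _ ->.
Qed.

Lemma rgt_right_end N j : (0 < j)%N -> (m N %| j)%N -> rgt j ->
  exists r : R, b < r < 1 /\ iter j f (h i b) = h i r.
Proof.
move=> j0 Nj lj; have [n nP] := deep j0; pose n' := maxn n N.
have [nn' Nn'] : (n <= n')%N /\ (N <= n')%N by rewrite leq_maxl leq_maxr.
have [r r01 e] := par (Qdvd Nn' Nj (Qxb n' j)); exists r; split=> //.
have := Qxb n' j; rewrite e => /(rights_image Nn' Nj (nP _ nn') lj r01).
by case/andP: r01 => _ -> ->.
Qed.

(** A connected set in the edge with points on both sides of [[a, b]] contains an open arc around
    this segment, hence all deep [J n]. *)
Lemma cover N Y (r s : R) : connected Y -> Y `<=` J N -> 0 < r < a -> b < s < 1 ->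
  Y (h i r) -> Y (h i s) -> exists n, forall n', (n <= n')%N -> J n' `<=` Y.
Proof.
have [a0 ab1] := ab.
move=> cY YJ ra sb Yr Ys; have [H1 _ _ H4 _] := S.
have [r0 s1] : 0 <= r /\ s <= 1 by lra.
have [|n nP] := nested_open cG (fun n => (H1 n).1) H4 (edge_open E i r0 s1).
  rewrite KE => _ [t /= + <-]; rewrite in_itv /= => tab.
  by exists t => //=; rewrite in_itv /=; lra.
exists n => n' nn' x /(sol_sub S nn')/nP[t /= + <-]; rewrite in_itv /= => trs.
by apply: (conv cY YJ (s := r) (t := s)) => //; lra.
Qed.

Lemma left_segment N (r : R) : 0 < r <= a -> J N (h i r) -> h i @` `[r, a] `<=` left_part N.
Proof.
have [a0 ab1] := ab; have [H1 _ _ _ _] := S.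
move=> ra Jr _ [t /= + <-]; rewrite in_itv /= => tr; split; last by exists t; split=> //; lra.
apply: (conv (n := N) (H1 N).2 _ _ _ tr) => //; lra.
Qed.

Lemma right_segment N (r : R) : b <= r < 1 -> J N (h i r) -> h i @` `[b, r] `<=` right_part N.
Proof.
have [a0 ab1] := ab; have [H1 _ _ _ _] := S.
move=> ra Jr _ [t /= + <-]; rewrite in_itv /= => tr; split; last by exists t; split=> //; lra.
apply: (conv (n := N) (H1 N).2 _ _ _ tr) => //; lra.
Qed.

Lemma segment_connected (s t : R) : 0 <= s -> t <= 1 -> connected (h i @` `[s, t]).
Proof.
move=> s0 t1; apply: (homeo_connected (edge_homeo E i)); last exact: interval_is_interval.
by move=> r /=; rewrite !in_itv /=; lra.
Qed.

Lemma covering_mono N N' : (N <= N')%N -> covering N' -> covering N.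
Proof.
move=> NN' [s [n [Nn JL JR]]]; exists s, n; split; first exact: leq_ltn_trans NN' Nn.
  by apply: (subset_trans JL); apply: image_subset => x [/(sol_sub S NN')].
by apply: (subset_trans JR); apply: image_subset => x [/(sol_sub S NN')].
Qed.

(** Near [h i b] the late orbit is in [J N], because the other members of the cycle form a closed
    set [D] missing [h i b]; and it is to the right of [b], because it meets [[a, b]] at most
    once. *)
Lemma right_io N : io (fun t => exists r : R, [/\ b < r < 1, orb f z t = h i r & J N (h i r)]).
Proof.
have [a0 ab1] := ab; have [H1 H2 H3 _ _] := S.
have [T [c TP]] := sol_enter E cf S N Jb lz.
pose D := \bigcup_(r in [set r | (0 < r < m N)%N]) Q N r.
have clD : closed D.
  apply: closed_bigcup; last by move=> r _; exact: (sol_closed E cf S).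
  by apply: (@sub_finite_set _ _ `I_(m N)); [move=> r /= /andP[]|exact: finite_II].
have nD : ~ D (h i b).
  move=> [r /= /andP[r0 rm]]; apply: Qndvd (Jb N).
  by apply/negP => /dvdn_leq => /(_ r0); rewrite leqNgt rm.
have [t0 t0P] : exists t0, forall t, (t0 <= t)%N -> ~ forall n, J n (orb f z t).
  have [[t0 t0K]|H] := pselect (exists t0, forall n, J n (orb f z t0)); last first.
    by exists 0%N => t _ Ht; apply: H; exists t.
  exists t0.+1 => t tt0 tK.
  have : (t - t0 = 0)%N.
    apply: (sol_disjoint S (x := orb f z t)) => n _; last by rewrite image_id.
    by exists (orb f z t0) => //; rewrite -orbD subnK // ltnW.
  by move/eqP; rewrite subn_eq0 leqNgt tt0.
have nb : nbhs (h i b) (arc i a 1 `&` ~` D).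
  apply: filterI; last by apply: open_nbhs_nbhs; split=> //; exact: closed_openC.
  apply: open_nbhs_nbhs; split; first by apply: (edge_open E); lra.
  by exists b => //=; rewrite in_itv /=; lra.
move=> M; have [t [tM [[r /= + re] Dt]]] := lz nb (maxn M (maxn t0 T)).
move: tM; rewrite !geq_max in_itv /= => /andP[Mt /andP[t0t Tt]] ra.
have JNt : J N (orb f z t).
  have := TP (t - T)%N; rewrite subnK // (sol_mod S (r' := ((t - T + c) %% m N)%N)) ?modn_mod //.
  have [e|e] := posnP ((t - T + c) %% m N)%N; first by rewrite e image_id.
  move=> H; exfalso; apply: Dt; exists ((t - T + c) %% m N)%N => //=.
  by rewrite e ltn_pmod // (H2 N).1.
exists t; split=> //; exists r; split=> //; last by rewrite re.
have [rb|br] := leP r b; last by lra.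
by case: (t0P t t0t) => n; rewrite -re; apply: inK; lra.
Qed.

(** Let [r1] and [r2] be two visits of the orbit to the right, [s] steps apart. Then [f^s] keeps
    [h i r1] on the right but sends [h i b] to the left, so it stretches [[b, r1]] over deep levels.
    On the left, [J n1] is the [f^s]-image of [f^j(J n1)] for [j = m n1 - s], and this set lies on
    the left. *)
Lemma covering_left N0 : (forall j, (0 < j)%N -> (m N0 %| j)%N -> lft j) -> forall N, covering N.
Proof.
have [a0 ab1] := ab; have [H1 H2 H3 _ H5] := S.
move=> EL N; pose N' := maxn N N0.
have [NN' N0N'] : (N <= N')%N /\ (N0 <= N')%N by rewrite leq_maxl leq_maxr.
apply: (covering_mono NN').
have [t1 [_ [r1 [r1b e1 J1]]]] := right_io N' 0%N.
have [t2 [t12 [r2 [r2b e2 J2]]]] := right_io N' t1.+1.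
pose s := (t2 - t1)%N; have s0 : (0 < s)%N by rewrite subn_gt0.
have fs : iter s f (h i r1) = h i r2 by rewrite -e1 -e2 -orbD subnK // ltnW.
have N's : (m N' %| s)%N.
  have /H3 : (Q N' s `&` Q N' 0) !=set0.
    by exists (h i r2); split; [exists (h i r1)|rewrite image_id].
  by rewrite mod0n => /eqP.
have ls := EL s s0 (dvdn_trans (dvd N0N') N's).
have [r3 [r3a e3]] := lft_right_end s0 N's ls.
pose B := h i @` `[b, r1].
have BR : B `<=` right_part N' by apply: right_segment J1; lra.
have cB : connected (iter s f @` B).
  by apply: iter_connected => //; apply: segment_connected; lra.
have [|||n nP] := cover (N := N') cB _ r3a r2b.
- move=> _ [x /BR[Jx _] <-]; apply: (Qdvd (leqnn N') N's); by exists x.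
- by exists (h i b) => //; exists b => //=; rewrite in_itv /=; lra.
- by exists (h i r1) => //; exists r1 => //=; rewrite in_itv /=; lra.
have [M MP] := H5 s.+1.
pose n1 := maxn n (maxn N'.+1 M).
have [nn1 N'n1 Mn1] : [/\ n <= n1, N' < n1 & M <= n1]%N.
  by rewrite /n1 !leq_max !leqnn ?orbT.
have sm : (s < m n1)%N := MP n1 Mn1.
exists s, n1; split=> //; last by apply: (subset_trans (nP _ nn1)); exact: image_subset.
pose j := (m n1 - s)%N; have j0 : (0 < j)%N by rewrite subn_gt0.
have N'j : (m N' %| j)%N by rewrite dvdn_subr ?(ltnW sm) // dvd // ltnW.
have nj : ~~ (m n1 %| j)%N.
  by apply/negP => /dvdn_leq => /(_ j0); rewrite leqNgt /j ltn_subrL s0 (ltn_trans s0 sm).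
have lj := EL j j0 (dvdn_trans (dvd N0N') N'j).
have Ll := lefts_image (ltnW N'n1) N'j nj lj.
have -> : J n1 = iter s f @` Q n1 j.
  by rewrite -image_iterD addnC subnK ?(ltnW sm) // (H2 n1).2.
apply: image_subset => x Qx; have Jx := Qdvd (ltnW N'n1) N'j Qx; split=> //.
have [r r01 e] := par Jx; rewrite e in Qx; exists r; split=> //.
by have := Ll r r01 Qx; lra.
Qed.

(** A left return [j] and a deeper right return [k] are fixed. For a right return [s] divisible by
    [m M1], [f^s] leaves [f^j(h i a)] on the left and moves [h i a] to the right, so it stretches
    the left part over deep levels. It remains to find a multiple [s] of [k] that also works for the
    right part. *)
Lemma covering_both : (forall N, exists2 j, (0 < j)%N & (m N %| j)%N /\ lft j) ->
  (forall N, exists2 j, (0 < j)%N & (m N %| j)%N /\ rgt j) -> forall N, covering N.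
Proof.
have [a0 ab1] := ab; have [H1 H2 H3 _ H5] := S.
move=> L Rr N; have [j j0 [Nj lj]] := L N; have [M MP] := deep j0.
pose M1 := maxn N M; have [NM1 MM1] : (N <= M1)%N /\ (M <= M1)%N by rewrite leq_maxl leq_maxr.
have [k k0 [Mk rk]] := Rr M1; have Nk := dvdn_trans (dvd NM1) Mk.
have Ll := lefts_image NM1 Nj (MP _ MM1) lj.
have [rj [rja ej]] := lj.
pose A := h i @` `[rj, a].
have JN_rj : J N (h i rj) by rewrite -ej; exact: (Qdvd (leqnn N) Nj (Qxa N j)).
have AL : A `<=` left_part N by apply: left_segment JN_rj; lra.
have coverA s : (0 < s)%N -> (m M1 %| s)%N -> rgt s -> exists n, forall n', (n <= n')%N -> J n' `<=` iter s f @` A.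
  move=> s0 M1s [r [rb e]].
  have [r' r'01 e'] : exists2 r : R, 0 < r < 1 & iter s f (h i rj) = h i r.
    apply: (par (n := N)); apply: (Qdvd (leqnn N) (dvdn_trans (dvd NM1) M1s)).
    by exists (h i rj).
  have r'a : r' < a.
    apply: (Ll r' r'01); rewrite -e' -ej -iterD.
    have <- : Q M1 (s + j) = Q M1 j by apply: (sol_mod S); rewrite -modnDml (eqP M1s) add0n.
    exact: Qxa.
  apply: (cover (N := N) (r := r') (s := r)) => //; last 2 first.
  - by rewrite -e'; exists (h i rj) => //; exists rj => //=; rewrite in_itv /=; lra.
  - by rewrite -e; exists (h i a) => //; exists a => //=; rewrite in_itv /=; lra.
  - by apply: iter_connected => //; apply: segment_connected; lra.
  - move=> _ [x /AL[Jx _] <-]; apply: (Qdvd (leqnn N) (dvdn_trans (dvd NM1) M1s)); by exists x.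
  - lra.
have finish s : (0 < s)%N -> (m M1 %| s)%N -> rgt s ->
    (exists n, forall n', (n <= n')%N -> J n' `<=` iter s f @` right_part N) -> covering N.
  move=> s0 M1s rs [n2 n2P]; have [n1 n1P] := coverA s s0 M1s rs.
  pose n3 := maxn N.+1 (maxn n1 n2).
  have [? ? ?] : [/\ N < n3, n1 <= n3 & n2 <= n3]%N by rewrite /n3 !leq_max !leqnn ?orbT.
  exists s, n3; split=> //; last exact: n2P.
  by apply: (subset_trans (n1P n3 _)) => //; exact: image_subset.
have mulM l : (m M1 %| l * k)%N by exact: dvdn_mull.
have mul0 l : (0 < l)%N -> (0 < l * k)%N by move=> l0; rewrite muln_gt0 l0.
(* If all multiples of [k] return on the right, [s] is chosen so that [s + k] is a multiple of the
   period, and [f^s] carries the right-hand set [f^k(J n1)] onto [J n1]. Otherwise [s = l * k]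
   precedes a left return: [f^s] sends [f^k(h i a)] to the left and [h i b] to the right. *)
have [allr|/existsNP[l0 /not_implyP[l00 nl0]]] := pselect (forall l, (0 < l)%N -> rgt (l * k)).
  have [M2 M2P] := H5 k.+2.
  pose n1 := maxn M1 M2; have [M1n1 M2n1] : (M1 <= n1)%N /\ (M2 <= n1)%N by rewrite leq_maxl leq_maxr.
  have km : (k.+1 < m n1)%N := M2P n1 M2n1.
  have m1 : (0 < (m n1).-1)%N by rewrite -subn1 subn_gt0; exact: leq_ltn_trans km.
  apply: (finish ((m n1).-1 * k)%N) => //; [exact: mul0|exact: allr|].
  have nk : ~~ (m n1 %| k)%N.
    by apply/negP => /dvdn_leq => /(_ k0); rewrite leqNgt (ltn_trans (ltnSn k) km).
  have Rs := rights_image M1n1 Mk nk rk.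
  exists n1 => n' nn'; apply: (subset_trans (sol_sub S nn')).
  have -> : J n1 = iter ((m n1).-1 * k) f @` Q n1 k.
    rewrite -image_iterD addnC -mulSn prednK ?(ltn_trans _ km) // mulnC.
    by rewrite (sol_mul S).
  apply: image_subset => x Qx; have Jx := Qdvd (leq_trans NM1 M1n1) Nk Qx; split=> //.
  have [r r01 e] := par Jx; rewrite e in Qx; exists r; split=> //.
  by have := Rs r r01 Qx; lra.
have [l l1 [rl nrl]] : exists2 l, (0 < l)%N & rgt (l * k) /\ ~ rgt (l.+1 * k).
  apply: contrapT => H; apply: nl0; elim: l0 l00 => // -[_ _|l IH _]; first by rewrite mul1n.
  by apply: contrapT => nr; apply: H; exists l.+1 => //; split=> //; exact: IH.
have ll : lft (l.+1 * k) by case: (lft_or_rgt (mul0 l.+1 isT) (mulM l.+1)).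
apply: (finish (l * k)%N (mul0 l l1) (mulM l) rl).
have [r1 [r1b e1]] := rk.
have [r2 [r2a e2]] := ll.
have [r3 [r3b e3]] := rgt_right_end (mul0 l l1) (mulM l) rl.
have Jr1 : J N (h i r1) by rewrite -e1; exact: (Qdvd (leqnn N) Nk (Qxa N k)).
have BR : h i @` `[b, r1] `<=` right_part N by apply: right_segment Jr1; lra.
have [||||n nP] := cover (N := N) (Y := iter (l * k) f @` (h i @` `[b, r1])) _ _ r2a r3b.
- by apply: iter_connected => //; apply: segment_connected; lra.
- move=> _ [x /BR[Jx _] <-]; apply: (Qdvd (leqnn N) (dvdn_trans (dvd NM1) (mulM l))); by exists x.
- rewrite -e2 mulSn addnC iterD e1; exists (h i r1) => //; exists r1 => //=; rewrite in_itv /=; lra.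
- by rewrite -e3; exists (h i b) => //; exists b => //=; rewrite in_itv /=; lra.
by exists n => n' nn'; apply: (subset_trans (nP n' nn')); exact: image_subset.
Qed.

End Key.

(** * Scrambled sets from prescribed itineraries *)

Section Itineraries.
Context {R : realType} {G : metricType R}.
Hypothesis cG : compact [set: G].
Context (f : G -> G).
Hypothesis cf : continuous f.
Variables (C : nat -> bool -> set G) (s : nat -> nat).
Hypothesis clC : forall k c, closed (C k c).
Hypothesis C0 : forall k c, C k c !=set0.
Hypothesis CS : forall k c c', C k.+1 c' `<=` iter (s k) f @` C k c.

Definition time k := (\sum_(j < k) s j)%N.

(** Finite itineraries are realised by pulling back through the coverings; the nested closed sets
    [W k] of points that follow the first letters have a common point. *)
Lemma itinerary_exists (al : nat -> bool) : exists w, forall k, C k (al k) (iter (time k) f w).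
Proof.
pose W k := [set w | forall j, (j <= k)%N -> C j (al j) (iter (time j) f w)].
have hit k y : C k (al k) y -> exists2 w, W k w & iter (time k) f w = y.
  elim: k y => [|k IH] y Cy.
    exists y; last by rewrite /time big_ord0.
    by move=> j; rewrite leqn0 => /eqP ->; rewrite /time big_ord0.
  have [u Cu uy] := CS (al k) Cy; have [w Ww wu] := IH u Cu.
  have wy : iter (time k.+1) f w = y.
    by rewrite /time big_ord_recr /= addnC iterD -/(time k) wu.
  exists w => // j; rewrite leq_eqVlt => /predU1P[->|]; first by rewrite wy.
  by rewrite ltnS; exact: Ww.
have clW k : closed (W k).
  have -> : W k = \bigcap_(j in [set j | (j <= k)%N]) (iter (time j) f @^-1` C j (al j)) by [].
  apply: closed_bigI => j _; apply: closed_comp => // x _; exact: iter_continuous.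
have dW k : W k.+1 `<=` W k by move=> w Ww j jk; apply: Ww; exact: leqW.
have /choice[x xP] : forall k, exists x, W k x.
  by move=> k; have [y /hit[w Ww _]] := C0 k (al k); exists w.
have [w xw] := lims_exists x cG.
exists w => k; exact: (nested_lims clW dW xP xw).
Qed.

Hypothesis s0 : forall k, (0 < s k)%N.
Hypothesis apart : exists2 d : R, 0 < d & forall k x y, C k false x -> C k true y -> d <= mdist x y.
Hypothesis small : forall e : R, 0 < e -> exists N, forall k x y, (N <= k)%N ->
  C k false x -> C k false y -> mdist x y < e.

Lemma time_ge k : (k <= time k)%N.
Proof.
elim: k => // k IH; rewrite /time big_ord_recr /= -addn1.
by apply: leq_add => //; exact: s0.
Qed.

(* Even positions are all [false], which forces proximality; every bit of [be] is repeated
   infinitely often at odd positions, which forces separation. *)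
Definition spread (be : nat -> bool) k := odd k && be (logn 2 k./2).

Lemma spread_neq be be' : be <> be' -> io (fun k => spread be k <> spread be' k).
Proof.
move=> ne; have [j nj] : exists j, be j <> be' j.
  by apply: contrapT => H; apply: ne; apply/funext => j; apply: contrapT => nj; apply: H; exists j.
(* An odd index whose half is [2 ^ j] times an odd number carries the [j]-th bit; [N] makes it
   large. *)
move=> N; exists (2 ^ j * N.*2.+1).*2.+1; split.
  apply: leqW; rewrite -addnn; apply: leq_trans (leq_addl _ _).
  apply: (@leq_trans N.*2.+1); first by rewrite -addnn; apply: leqW; exact: leq_addl.
  by rewrite leq_pmull // expn_gt0.
rewrite /spread /= odd_double /= uphalf_double lognM ?expn_gt0 // pfactorK // logn_coprime ?addn0 //.
by rewrite coprime2n /= odd_double.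
Qed.

Lemma itineraries_chaotic : Li_Yorke_chaotic f.
Proof.
have /choice[w wP] : forall be, exists w, forall k, C k (spread be k) (iter (time k) f w).
  by move=> be; exact: itinerary_exists.
have scr be be' : be <> be' -> proximal f (w be) (w be') /\ separated_io f (w be) (w be').
  move=> ne; split.
    move=> e e0 M; have [N NP] := small e0; pose k := (M + N).*2.
    have [Mk Nk] : (M <= k)%N /\ (N <= k)%N.
      by rewrite /k -addnn; split; apply: leq_trans (leq_addr _ _); [exact: leq_addr|exact: leq_addl].
    exists (time k); split; first exact: leq_trans Mk (time_ge k).
    have := wP be k; have := wP be' k; rewrite /spread odd_double /= => w1 w2.
    exact: (NP k).
  have [d d0 dP] := apart; exists d => // M.
  have [k [Mk nk]] := spread_neq ne M; exists (time k).
  split; first exact: leq_trans Mk (time_ge k).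
  move: (wP be k) (wP be' k) nk; case: (spread be k); case: (spread be' k) => // w1 w2 _.
    by rewrite metric_sym; exact: dP w2 w1.
  exact: dP w1 w2.
exists (range w); split; last first.
  by move=> _ _ [be _ <-] [be' _ <-] ww; apply/scrambledP; apply: scr => e; apply: ww; rewrite e.
move=> /countable_injP[ph phI].
have inj be be' : ph (w be) = ph (w be') -> be = be'.
  move=> e; apply: contrapT => ne; have [_ [d d0 dio]] := scr _ _ ne.
  have ww : w be = w be' by apply: phI => //; rewrite inE; [exists be|exists be'].
  by have [k [_]] := dio 0%N; rewrite ww mdistxx leNgt d0.
(* Cantor's diagonal: [D] differs from each sequence at the code of that sequence, including its
   own. *)
pose D k := ~~ `[< exists be, ph (w be) = k /\ be k >].
have [DD|nD] := boolP (D (ph (w D))).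
  by move: (DD) => /asboolP; apply; exists D.
by move: (nD); rewrite negbK => /asboolP[be [/inj ->]]; exact/negP.
Qed.

End Itineraries.

(** * Chaos from a solenoidal tower *)

Section Backward.
Context {R : realType} {G : metricType R}.
Context n0 (h : 'I_n0 -> R -> G) (g : 'I_n0 -> G -> R).
Hypothesis E : edges [set: G] h g.
Context (f : G -> G).
Hypothesis cf : continuous f.
Local Notation arc i a b := (h i @` `]a, b[%classic).
Local Notation cG := (graph_compact E).

Section Interval.
Context (J : nat -> set G) (m : nat -> nat) (i : 'I_n0) (a b : R) (z z' : G).
Hypothesis S : solenoid f J m.
Hypothesis ab : 0 < a /\ a < b < 1.
Hypothesis Jarc : forall n, J n `<=` arc i 0 1.
Hypothesis KE : \bigcap_n J n = h i @` `[a, b].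
Hypotheses (lz : lims (orb f z) (h i a)) (lz' : lims (orb f z') (h i b)).
Local Notation left := (left_part h J i a).
Local Notation right := (right_part h J i b).

(** From some level on all returns are on the left, or all are on the right, or both sides recur at
    every depth. The second case is the first one with the edges reversed. *)
Lemma covering_all N : covering h f J i a b N.
Proof.
have [a0 ab1] := ab.
have [[N0 H]|nl] := pselect (exists N0, forall j, (0 < j)%N -> (m N0 %| j)%N -> lft h f i a j).
  exact: (covering_left E cf S ab Jarc KE lz' H).
have [[N0 H]|nr] := pselect (exists N0, forall j, (0 < j)%N -> (m N0 %| j)%N -> rgt h f i a b j); last first.
  apply: (covering_both E cf S ab Jarc KE).
    move=> M; apply: contrapT => H; apply: nr; exists M => j j0 Mj.
    have [lj|//] := lft_or_rgt S ab Jarc KE j0 Mj.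
    by case: H; exists j.
  move=> M; apply: contrapT => H; apply: nl; exists M => j j0 Mj.
  have [//|lj] := lft_or_rgt S ab Jarc KE j0 Mj.
  by case: H; exists j.
pose h' (j : 'I_n0) (s : R) := h j (1 - s).
have ab' : 0 < 1 - b /\ 1 - b < 1 - a < 1 by lra.
have Jarc' n : J n `<=` h' i @` `]0, 1[.
  move=> x /Jarc[r /= + <-]; rewrite in_itv /= => r01.
  by exists (1 - r); rewrite /= ?in_itv /= /h' ?subKr //; lra.
have KE' : \bigcap_n J n = h' i @` `[1 - b, 1 - a].
  rewrite KE; apply/seteqP; split=> _ [r /= + <-]; rewrite in_itv /= => rab.
    by exists (1 - r); rewrite /= ?in_itv /= /h' ?subKr //; lra.
  by exists (1 - r); rewrite //= in_itv /=; lra.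
have lz1 : lims (orb f z) (h' i (1 - a)) by rewrite /h' subKr.
have [s [n [Nn L R1]]] : covering h' f J i (1 - b) (1 - a) N.
  apply: (covering_left (edges_flip E) cf S ab' Jarc' KE' lz1 (N0 := N0)).
  move=> j j0 Nj; have [r [rb e]] := rgt_right_end E cf S ab Jarc KE j0 Nj (H j j0 Nj).
  by exists (1 - r); rewrite /h' !subKr; split=> //; lra.
exists s, n; split=> //.
  apply: (subset_trans R1); apply: image_subset => x [Jx [r [ra xr]]]; split=> //; rewrite xr.
  by exists (1 - r); split=> //; lra.
apply: (subset_trans L); apply: image_subset => x [Jx [r [ra xr]]]; split=> //; rewrite xr.
by exists (1 - r); split=> //; lra.
Qed.

Lemma left_closed N : closed (left N).
Proof.
have [a0 ab1] := ab; have [H1 _ _ _ _] := S.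
have -> : left N = J N `&` h i @` `[0, a].
  apply/seteqP; split=> x [Jx].
    by move=> [r [ra xr]]; split=> //; exists r; [rewrite /= in_itv /=; lra|rewrite xr].
  move=> [r /= + rx]; rewrite in_itv /= => ra; split=> //; exists r; split=> //.
  have [t /= + tx] := Jarc Jx; rewrite in_itv /= => t01.
  have rt : r = t by apply: (edge_inj E (i := i)); [lra|lra|rewrite rx tx].
  lra.
by apply: closedI; [exact: (H1 N).1|apply: (edge_closed E); lra].
Qed.

Lemma right_closed N : closed (right N).
Proof.
have [a0 ab1] := ab; have [H1 _ _ _ _] := S.
have -> : right N = J N `&` h i @` `[b, 1].
  apply/seteqP; split=> x [Jx].
    by move=> [r [ra xr]]; split=> //; exists r; [rewrite /= in_itv /=; lra|rewrite xr].
  move=> [r /= + rx]; rewrite in_itv /= => ra; split=> //; exists r; split=> //.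
  have [t /= + tx] := Jarc Jx; rewrite in_itv /= => t01.
  have rt : r = t by apply: (edge_inj E (i := i)); [lra|lra|rewrite rx tx].
  lra.
by apply: closedI; [exact: (H1 N).1|apply: (edge_closed E); lra].
Qed.

Let ends n : J n (h i a) /\ J n (h i b).
Proof.
have [a0 ab1] := ab.
have H (r : R) : a <= r <= b -> J n (h i r).
  move=> rab; have : (\bigcap_n J n) (h i r) by rewrite KE; exists r => //=; rewrite in_itv.
  exact.
by split; apply: H; lra.
Qed.

Let sides_disjoint x : left 0 x -> ~ right 0 x.
Proof.
have [a0 ab1] := ab.
move=> [_ [r [ra ->]]] [_ [r' [rb e]]].
have : r = r' by apply: (edge_inj E (i := i)) e; lra.
lra.
Qed.

(** The levels [M k] are chosen so that both parts of each cover the next. The left parts shrink to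
    the point [h i a], which gives proximality, while left and right parts stay a fixed distance
    apart. *)
Lemma interval_chaotic : Li_Yorke_chaotic f.
Proof.
have [a0 ab1] := ab; have [H1 _ _ H4 _] := S.
have /choice[sn snP] : forall N, exists sn : nat * nat, [/\ (N < sn.2)%N,
    J sn.2 `<=` iter sn.1 f @` left N & J sn.2 `<=` iter sn.1 f @` right N].
  by move=> N; have [s [n H]] := covering_all N; exists (s, n).
pose M k := iter k (fun N => (sn N).2) 0%N.
have Mk k : (k <= M k)%N.
  by elim: k => // k IH; apply: leq_ltn_trans IH _; have [] := snP (M k).
pose C k (c : bool) := if c then right (M k) else left (M k).
have lsub N : left N `<=` left 0 by move=> x [/(sol_sub S (leq0n N))].
have rsub N : right N `<=` right 0 by move=> x [/(sol_sub S (leq0n N))].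
have CJ k c : C k c `<=` J (M k) by case: c => x [].
apply: (@itineraries_chaotic R G cG f cf C (fun k => (sn (M k)).1)).
- by move=> k [|]; [exact: right_closed|exact: left_closed].
- move=> k [|]; [exists (h i b)|exists (h i a)]; split; try exact: (ends _).1; try exact: (ends _).2.
    by exists b; split=> //; lra.
  by exists a; split=> //; lra.
- move=> k c c'; apply: (subset_trans (@CJ k.+1 c')); have [_ L Rr] := snP (M k).
  by case: c.
(* With time 0 the left part would contain a whole deeper level, and thus the point [h i b]. *)
- move=> k; rewrite lt0n; apply/eqP => e; have [_ L _] := snP (M k).
  move: L; rewrite e image_id => L; have := L _ (ends _).2 => bl.
  apply: (sides_disjoint (lsub _ _ bl)); split; first exact: (ends _).2.
  by exists b; split=> //; lra.
- have [|d d0 dP] := closed_disjoint_dist cG (@left_closed 0%N) (@right_closed 0%N).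
    by rewrite -subset0 => x [/sides_disjoint].
  by exists d => // k x y Cx Cy; apply: dP; [exact: (lsub (M k))|exact: (rsub (M k))].
- move=> e e0; have e20 : 0 < e / 2 by rewrite divr_gt0.
  have dl N : left N.+1 `<=` left N by move=> x [/H4 Jx Hx].
  have [|N NP] := nested_open cG (@left_closed) dl (@open_interior _ (ball (h i a) (e / 2))).
    move=> x xl; have [_ [r [ra xr]]] := xl 0%N I.
    have : (\bigcap_n J n) x by move=> n _; have [] := xl n I.
    rewrite KE => -[t /= + tx]; rewrite in_itv /= => tab.
    have rt : t = r by apply: (edge_inj E (i := i)); [lra|lra|rewrite tx xr].
    have -> : x = h i a by rewrite xr; congr (h i _); lra.
    exact: nbhsx_ballx.
  exists N => k x y Nk.
  have sub : left (M k) `<=` left N.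
    by move=> u [/(sol_sub S (leq_trans Nk (Mk k)))].
  move=> /sub/NP/interior_subset; rewrite ballEmdist /= => xa.
  move=> /sub/NP/interior_subset; rewrite ballEmdist /= => ya.
  have := metric_triangle x (h i a) y; rewrite (metric_sym x (h i a)); lra.
Qed.

End Interval.

Lemma solenoid_drop J m n : solenoid f J m -> solenoid f (fun k => J (n + k)%N) (fun k => m (n + k)%N).
Proof.
move=> [H1 H2 H3 H4 H5]; split=> [k|k|k|k|N]; [exact: H1|exact: H2|exact: H3| |].
  by have := H4 (n + k)%N; rewrite -addnS.
have [M MP] := H5 N; exists M => k Mk; apply: MP.
exact: leq_trans Mk (leq_addl _ _).
Qed.

(** The orbit would enter the intersection twice, although the images of the intersection are
    disjoint. *)
Lemma not_interior J m x z : solenoid f J m -> lims (orb f z) x -> ~ nbhs x (\bigcap_n J n).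
Proof.
move=> S lz nb; have [t [_ zt]] := lz _ nb 0%N; have [t' [tt' zt']] := lz _ nb t.+1.
have : (t' - t = 0)%N.
  apply: (sol_disjoint S (x := orb f z t')) => n _; last by rewrite image_id; exact: zt'.
  by exists (orb f z t); [exact: zt|rewrite -orbD subnK // ltnW].
by move/eqP; rewrite subn_eq0 leqNgt tt'.
Qed.

(** A point of the intersection outside [[a, b]] would make [h i a] or [h i b] interior to it,
    against [not_interior]; so the intersection is exactly this segment. *)
Lemma solenoid_chaotic J m i (a b : R) z z' : solenoid f J m -> 0 < a < b -> b < 1 ->
  (forall n, J n `<=` arc i 0 1) -> (forall n, J n (h i a) /\ J n (h i b)) ->
  lims (orb f z) (h i a) -> lims (orb f z') (h i b) -> Li_Yorke_chaotic f.
Proof.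
move=> S a0b b1 Jarc Jab lz lz'; have [H1 _ _ H4 _] := S.
have ab : 0 < a /\ a < b < 1 by split; lra.
apply: (interval_chaotic S ab Jarc _ lz lz').
have conv n (s t r : R) : 0 <= s -> t <= 1 -> s <= r <= t -> J n (h i s) -> J n (h i t) -> J n (h i r).
  move=> s0 t1 rst; apply: (arc_interval E (H1 n).2 _ s0 t1 rst).
  by apply: (subset_trans (Jarc n)); exact: arc_sub01.
have inner (s t r : R) : 0 <= s -> t <= 1 -> s < r < t -> (\bigcap_n J n) (h i s) -> (\bigcap_n J n) (h i t) ->
    nbhs (h i r) (\bigcap_n J n).
  move=> s0 t1 rst Js Jt; apply: (@filterS _ _ _ (arc i s t)).
    move=> _ [u /= + <-] n _; rewrite in_itv /= => ust.
    by apply: (conv n s t) => //; [lra|exact: Js|exact: Jt].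
  apply: open_nbhs_nbhs; split; first exact: (edge_open E).
  by exists r => //=; rewrite in_itv.
apply/seteqP; split=> x.
  move=> Kx; have [r /= + rx] := Jarc 0%N _ (Kx 0%N I); rewrite in_itv /= => r01.
  rewrite -rx in Kx *; exists r => //=; rewrite in_itv /=; apply/andP; split; rewrite leNgt; apply/negP => lt.
    apply: (not_interior S lz); apply: (inner r b) => //; [lra|lra|lra|].
    by move=> n _; exact: (Jab n).2.
  apply: (not_interior S lz'); apply: (inner a r) => //; [lra|lra|lra|].
  by move=> n _; exact: (Jab n).1.
move=> [r /= + <-] n _; rewrite in_itv /= => rab.
by apply: (conv n a b) => //; [lra|lra|exact: (Jab n).1|exact: (Jab n).2].
Qed.

Lemma NS_pair_Li_Yorke x y : NS_pair f x y -> Li_Yorke_chaotic f.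
Proof.
move=> /NS_pair_solenoid[J [m [S xy Jxy [z lzx] [z' lzy]]]].
pose V := [set v | exists i, v = h i 0 \/ v = h i 1].
have fV : finite_set V.
  apply: (@sub_finite_set _ _ (\bigcup_(i in [set: 'I_n0]) ([set h i 0] `|` [set h i 1]))).
    by move=> v [i Hv]; exists i.
  by apply: bigcup_finite => // i _; rewrite finite_setU; split; exact: finite_set1.
have Jx n := (Jxy n).1; have Jy n := (Jxy n).2.
have [k kV] := back_avoid S fV.
have S1 := back_solenoid E cf S k Jx.
have [x1 [lx1 x1x Jx1]] := back_point E cf S k Jx lzx.
have [y1 [ly1 y1y Jy1]] := back_point E cf S k Jy lzy.
have xy1 : x1 <> y1 by move=> e; apply: xy; rewrite -x1x -y1y e.
have [H1 _ _ H4 _] := S1.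
have acc : accessible_space G by apply: hausdorff_accessible; exact: metric_hausdorff.
have oV : open (~` V) by apply: closed_openC; exact: accessible_finite_set_closed.1.
(* By compactness a single level already avoids the vertices; earlier levels are dropped, and a
   connected set without vertices stays in one edge. *)
have [|n nP] := nested_open cG (fun n => (H1 n).1) H4 oV.
  by move=> v Kv Vv; exact: (kV v Vv Kv).
have S2 := solenoid_drop n S1.
have [i [s [s01 xs]]] := edge_cover E x1.
have nV j : ~ back f J m k n (h j 0) /\ ~ back f J m k n (h j 1).
  by split=> /nP; apply; exists j; [left|right].
have s01' : 0 < s < 1.
  apply/andP; split; rewrite lt_neqAle ?(andP s01).1 ?(andP s01).2 andbT; apply/eqP => e.
    by apply: (nV i).1; rewrite e -xs; exact: Jx1.
  by apply: (nV i).2; rewrite -e -xs; exact: Jx1.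
have Jarc k' : back f J m k (n + k')%N `<=` arc i 0 1.
  apply: (subset_trans (sol_sub S1 (leq_addr k' n))).
  apply: (trap_edge E (H1 n).2 (lexx 0) s01' (lexx 1) _ (nV i).1 (nV i).2).
  by rewrite -xs; exact: Jx1.
have := Jarc 0%N _ (Jy1 _) => -[t /= + ty]; rewrite in_itv /= => t01.
rewrite xs in lx1 Jx1; rewrite -ty in ly1 Jy1.
have [st|ts] := ltP s t.
  by apply: (solenoid_chaotic S2 _ _ Jarc _ lx1 ly1); [lra|lra|move=> j].
have ts' : t < s.
  by rewrite lt_neqAle ts andbT; apply/eqP => e; apply: xy1; rewrite xs -ty e.
by apply: (solenoid_chaotic S2 _ _ Jarc _ ly1 lx1); [lra|lra|move=> j].
Qed.

End Backward.

Theorem theorem1p1 (R : realType) (G : metricType R)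
    (hG : is_graph [set: G]) (f : G -> G) (hf : continuous f)
    (hent : topological_entropy f = 0%E) :
  Li_Yorke_chaotic f <-> exists x y : G, NS_pair f x y.
Proof.
have [n [h [g E]]] := graph_edges hG.
split; last by move=> [x [y xy]]; exact: (NS_pair_Li_Yorke E hf xy).
apply: (Li_Yorke_NS_pair E hf) => H.
exact: (horseshoe_entropy (graph_compact E) H hent).
Qed.
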